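(* Let $s \ge 5$ be an integer, let $\eta > 0$, and let $\mu_1, \ldots, \mu_s$ be real numbers with $\mu_1$ irrational. Put $F(x_1,\ldots,x_s) = (x_1-\mu_1)^3 + \cdots + (x_s-\mu_s)^3$. For $N > 0$ let $Z(N)$ denote the set of $\tau \in [0,N]$ for which there is no $\mathbf{x} \in \mathbb{Z}^s$ with $x_i > \mu_i$ for all $i$ and $|F(\mathbf{x}) - \tau| < \eta$. Then \[ \mathrm{meas}(Z(N)) = o(N) \qquad (N \to \infty), \] where $\mathrm{meas}$ denotes Lebesgue measure. *)

(* Defs.v *)
From HB Require Import structures.
From mathcomp Require Import all_boot all_order all_algebra.
From mathcomp Require Import all_classical all_reals all_analysis.

Set Implicit Arguments.
Unset Strict Implicit.
Unset Printing Implicit Defensive.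

Import Order.TTheory GRing.Theory Num.Theory.
Import numFieldNormedType.Exports.

Local Open Scope classical_set_scope.
Local Open Scope ring_scope.

Definition shifted_cubes (R : realType) (s : nat) (mu : 'I_s -> R)
    (x : 'I_s -> int) : R :=
  \sum_(i < s) ((x i)%:~R - mu i) ^+ 3.

(* Closed and contained in [0, N], hence measurable of finite measure: [fine]
   of its Lebesgue measure loses nothing. *)
Definition exceptional_set (R : realType) (s : nat) (eta : R) (mu : 'I_s -> R)
    (N : R) : set R :=
  [set tau | 0 <= tau <= N /\
    ~ exists x : 'I_s -> int,
        (forall i, mu i < (x i)%:~R) /\ `|shifted_cubes mu x - tau| < eta].

(* Main.v *)
(* The circle method with a discrete detector.  Put P = p^120, Q = p^80 and let
   x_2 run over Q ~ P^(2/3) values, the other four variables over P values near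
   P, so that two of the cubes already take 1-separated values and
   |T_1 T_2|^2 has a diagonal mean value.  On a grid of step < eta in a window
   [6 P^3, 10 P^3], the sum over x of a narrow Fejer kernel of order K ~ P^3 / eta
   is small at a bad grid point, whereas that of a wide kernel of bounded order k0
   is of the expected size everywhere.  By Parseval on the grid, the number of bad
   points is controlled by the energy of the difference, that is by
   |T_1 ... T_5|^2 at the points h / D.  Minor arcs: Weyl's inequality and the
   diagonal mean value.  Major arcs: Weyl differencing gives
   |T_i| << P q^(-1/4+e) (1 + P^3 |b|)^(-3/16), and the ten factors make the sum
   over arcs converge.  The finitely many arcs that remain after cutting the tail
   are treated with the irrationality of mu_1, which forces T_1 = o(P) on each of
   them.  Dyadic-like windows [4y/5, y] then give density zero. *)

Require Import Defs.
From HB Require Import structures.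
From mathcomp Require Import all_boot all_order all_algebra.
From mathcomp Require Import all_classical all_reals all_analysis.
From mathcomp Require Import complex zify ring lra.

Set Implicit Arguments.
Unset Strict Implicit.
Unset Printing Implicit Defensive.

Import Order.TTheory GRing.Theory Num.Theory.
Import numFieldNormedType.Exports.

Local Open Scope ring_scope.

(** * Additive characters *)

Section Exponential.
Variable R : realType.
Implicit Types (s t x y : R) (f : nat -> R).

Local Notation normc := (@Normc.normc R).
Local Notation Re := (@complex.Re R).
Local Notation Im := (@complex.Im R).

(** Frequencies near 0 carry the main term, so no bound on the exponential sum can make the energy
    small there. Subtracting the wide kernel removes them: the difference has coefficient at most
    [h / k0] at frequency [h], and a large [k0] disposes of the arc at 0 without asymptotic formula,
    singular series or singular integral. Irrationality then has to act only on finitely many arcs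
    around nonzero rationals. The size of [Q] is squeezed from two sides. Above P^(2/3) the cubes of
    x_2 would overrun the gaps of order P^2 between the cubes of x_1. On the minor arcs three Weyl
    bounds P^(3/2) and the mean value P^4 Q must beat P^8 Q^2, which asks for Q above P^(1/2). What
    is left is P^(1/6) = p^20. The integer [p] plays the part of P^epsilon: every logarithm and
    every divisor function is charged one factor [p], and the 20 spare factors pay for them.
    Dirichlet approximation uses denominators up to p^243 = P^2 p^3, and arcs are major up to p^117
    = P / p^3; the margins p^3 absorb numerical constants such as 12 in the major arc condition. *)

Definition expi (t : R) : R[i] := (cos (2 * pi * t) +i* sin (2 * pi * t))%C.

Lemma expiD s t : expi (s + t) = expi s * expi t.
Proof.
rewrite /expi mulrDr cosD sinD; apply/eqP; rewrite eq_complex /=.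
by apply/andP; split; apply/eqP; ring.
Qed.

Lemma normcE (z : R[i]) : normc z = Num.sqrt (Re z ^+ 2 + Im z ^+ 2).
Proof. by case: z. Qed.

Lemma normc_sqr (z : R[i]) : normc z ^+ 2 = Re z ^+ 2 + Im z ^+ 2.
Proof. by rewrite normcE sqr_sqrtr ?addr_ge0 ?sqr_ge0. Qed.

Lemma normc_ge0 (z : R[i]) : 0 <= normc z.
Proof. by rewrite normcE sqrtr_ge0. Qed.

Lemma normc_expi t : normc (expi t) = 1.
Proof. by rewrite normcE /= cos2Dsin2 sqrtr1. Qed.

Lemma expi0 : expi 0 = 1.
Proof. by rewrite /expi mulr0 cos0 sin0. Qed.

Lemma expi_nat n : expi n%:R = 1.
Proof.
elim: n => [|n IH]; first exact: expi0.
rewrite -natr1 expiD IH mul1r /expi mulr1 mulr_natl cos2pi sin2pi.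
by [].
Qed.

Lemma expi_int (m : int) : expi m%:~R = 1.
Proof.
case: m => n; first exact: expi_nat.
rewrite NegzE mulrNz; have : expi (n.+1%:R + - n.+1%:R) = 1 by rewrite subrr expi0.
by rewrite expiD expi_nat mul1r.
Qed.

Lemma normc_sum I (r : seq I) (P : pred I) (F : I -> R[i]) :
  normc (\sum_(i <- r | P i) F i) <= \sum_(i <- r | P i) normc (F i).
Proof.
elim/big_ind2: _ => [|x1 x2 y1 y2 h1 h2|i _] //; first by rewrite Normc.normc0.
by apply: le_trans (lerD h1 h2); exact: le_normcD.
Qed.

Lemma Re_sum I (r : seq I) (P : pred I) (F : I -> R[i]) :
  Re (\sum_(i <- r | P i) F i) = \sum_(i <- r | P i) Re (F i).
Proof. by apply: (big_morph Re _ _) => // -[? ?] [? ?]. Qed.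

Lemma Im_sum I (r : seq I) (P : pred I) (F : I -> R[i]) :
  Im (\sum_(i <- r | P i) F i) = \sum_(i <- r | P i) Im (F i).
Proof. by apply: (big_morph Im _ _) => // -[? ?] [? ?]. Qed.

Lemma Re_le_normc (z : R[i]) : `|Re z| <= normc z.
Proof. by rewrite normcE -sqrtr_sqr ler_sqrt ?lerDl ?addr_ge0 ?sqr_ge0. Qed.

Lemma cos_bilinear s t :
  cos (2 * pi * (s - t)) = Re (expi s) * Re (expi t) + Im (expi s) * Im (expi t).
Proof. by rewrite /= mulrBr cosB. Qed.

(** Induction on [n]: the new last term brings its correlations with all earlier terms, exactly one
    for each lag [h]. Grouping pairs by lag prepares Weyl differencing. *)
Lemma normc_sqr_expi_sum (n : nat) f :
  normc (\sum_(i < n) expi (f i)) ^+ 2 =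
  n%:R + 2 * \sum_(1 <= h < n) \sum_(i < n - h) cos (2 * pi * (f (i + h)%N - f i)).
Proof.
elim: n => [|n IH].
  by rewrite big_ord0 Normc.normc0 big_geq // expr0n mulr0 addr0.
have e1 : normc (\sum_(i < n.+1) expi (f i)) ^+ 2 =
   normc (\sum_(i < n) expi (f i)) ^+ 2 + 1
   + 2 * \sum_(i < n) cos (2 * pi * (f n - f i)).
  rewrite big_ord_recr /= !normc_sqr.
  set S := \sum_(i < n) _.
  have -> : \sum_(i < n) cos (2 * pi * (f n - f i)) =
      Re (expi (f n)) * Re S + Im (expi (f n)) * Im S.
    rewrite /S Re_sum Im_sum !mulr_sumr -big_split /=.
    by apply: eq_bigr => i _; rewrite cos_bilinear.
  have := cos2Dsin2 (2 * pi * f n).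
  case: S => a b /=; nra.
rewrite e1 IH -natr1.
suff -> : \sum_(1 <= h < n.+1) \sum_(i < n.+1 - h) cos (2 * pi * (f (i + h)%N - f i)) =
  \sum_(1 <= h < n) \sum_(i < n - h) cos (2 * pi * (f (i + h)%N - f i)) +
  \sum_(i < n) cos (2 * pi * (f n - f i)) by ring.
apply: esym; case: n {e1 IH} => [|n]; first by rewrite big_ord0 !big_geq // addr0.
rewrite [RHS]big_nat_recr //= subSnn.
have -> : \sum_(1 <= h < n.+1) \sum_(i < n.+2 - h) cos (2 * pi * (f (i + h)%N - f i)) =
  \sum_(1 <= h < n.+1) (\sum_(i < n.+1 - h) cos (2 * pi * (f (i + h)%N - f i)) +
     cos (2 * pi * (f n.+1 - f (n.+1 - h)%N))).
  apply: eq_big_nat => h /andP[h1 h2].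
  rewrite subSn; last lia.
  by rewrite big_ord_recr /= subnK // ltnW.
rewrite big_split -addrA; congr (_ + _).
rewrite big_ord1 big_ord_recl /= [RHS]addrC; congr (_ + _).
rewrite big_add1 /= big_mkord (reindex_inj rev_ord_inj) /=.
by apply: eq_bigr => i _; congr (cos (_ * (_ - f _))); rewrite /bump /=; have := ltn_ord i; lia.
Qed.

(** Weyl differencing: for each lag only the modulus of the differenced sum is kept, so a polynomial
    phase loses one degree. *)
Lemma vdc (n : nat) f :
  normc (\sum_(i < n) expi (f i)) ^+ 2 <=
  n%:R + 2 * \sum_(1 <= h < n) normc (\sum_(i < n - h) expi (f (i + h)%N - f i)).
Proof.
rewrite normc_sqr_expi_sum lerD2l ler_pM2l //.
apply: ler_sum => h _; apply: le_trans (Re_le_normc _).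
by rewrite Re_sum; exact: ler_norm.
Qed.

Lemma fejer_expansion (n : nat) t : (0 < n)%N ->
  normc (\sum_(i < n) expi (i%:R * t)) ^+ 2 / n%:R =
  1 + 2 * \sum_(1 <= h < n) (1 - h%:R / n%:R) * cos (2 * pi * (h%:R * t)).
Proof.
move=> n0; rewrite (normc_sqr_expi_sum n (fun i => i%:R * t)).
have nN : n%:R != 0 :> R by rewrite pnatr_eq0 -lt0n.
rewrite mulrDl divff // -mulrA mulr_suml; congr (_ + _ * _).
apply: eq_big_nat => h /andP[h1 h2].
rewrite (eq_bigr (fun=> cos (2 * pi * (h%:R * t)))); last first.
  by move=> i _; rewrite natrD; congr (cos _); ring.
rewrite sumr_const card_ord -[cos _ *+ _]mulr_natr natrB ?(ltnW h2) //.
by field.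
Qed.

Lemma normc_expiB s t : normc (expi s - expi t) = 2 * `|sin (pi * (s - t))|.
Proof.
have -> : 2 * `|sin (pi * (s - t))| = Num.sqrt ((2 * sin (pi * (s - t))) ^+ 2).
  by rewrite sqrtr_sqr normrM ger0_norm.
rewrite normcE; congr Num.sqrt.
have h1 := cos2Dsin2 (2 * pi * s); have h2 := cos2Dsin2 (2 * pi * t).
have h3 : cos (2 * pi * (s - t)) = 1 - 2 * sin (pi * (s - t)) ^+ 2.
  have -> : 2 * pi * (s - t) = (pi * (s - t)) *+ 2 by rewrite -mulr_natl; ring.
  by rewrite cos_mulr2n cos2sin2 -mulr_natl; ring.
rewrite cos_bilinear /= in h3.
rewrite /=; nra.
Qed.

Lemma sin_le_id x : 0 <= x -> sin x <= x.
Proof.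
move=> x0; have [->|xN] := eqVneq x 0; first by rewrite sin0.
have xp : 0 < x by rewrite lt_neqAle eq_sym xN.
have [c _] := @MVT R (@sin R) (@cos R) 0 x xp (fun y _ => is_derive_sin y)
  (continuous_subspaceT (@continuous_sin R)).
 rewrite sin0 !subr0 => ->.
by rewrite ler_piMl // cos_le1.
Qed.

Lemma normr_sin_le x : `|sin x| <= `|x|.
Proof.
wlog x0 : x / 0 <= x => [hw|].
  have [/hw//|/ltW] := leP 0 x; rewrite -oppr_ge0 => /hw.
  by rewrite sinN !normrN.
rewrite [X in _ <= X]ger0_norm //; have [h|h] := leP x 1.
  rewrite ger0_norm ?sin_le_id // sin_ge0_pi // x0 (le_trans h) //.
  by have := pi_ge2 R; lra.
exact: le_trans (sin_max _) (ltW h).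
Qed.

Lemma normc_expiB_le s t : normc (expi s - expi t) <= 8 * `|s - t|.
Proof.
rewrite normc_expiB; apply: le_trans (_ : 2 * (`|pi * (s - t)|) <= _).
  by rewrite ler_pM2l // normr_sin_le.
rewrite normrM ger0_norm ?pi_ge0 // mulrA ler_wpM2r //.
by have := @pihalf_lt2 R; lra.
Qed.

Lemma sin_ge_half x : 0 <= x <= pi / 2 -> x / 4 <= sin x.
Proof.
move=> /andP[x0 x2]; have pi4 := @pihalf_lt2 R; have pi2 := @pi_ge2 R.
have [->|xN] := eqVneq x 0; first by rewrite sin0 mul0r.
have xp : 0 < x by rewrite lt_neqAle eq_sym xN.
(* On [0, 1] the mean value theorem gives slope at least cos 1 >= 1/2; beyond 1, monotonicity gives
   sin x > sin 1 >= 1/2 >= x / 4. *)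
have c1 : 1/2 <= cos 1 :> R.
  have h : cos (1/2 *+ 2 : R) = 1 - 2 * sin (1/2) ^+ 2.
    by rewrite cos_mulr2n cos2sin2 -mulr_natl; ring.
  have -> : 1 = 1/2 *+ 2 :> R by rewrite -mulr_natl; field.
  rewrite h.
  have := @sin_le_id (1/2) ltac:(lra); have := @sin_ge0_pi R (1/2) ltac:(lra).
  nra.
have base y : 0 < y <= 1 -> y / 2 <= sin y.
  move=> /andP[y0 y1].
  have [c] := @MVT R (@sin R) (@cos R) 0 y y0 (fun y _ => is_derive_sin y)
    (continuous_subspaceT (@continuous_sin R)).
  rewrite in_itv /= => /andP[c0 cy]; rewrite sin0 !subr0 => ->.
  rewrite mulrC ler_wpM2r ?(ltW y0) //.
  have -> : 2^-1 = 1 / 2 :> R by rewrite mul1r.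
  apply: le_trans c1 _; rewrite ltW // ltr_cos ?in_itv /=; lra.
have [h|h] := leP x 1; first by have := base x ltac:(lra); lra.
have := base 1 ltac:(lra).
have : sin 1 < sin x by rewrite ltr_sin ?in_itv /=; lra.
lra.
Qed.

End Exponential.

(** * Distance to the nearest integer and sums over spaced points *)

Section Separation.
Variable R : realType.
Implicit Types (s t V : R).

Local Notation normc := (@Normc.normc R).

(** Distance to the nearest integer, with the floor of [t + 1 / 2] as the nearest integer, so that
    no infimum over integers is handled. *)
Definition dZ (t : R) : R := `|t - (Num.floor (t + 1 / 2))%:~R|.

Lemma floor_half t : - (1 / 2) <= t - (Num.floor (t + 1 / 2))%:~R < 1 / 2.
Proof. by have := floor_itv (t + 1 / 2); rewrite intrD /=; lra. Qed.

Lemma dZ_le_half t : dZ t <= 1 / 2.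
Proof. by rewrite /dZ ler_norml; have := floor_half t; lra. Qed.

Lemma dZ_ge0 t : 0 <= dZ t. Proof. exact: normr_ge0. Qed.

Lemma dZ_le t (m : int) : dZ t <= `|t - m%:~R|.
Proof.
have [->//|neq] := eqVneq m (Num.floor (t + 1 / 2)).
apply: le_trans (dZ_le_half t) _.
have h : 1 <= `|(m - Num.floor (t + 1 / 2))%:~R| :> R.
  by rewrite -intr_norm (ler_int _ 1) -gtz0_ge1 normr_gt0 subr_eq0.
have := floor_half t; move: h; rewrite intrB.
set k := (Num.floor _)%:~R; set m' := m%:~R => h /andP[h1 h2].
have [u|u] := ler0P (m' - k); have [v|v] := ler0P (t - m');
  move: h; rewrite ?(ler0_norm u) ?(gtr0_norm u); lra.
Qed.

Lemma dZDint t (m : int) : dZ (t + m%:~R) = dZ t.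
Proof.
apply/eqP; rewrite eq_le; apply/andP; split.
  apply: le_trans (dZ_le _ (Num.floor (t + 1 / 2) + m)) _.
  by rewrite intrD opprD addrACA subrr addr0.
apply: le_trans (dZ_le _ (Num.floor (t + m%:~R + 1 / 2) - m)) _.
rewrite intrB /dZ; set k := _%:~R; have -> : t - (k - m%:~R) = t + m%:~R - k by ring.
by [].
Qed.

Lemma dZ_triangle s t : dZ s <= dZ t + `|s - t|.
Proof.
apply: le_trans (dZ_le s (Num.floor (t + 1 / 2))) _.
have -> : s - (Num.floor (t + 1 / 2))%:~R = (t - (Num.floor (t + 1 / 2))%:~R) + (s - t) by ring.
exact: ler_normD.
Qed.

Lemma dZN t : dZ (- t) = dZ t.
Proof.
have h s : dZ (- s) <= dZ s.
  apply: le_trans (dZ_le _ (- Num.floor (s + 1 / 2))) _.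
  by rewrite mulrNz -opprD normrN.
by apply/eqP; rewrite eq_le h -{1}[t]opprK h.
Qed.

Lemma dZ_small t : `|t| <= 1 / 2 -> dZ t = `|t|.
Proof.
move=> h; apply/eqP; rewrite eq_le; apply/andP; split.
  by have := dZ_le t 0; rewrite subr0.
rewrite /dZ; have [->|neq] := eqVneq (Num.floor (t + 1 / 2)) 0; first by rewrite subr0.
have : 1 <= `|(Num.floor (t + 1 / 2))%:~R| :> R.
  by rewrite -intr_norm (ler_int _ 1) -gtz0_ge1 normr_gt0.
move: h; set k := (Num.floor _)%:~R => h1 h2.
have := ler_normB (t - k) t; rewrite addrAC subrr add0r normrN; lra.
Qed.

(** Multiplied by [q], the distance to any integer becomes the absolute value of a nonzero
    integer. *)
Lemma dZ_rat (a : int) (q : nat) (m : int) : (0 < q)%N ->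
  ~~ (q%:Z %| a * m)%Z -> q%:R^-1 <= dZ (a%:~R / q%:R * m%:~R).
Proof.
move=> q0 nd; rewrite /dZ; set k := Num.floor _.
have qp : 0 < q%:R :> R by rewrite ltr0n.
rewrite -[X in X <= _]mul1r ler_pdivrMr //.
have {2}-> : q%:R = `|q%:R| :> R by rewrite ger0_norm // ltW.
rewrite -normrM.
have -> : (a%:~R / q%:R * m%:~R - k%:~R) * q%:R = (a * m - k * q%:Z)%:~R :> R.
  by rewrite intrB !intrM -pmulrn; field; rewrite gt_eqF.
rewrite -intr_norm (ler_int _ 1) -gtz0_ge1 normr_gt0 subr_eq0.
by apply: contra nd => /eqP ->; rewrite dvdz_mull.
Qed.

(* A smooth version of [min V (1 / dZ t)], equivalent to it up to a factor 2. *)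
Definition mm V t : R := V / (1 + V * dZ t).

Lemma mm_ge0 V t : 0 <= V -> 0 <= mm V t.
Proof. by move=> V0; rewrite divr_ge0 // addr_ge0 // mulr_ge0 // dZ_ge0. Qed.

Lemma mm_le_inv V t x : 0 <= V -> 0 < x <= dZ t -> mm V t <= x^-1.
Proof.
move=> V0 /andP[x0 xd]; rewrite ler_pdivrMr; last by nra.
rewrite mulrC ler_pdivlMr //; nra.
Qed.

Lemma expi_geom_mul (n : nat) t b :
  (\sum_(i < n) expi (i%:R * t + b)) * (1 - expi t) = expi b - expi (n%:R * t + b).
Proof.
elim: n => [|k IH]; first by rewrite big_ord0 mul0r mul0r add0r subrr.
rewrite big_ord_recr /= mulrDl IH mulrBr mulr1 -expiD.
have -> : k%:R * t + b + t = k.+1%:R * t + b by rewrite -natr1; ring.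
by rewrite addrA subrK.
Qed.

Lemma dZ_le_normc_expi t : dZ t <= normc (1 - expi t).
Proof.
set k := Num.floor (t + 1 / 2).
have -> : expi t = expi (t - k%:~R) by rewrite -[RHS]mulr1 -(expi_int R k) -expiD subrK.
rewrite -(expi0 R) normc_expiB sub0r.
rewrite /dZ -/k; set u := t - k%:~R.
have -> : `|sin (pi * - u)| = `|sin (pi * `|u|)|.
  have [h|h] := ler0P u; rewrite ?(ler0_norm h) ?(gtr0_norm h) //.
  by rewrite mulrN sinN normrN.
have u2 : `|u| <= 1 / 2 := dZ_le_half t.
have := @sin_ge_half R (pi * `|u|); have := normr_ge0 u; have := @pi_ge2 R.
have := ler_norm (sin (pi * `|u|)); nra.
Qed.

(** The trivial bound n and the geometric bound 2 / [dZ t] combine into |S| (1 + n [dZ t]) <= n + 2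
    n, whence the constant 3. *)
Lemma normc_expi_geom (n : nat) t b :
  normc (\sum_(i < n) expi (i%:R * t + b)) <= 3 * mm n%:R t.
Proof.
set S := \sum_(i < n) _.
have Sn : normc S <= n%:R.
  apply: le_trans (normc_sum _ _ _) _; under eq_bigr do rewrite normc_expi.
  by rewrite sumr_const card_ord.
have Sd : normc S * dZ t <= 2.
  apply: le_trans (ler_wpM2l (normc_ge0 _) (dZ_le_normc_expi t)) _.
  rewrite -Normc.normcM expi_geom_mul.
  have := @le_normcD R (expi b) (- expi (n%:R * t + b)).
  by rewrite normcN !normc_expi.
rewrite mulrA ler_pdivlMr; last by have := dZ_ge0 t; have := ler0n R n; nra.
by have := dZ_ge0 t; have := ler0n R n; nra.
Qed.

Definition harm (n : nat) : R := \sum_(1 <= r < n.+1) r%:R^-1.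

Lemma harm_ge0 n : 0 <= harm n.
Proof. by apply: sumr_ge0 => i _; rewrite invr_ge0. Qed.

Lemma harm_mono m n : (m <= n)%N -> harm m <= harm n.
Proof.
move=> mn; rewrite /harm [leRHS](@big_cat_nat _ _ _ m.+1) //= lerDl.
by apply: sumr_ge0 => i _; rewrite invr_ge0.
Qed.

Lemma harm_exp2 k : harm (2 ^ k) <= k.+1%:R.
Proof.
elim: k => [|k IH]; first by rewrite /harm big_nat1 invr1.
have h : (2 ^ k < 2 ^ k.+1)%N by rewrite ltn_exp2l.
have -> : k.+2%:R = k.+1%:R + 1 :> R by rewrite natr1.
rewrite /harm (@big_cat_nat _ _ _ (2 ^ k).+1) ?ltnS ?(ltnW h) //=; apply: lerD; first exact: IH.
have e1 : \sum_((2 ^ k).+1 <= i < (2 ^ k.+1).+1) (2 ^ k)%:R^-1 = 1 :> R.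
  rewrite sumr_const_nat subSS expnS mul2n -addnn addnK.
  by rewrite -[_^-1 *+ _]mulr_natr mulVf // pnatr_eq0 -lt0n expn_gt0.
rewrite -[leRHS]e1; apply: ler_sum_nat => i /andP[h1 _].
by rewrite lef_pV2 ?posrE ?ltr0n ?expn_gt0 ?ler_nat ?(ltnW h1) // (leq_trans _ h1).
Qed.

(** A logarithm costs one factor [p]: since p < 2^p, n is at most 2^(p c), and each dyadic block of
    the harmonic sum contributes at most 1. *)
Lemma harm_le_pow (p c n : nat) : (0 < p)%N -> (n <= p ^ c)%N ->
  harm n <= c.+1%:R * p%:R.
Proof.
move=> p0 h; have h2 : (n <= 2 ^ (p * c))%N.
  apply: leq_trans h _; rewrite expnM; case: c => // c; rewrite leq_exp2r //.
  exact: ltnW (ltn_expl _ _).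
apply: le_trans (harm_mono h2) _; apply: le_trans (harm_exp2 _) _.
by rewrite -natrM ler_nat mulSn mulnC -addn1 addnC leq_add2r.
Qed.

(** Pigeonhole: the residues in [-1/2, 1/2) are sorted by sign and by the integer part r of 2 q |u|.
    Separation allows one point per cell; a point in cell r > 0 contributes at most 2 q / r, one in
    cell 0 at most V, and the two signs double the total. *)
Lemma separation (I : finType) (A : {set I}) (t : I -> R) (q : nat) V :
  (0 < q)%N -> 0 <= V ->
  {in A &, forall i j, i != j -> (2 * q%:R)^-1 <= dZ (t i - t j)} ->
  \sum_(i in A) mm V (t i) <= 2 * V + 4 * q%:R * harm q.
Proof.
move=> q0 V0 sep; have qp : 0 < q%:R :> R by rewrite ltr0n.
pose u i := t i - (Num.floor (t i + 1 / 2))%:~R.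
have uL i : (Num.truncn (`|u i| * (2 * q%:R)) < q.+1)%N.
  rewrite ltnS -(ler_nat R).
  have h := truncn_le (`|u i| * (2 * q%:R)).
  have h0 : 0 <= `|u i| * (2 * q%:R) by rewrite mulr_ge0 // mulr_ge0 // ltW.
  rewrite h0 in h; apply: le_trans h _.
  by have := dZ_le_half (t i); rewrite /dZ -/(u i); nra.
pose phi i : bool * 'I_q.+1 := (u i < 0, Ordinal (uL i)).
have phi_inj : {in A &, injective phi}.
  move=> i j iA jA [] e1 e2; apply/eqP; apply/negPn/negP => ij.
  have := sep i j iA jA ij; apply/negP; rewrite -ltNge.
  apply: le_lt_trans (_ : `|u i - u j| < _).
    apply: le_trans (dZ_le _ (Num.floor (t i + 1 / 2) - Num.floor (t j + 1 / 2))) _.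
    by rewrite intrB /u le_eqVlt; apply/orP; left; apply/eqP; congr (`|_|); ring.
  have q2 : 0 < 2 * q%:R :> R by rewrite mulr_gt0.
  rewrite -[X in _ < X]mul1r ltr_pdivlMr //.
  have := truncn_itv (mulr_ge0 (normr_ge0 (u i)) (ltW q2)).
  have := truncn_itv (mulr_ge0 (normr_ge0 (u j)) (ltW q2)).
  rewrite e2 -[(Num.truncn _).+1%:R]natr1; set r := (Num.truncn _)%:R.
  have [ui|ui] := boolP (u i < 0); rewrite ?ui ?(negbTE ui) in e1; symmetry in e1.
    rewrite (ltr0_norm ui) (ltr0_norm e1) => hi hj.
    have [w|w] := ler0P (u i - u j); lra.
  move/negbT: e1; move: ui; rewrite -!leNgt => ui uj; rewrite (ger0_norm ui) (ger0_norm uj) => hi hj.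
  have [w|w] := ler0P (u i - u j); lra.
have step i : mm V (t i) <= V / (1 + V * ((phi i).2%:R / (2 * q%:R))).
  rewrite /mm /= ler_wpM2l // lef_pV2 ?posrE; first last.
  - by rewrite ltr_pwDl // mulr_ge0 // divr_ge0 // mulr_ge0 // ltW.
  - by rewrite ltr_pwDl // mulr_ge0 // dZ_ge0.
  rewrite lerD2l ler_wpM2l // ler_pdivrMr ?mulr_gt0 // truncn_le.
  by rewrite mulr_ge0 // mulr_ge0 // ltW.
pose g (y : bool * 'I_q.+1) : R := V / (1 + V * (y.2%:R / (2 * q%:R))).
have g0 y : 0 <= g y.
  by rewrite divr_ge0 // addr_ge0 // mulr_ge0 // divr_ge0 // mulr_ge0 // ltW.
apply: le_trans (_ : \sum_(i in A) g (phi i) <= _); first exact: ler_sum.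
rewrite -(big_imset g phi_inj) /=.
apply: le_trans (_ : \sum_(y : bool * 'I_q.+1) g y <= _).
  by rewrite [leRHS](bigID (mem [set phi x | x in A])) /= lerDl sumr_ge0.
rewrite -(pair_big xpredT xpredT (fun b i => g (b, i))) /= big_bool /=.
suff : \sum_(i < q.+1) g (true, i) <= V + 2 * q%:R * harm q.
  by have -> : \sum_(i < q.+1) g (false, i) = \sum_(i < q.+1) g (true, i) by []; lra.
rewrite big_ord_recl /= {1}/g /= mul0r mulr0 addr0 divr1 lerD2l.
rewrite /harm big_add1 /= big_mkord mulr_sumr; apply: ler_sum => i _.
rewrite /g /= /bump /= add1n.
have i0 : 0 < i.+1%:R :> R by rewrite ltr0n.
rewrite ler_pdivrMr; last by rewrite ltr_pwDl // mulr_ge0 // divr_ge0 ?mulr_ge0 ?(ltW qp) ?(ltW i0).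
rewrite mulrDr mulr1.
have -> : 2 * q%:R / i.+1%:R * (V * (i.+1%:R / (2 * q%:R))) = V.
  by field; rewrite !gt_eqF.
by rewrite lerDr divr_ge0 ?mulr_ge0 ?(ltW qp) ?(ltW i0).
Qed.

Lemma sum_blocks (f : nat -> R) (b B : nat) C :
  (forall k, \sum_(i < b) f (k * b + i)%N <= C) ->
  \sum_(n < B * b) f n <= B%:R * C.
Proof.
move=> h; elim: B => [|B IH]; first by rewrite mul0n big_ord0 mul0r.
rewrite mulSn addnC big_split_ord /= -natr1 mulrDl mul1r.
by apply: lerD IH (h _).
Qed.

(** Within a block of [uphalf q] consecutive indices, two of them differ by some m with 0 < 2 m < q.
    Then a m / q is at least 1 / q away from the integers and theta m differs from it by at most 1 /
    (2 q), so each block is spaced enough for [separation]. *)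
Lemma sum_mm_rat (theta : R) (a : int) (q N : nat) V :
  (0 < q)%N -> 0 <= V -> coprimez a q%:Z ->
  `|theta - a%:~R / q%:R| <= (q%:R ^+ 2)^-1 ->
  \sum_(n < N) mm V (theta * n%:R) <= (2 * N%:R / q%:R + 1) * (2 * V + 4 * q%:R * harm q).
Proof.
move=> q0 V0 cop app; have qp : 0 < q%:R :> R by rewrite ltr0n.
pose b := uphalf q; have b0 : (0 < b)%N by rewrite /b; lia.
have C0 : 0 <= 2 * V + 4 * q%:R * harm q.
  by rewrite addr_ge0 ?mulr_ge0 ?harm_ge0 ?(ltW qp).
apply: le_trans (_ : (N %/ b).+1%:R * (2 * V + 4 * q%:R * harm q) <= _); last first.
  apply: ler_wpM2r => //; rewrite -natr1 lerD2r ler_pdivlMr // -!natrM ler_nat.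
  apply: leq_trans (_ : (N %/ b * (b * 2) <= _)%N); first by rewrite leq_mul2l; lia.
  by rewrite mulnA mulnC leq_mul2l leq_divM orbT.
apply: le_trans (@sum_blocks (fun n => mm V (theta * n%:R)) b (N %/ b).+1 _ _); last first.
  move=> k; rewrite (eq_bigl (mem [set: 'I_b])); last by move=> i /=; rewrite finset.in_setT.
  apply: separation => // i j _ _ ij.
  wlog ji : i j ij / (j < i)%N => [hw|].
    have [|h] := ltnP j i; first exact: hw.
    rewrite -dZN opprB.
    by apply: hw; rewrite 1?eq_sym // ltn_neqAle h andbT.
  pose m := (i - j)%N.
  have -> : theta * (k * b + i)%:R - theta * (k * b + j)%:R = theta * m%:R.
    by rewrite /m natrB ?(ltnW ji) // !natrD; ring.
  have m0 : (0 < m)%N by rewrite /m subn_gt0.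
  have m2 : (2 * m < q)%N by have := ltn_ord i; rewrite /m /b; lia.
  have := @dZ_rat a q m%:Z q0; have -> : (q%:Z %| a * m%:Z)%Z = false.
    rewrite Gauss_dvdzr; last by rewrite coprimez_sym.
    by apply/negP => /dvdn_leq; rewrite m0 /= => /(_ isT); lia.
  move=> /(_ isT); rewrite -pmulrn.
  have h2 := dZ_triangle (a%:~R / q%:R * m%:R) (theta * m%:R).
  have h3 : `|a%:~R / q%:R * m%:R - theta * m%:R| <= (2 * q%:R)^-1.
    rewrite -mulrBl normrM distrC [`|m%:R|]ger0_norm //.
    apply: le_trans (ler_wpM2r _ app) _ => //.
    rewrite ler_pdivrMl ?exprn_gt0 //.
    have -> : q%:R ^+ 2 / (2 * q%:R) = q%:R / 2 :> R by field; rewrite gt_eqF.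
    by rewrite ler_pdivlMr // -natrM ler_nat; lia.
  have h4 : (2 * q%:R)^-1 = q%:R^-1 / 2 :> R by field; rewrite gt_eqF.
  lra.
rewrite -!(big_mkord xpredT (fun n => mm V (theta * n%:R))).
rewrite [leRHS](@big_cat_nat _ _ _ N) //=.
  by rewrite lerDl sumr_ge0 // => i _; exact: mm_ge0.
by rewrite ltnW // ltn_ceil.
Qed.

End Separation.

(** * Weyl differencing and the divisor bound *)

Section Weyl.
Variable R : realType.
Local Notation normc := (@Normc.normc R).

(** Lagrange's identity: twice the difference of the two sides is a double sum of squares. *)
Lemma CauchySchwarz_sum (I : Type) (r : seq I) (P : pred I) (a b : I -> R) :
  (\sum_(i <- r | P i) a i * b i) ^+ 2 <=
  (\sum_(i <- r | P i) a i ^+ 2) * (\sum_(i <- r | P i) b i ^+ 2).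
Proof.
have h : 0 <= \sum_(i <- r | P i) \sum_(j <- r | P j) (a i * b j - a j * b i) ^+ 2.
  by apply: sumr_ge0 => i _; apply: sumr_ge0 => j _; exact: sqr_ge0.
have e : \sum_(i <- r | P i) \sum_(j <- r | P j) (a i * b j - a j * b i) ^+ 2 =
  \sum_(i <- r | P i) \sum_(j <- r | P j) (a i ^+ 2 * b j ^+ 2)
  + \sum_(i <- r | P i) \sum_(j <- r | P j) (b i ^+ 2 * a j ^+ 2)
  - 2 * \sum_(i <- r | P i) \sum_(j <- r | P j) ((a i * b i) * (a j * b j)).
  rewrite mulr_sumr -big_split /= -sumrB; apply: eq_bigr => i _.
  rewrite mulr_sumr -big_split /= -sumrB; apply: eq_bigr => j _; ring.
by move: h; rewrite e -!big_distrlr /=; nra.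
Qed.

Lemma sqr_sum_nat (n : nat) (a : nat -> R) :
  (\sum_(1 <= h < n) a h) ^+ 2 <= n%:R * \sum_(1 <= h < n) a h ^+ 2.
Proof.
have := CauchySchwarz_sum (index_iota 1 n) xpredT (fun=> 1) a.
rewrite (eq_bigr a) => [h|i _]; last by rewrite mul1r.
apply: le_trans h _; apply: ler_wpM2r; first by apply: sumr_ge0 => i _; exact: sqr_ge0.
by rewrite expr1n sumr_const_nat ler_nat leq_subr.
Qed.

Lemma mm_mono (V W t : R) : 0 <= V <= W -> mm V t <= mm W t.
Proof.
move=> /andP[V0 VW]; have d0 := dZ_ge0 t; rewrite /mm ler_pdivrMr; last by nra.
rewrite mulrAC ler_pdivlMr; nra.
Qed.

(** Two differencings leave a linear phase of slope 6 alpha h k. The shift [c] survives only in its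
    constant term, so the bound is uniform over real shifts. *)
Lemma weyl_cube (n : nat) (alpha c : R) :
  normc (\sum_(i < n) expi (alpha * (i%:R + c) ^+ 3)) ^+ 4 <=
  10 * n%:R ^+ 3
  + 48 * n%:R * \sum_(1 <= h < n) \sum_(1 <= k < n) mm n%:R (6 * alpha * h%:R * k%:R).
Proof.
pose f (i : nat) := alpha * (i%:R + c) ^+ 3.
pose S h := normc (\sum_(i < n - h) expi (f (i + h)%N - f i)).
have h1 : normc (\sum_(i < n) expi (f i)) ^+ 2 <= n%:R + 2 * \sum_(1 <= h < n) S h.
  exact: vdc.
have hS h : S h ^+ 2 <= n%:R + 6 * \sum_(1 <= k < n) mm n%:R (6 * alpha * h%:R * k%:R).
  apply: le_trans (vdc (n - h) (fun i => f (i + h)%N - f i)) _.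
  apply: lerD; first by rewrite ler_nat leq_subr.
  rewrite (_ : 6 * \sum_(1 <= k < n) _ = 2 * (3 * \sum_(1 <= k < n) mm n%:R (6 * alpha * h%:R * k%:R))); last by ring.
  rewrite ler_pM2l // mulr_sumr.
  apply: le_trans (_ : \sum_(1 <= k < n - h) 3 * mm n%:R (6 * alpha * h%:R * k%:R) <= _).
    apply: ler_sum => k _.
    have e (i : nat) : f (i + k + h)%N - f (i + k)%N - (f (i + h)%N - f i) =
        i%:R * (6 * alpha * h%:R * k%:R)
        + alpha * h%:R * k%:R * (6 * c + 3 * h%:R + 3 * k%:R).
      by rewrite /f !natrD; ring.
    under eq_bigr => i _ do rewrite e.
    apply: le_trans (normc_expi_geom _ _ _) _; rewrite ler_pM2l //.
    by apply: mm_mono; rewrite ler0n ler_nat -subnDA leq_subr.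
  have [nh|nh] := leqP 1 (n - h); last first.
    by rewrite big_geq 1?ltnW // sumr_ge0 // => k _; rewrite mulr_ge0 // mm_ge0.
  rewrite [leRHS](@big_cat_nat _ _ _ (n - h)) ?leq_subr //= lerDl.
  by apply: sumr_ge0 => k _; rewrite mulr_ge0 // mm_ge0.
set B := \sum_(1 <= h < n) \sum_(1 <= k < n) _.
have h2 : (\sum_(1 <= h < n) S h) ^+ 2 <= n%:R * (n%:R * n%:R + 6 * B).
  apply: le_trans (sqr_sum_nat _ _) _; apply: ler_wpM2l => //.
  apply: le_trans (ler_sum _ (fun h _ => hS h)) _.
  rewrite big_split /= -mulr_sumr lerD2r sumr_const_nat -[leLHS]mulr_natr.
  by rewrite ler_wpM2l // ler_nat leq_subr.
have S0 : 0 <= \sum_(1 <= h < n) S h by apply: sumr_ge0 => h _; exact: normc_ge0.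
have -> : normc (\sum_(i < n) expi (alpha * (i%:R + c) ^+ 3)) ^+ 4 =
  (normc (\sum_(i < n) expi (f i)) ^+ 2) ^+ 2 by rewrite -exprM.
set T2 := normc _ ^+ 2 in h1 *; have T20 : 0 <= T2 by exact: sqr_ge0.
set SS := \sum_(1 <= h < n) S h in h1 h2 S0.
apply: le_trans (_ : (n%:R + 2 * SS) ^+ 2 <= _).
  by rewrite ler_sqr ?nnegrE // addr_ge0 // mulr_ge0.
have n2 : n%:R ^+ 2 <= n%:R ^+ 3 :> R.
  by rewrite -!natrX ler_nat; case: (n) => // m; rewrite leq_pexp2l.
(* (n + 2 S)^2 <= 2 n^2 + 8 S^2 together with S^2 <= n (n^2 + 6 B) produces the constants 10 and
   48. *)
have := sqr_ge0 (n%:R - 2 * SS); nra.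
Qed.

End Weyl.

Section DivisorBound.
Local Open Scope nat_scope.

Definition ndiv n := size (divisors n).

Lemma ndiv_part p n : prime p -> 0 < n ->
  ndiv n <= (logn p n).+1 * ndiv n`_p^'.
Proof.
move=> pp n0; rewrite /ndiv.
apply: leq_trans (_ : size [seq p ^ i * e | i <- iota 0 (logn p n).+1, e <- divisors n`_p^'] <= _);
  last by rewrite size_allpairs size_iota.
apply: uniq_leq_size; first exact: divisors_uniq.
move=> e; rewrite -dvdn_divisors // => en.
have e0 : 0 < e by exact: dvdn_gt0 en.
apply/allpairsP; exists (logn p e, e`_p^'); split.
- by rewrite mem_iota add0n ltnS dvdn_leq_log.
- by rewrite -dvdn_divisors ?part_gt0 // partn_dvd.
- by rewrite -p_part partnC.
Qed.

(** Powers of a + 1 against 2^a, by doubling the exponent: passing from [a] to its half squares the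
    inductive bound and costs only a constant. *)
Lemma succ_expn_le i : exists c, forall a, a.+1 ^ (2 ^ i) <= c * 2 ^ a.
Proof.
elim: i => [|i [c IH]].
  by exists 1 => a; rewrite expn0 expn1 mul1n ltn_expl.
exists (2 ^ (2 ^ i.+1) * (c * c)) => a.
apply: leq_trans (_ : (2 * (a./2).+1) ^ (2 ^ i.+1) <= _).
  by rewrite leq_exp2r ?expn_gt0 //; lia.
rewrite expnMn -mulnA leq_mul2l; apply/orP; right.
rewrite expnS mul2n -addnn expnD; apply: leq_trans (leq_mul (IH _) (IH _)) _.
by rewrite mulnACA leq_mul2l -expnD leq_pexp2l ?orbT //; lia.
Qed.

(** The divisor bound d(n) << n^(1/k) with k = 2^i. A prime p >= 2^k costs no constant, as (l + 1)^k
    <= 2^(k l) <= p^l; each of the finitely many smaller primes costs one. *)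
Lemma ndiv_le i : exists c, forall n, 0 < n -> ndiv n ^ (2 ^ i) <= c * n.
Proof.
pose k := 2 ^ i; pose B := 2 ^ k; have k0 : 0 < k by rewrite expn_gt0.
suff [c hc] : exists c, forall n, 0 < n ->
    (forall p, prime p -> p %| n -> p < B \/ B <= p) -> ndiv n ^ k <= c * n.
  by exists c => n n0; apply: hc => // p _ _; case: (ltnP p B); [left|right].
have [c2 hc2] := succ_expn_le i.
(* The induction raises the bound [b] below which small primes are allowed; at b = 0 only primes
   from [B] on remain, and b = [B] is no restriction. *)
move: {1}B => b; elim: b => [|b [c IH]].
  exists 1 => n; elim/ltn_ind: n => n IHn n0 hn; rewrite mul1n.
  case: (leqP n 1) => n1.
    have -> : n = 1 by lia.
    by rewrite exp1n.
  pose p := pdiv n; have pp : prime p by exact: pdiv_prime.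
  have pn : p %| n by exact: pdiv_dvd.
  have pB : B <= p by case: (hn p pp pn).
  pose m := n`_p^'; have m0 : 0 < m by exact: part_gt0.
  have nE : p ^ logn p n * m = n by rewrite -p_part partnC.
  have l0 : 0 < logn p n by rewrite logn_gt0 mem_primes pp n0.
  have mn : m < n.
    by rewrite -[ltnRHS]nE ltn_Pmull // -[1](expn0 p) ltn_exp2l // prime_gt1.
  apply: leq_trans (_ : ((logn p n).+1 * ndiv m) ^ k <= _).
    by rewrite leq_exp2r // ndiv_part.
  rewrite expnMn -[leqRHS]nE; apply: leq_mul; last first.
    rewrite -[leqRHS]mul1n; apply: IHn => // r rp rm; apply: hn => //.
    by apply: dvdn_trans rm _; exact: dvdn_part.
  apply: leq_trans (_ : B ^ logn p n <= _); last by rewrite leq_exp2r.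
  rewrite /B -expnM mulnC expnM leq_exp2r //; exact: ltn_expl.
case: (boolP (prime b)) => pb; last first.
  exists c => n n0 hn; apply: IH => // p pp pn; case: (hn p pp pn) => [|]; last by right.
  rewrite ltnS leq_eqVlt => /orP[/eqP e|]; last by left.
  by rewrite -e pp in pb.
exists (c2 * c) => n n0 hn.
pose m := n`_b^'; have m0 : 0 < m by exact: part_gt0.
have nE : b ^ logn b n * m = n by rewrite -p_part partnC.
apply: leq_trans (_ : ((logn b n).+1 * ndiv m) ^ k <= _).
  by rewrite leq_exp2r // ndiv_part.
rewrite expnMn -[X in _ <= _ * X]nE mulnACA; apply: leq_mul.
  apply: leq_trans (hc2 _) _; rewrite leq_mul2l; apply/orP; right.
  by case: (logn b n) => // a; rewrite leq_exp2r // prime_gt1.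
apply: IH => // p pp pm.
have pn : p %| n by apply: dvdn_trans pm _; exact: dvdn_part.
case: (hn p pp pn) => [|]; last by right.
rewrite ltnS leq_eqVlt => /orP[/eqP e|]; last by left.
have := part_pnat b^' n; rewrite -/m => /pnatP => /(_ m0 p pp pm).
by rewrite !inE e eqxx.
Qed.

End DivisorBound.

(** * Dirichlet approximation, Weyl's inequality and sums of fractional powers *)

Section MinorMajor.
Variable R : realType.
Local Notation normc := (@Normc.normc R).

Lemma dirichlet (theta : R) (Y : nat) : (0 < Y)%N ->
  exists (q : nat) (a : int), [/\ (0 < q <= Y)%N, coprimez a q%:Z &
    `|q%:R * theta - a%:~R| <= Y%:R^-1].
Proof.
move=> Y0; have Yp : 0 < Y%:R :> R by rewrite ltr0n.
pose fl (i : nat) := Num.floor (i%:R * theta).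
pose fr (i : nat) := i%:R * theta - (fl i)%:~R.
have fr01 i : 0 <= fr i < 1.
  by have := floor_itv (i%:R * theta); rewrite intrD /= /fr /fl; lra.
have bY i : (Num.truncn (Y%:R * fr i) < Y)%N.
  rewrite -(ltr_nat R); have := fr01 i => /andP[f0 f1].
  apply: le_lt_trans (_ : Y%:R * fr i < _); last by nra.
  by rewrite truncn_le mulr_ge0 // ltW.
pose phi (i : 'I_Y.+1) : 'I_Y := Ordinal (bY i).
have /injectivePn [i [j ij e]] : ~~ injectiveb phi.
  apply/negP => /injectiveP inj; have := leq_card phi inj.
  by rewrite !card_ord ltnn.
wlog lij : i j ij e / (i < j)%N => [hw|].
  have [lij|lij] := ltnP i j; first exact: (hw i j).
  by apply: (hw j i) => //; rewrite 1?eq_sym // ltn_neqAle lij andbT eq_sym.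
have {}e : Num.truncn (Y%:R * fr i) = Num.truncn (Y%:R * fr j) by case: e.
pose q := (j - i)%N; pose a := fl j - fl i.
have q0 : (0 < q)%N by rewrite subn_gt0.
have qY : (q <= Y)%N by have := ltn_ord j; rewrite /q; lia.
have app : `|q%:R * theta - a%:~R| <= Y%:R^-1.
  have -> : q%:R * theta - a%:~R = fr j - fr i.
    by rewrite /fr /q /a natrB ?(ltnW lij) // intrB; ring.
  have /andP[fi0 _] := fr01 i; have /andP[fj0 _] := fr01 j.
  have := truncn_itv (mulr_ge0 (ltW Yp) fi0); have := truncn_itv (mulr_ge0 (ltW Yp) fj0).
  rewrite e -[(Num.truncn _).+1%:R]natr1; set r := (Num.truncn _)%:R => h1 h2.
  rewrite -[leRHS]mul1r ler_pdivlMr //; have [h|h] := ler0P (fr j - fr i); nra.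
(* Pigeonhole may return a pair with a common factor [g]; dividing by it divides the error by [g],
   so the bound survives in lowest terms. *)
pose g := gcdn `|a|%N q; have g0 : (0 < g)%N by rewrite gcdn_gt0 q0 orbT.
have gp : 0 < g%:R :> R by rewrite ltr0n.
have gq : (g %| q)%N by exact: dvdn_gcdr.
have ga : (g%:Z %| a)%Z by rewrite dvdzE; exact: dvdn_gcdl.
exists (q %/ g)%N, (a %/ g%:Z)%Z; split.
- by rewrite divn_gt0 // dvdn_leq //= (leq_trans (leq_div _ _)).
- rewrite /coprimez /gcdz /=.
  have -> : `|(a %/ g%:Z)%Z|%N = (`|a| %/ g)%N.
    apply/eqP; rewrite -(eqn_pmul2r g0) divnK ?dvdn_gcdl //.
    by rewrite -{2}[a](divzK ga) abszM.
  rewrite eqz_nat -(eqn_pmul2r g0) mul1n muln_gcdl !divnK ?dvdn_gcdl //.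
- have qE : q%:R = (q %/ g)%:R * g%:R :> R by rewrite -natrM divnK.
  have aE : a%:~R = (a %/ g%:Z)%Z%:~R * g%:R :> R.
    by rewrite -{1}[a](divzK ga) intrM.
  apply: le_trans app; rewrite qE aE.
  have -> : (q %/ g)%:R * g%:R * theta - (a %/ g)%Z%:~R * g%:R =
    ((q %/ g)%:R * theta - (a %/ g)%Z%:~R) * g%:R by ring.
  rewrite normrM [`|g%:R|]ger0_norm ?(ltW gp) // ler_peMr // ler1n //.
Qed.

Lemma sum_bool_count (s : seq nat) (P : pred nat) :
  (\sum_(k <- s) P k = count P s)%N.
Proof. by rewrite -sum1_count [RHS]big_mkcond; apply: eq_bigr => k _; case: (P k). Qed.

(** A value m > 0 is attained by h k at most once for each divisor h of m, and m = 0 never, as h and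
    k start at 1. *)
Lemma sum_prod_le (n Dm : nat) (F : nat -> R) :
  (forall m, 0 <= F m) -> (forall m, (0 < m < n * n)%N -> (ndiv m <= Dm)%N) ->
  \sum_(1 <= h < n) \sum_(1 <= k < n) F (h * k)%N <= Dm%:R * \sum_(m < n * n) F m.
Proof.
move=> F0 hD.
have e : \sum_(1 <= h < n) \sum_(1 <= k < n) F (h * k)%N =
  \sum_(m < n * n) (\sum_(1 <= h < n) \sum_(1 <= k < n) (m == h * k :> nat)%N%:R) * F m.
  under [RHS]eq_bigr => m _ do (rewrite mulr_suml; under eq_bigr => h _ do rewrite mulr_suml).
  rewrite [RHS]exchange_big /=; apply: eq_big_nat => h /andP[h1 h2].
  rewrite [RHS]exchange_big /=; apply: eq_big_nat => k /andP[k1 k2].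
  have hk : (h * k < n * n)%N by rewrite ltn_mul.
  rewrite (bigD1 (Ordinal hk)) //= eqxx mul1r big1 ?addr0 // => i.
  by rewrite -val_eqE /= => /negbTE ->; rewrite mul0r.
rewrite e mulr_sumr; apply: ler_sum => m _; apply: ler_wpM2r => //.
have [m0|m0] := posnP (m : nat).
  rewrite big_nat big1 // => h /andP[h1 _]; rewrite big_nat big1 // => k /andP[k1 _].
  by rewrite m0 eq_sym muln_eq0; case: (h) h1 => // h'; case: (k) k1.
apply: le_trans (_ : \sum_(1 <= h < n) (h %| m)%N%:R <= _).
  apply: ler_sum_nat => h /andP[h1 h2].
  have [hm|hm] := boolP (h %| m)%N; last first.
    rewrite big1 // => k _; have [mE|//] := eqVneq (m : nat) (h * k)%N.
    by rewrite mE dvdn_mulr in hm.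
  apply: le_trans (_ : \sum_(1 <= k < n) (k == m %/ h)%N%:R <= _).
    apply: ler_sum => k _; rewrite ler_nat.
    by have [->|//] := eqVneq (m : nat) (h * k)%N; rewrite mulKn // eqxx.
  rewrite -natr_sum ler_nat sum_bool_count.
  by rewrite count_uniq_mem ?iota_uniq // leq_b1.
rewrite -natr_sum ler_nat; apply: leq_trans (hD m _); last by rewrite m0 ltn_ord.
rewrite sum_bool_count -size_filter; apply: uniq_leq_size.
  by rewrite filter_uniq // iota_uniq.
by move=> h; rewrite mem_filter -dvdn_divisors // => /andP[].
Qed.

Lemma weyl_minor (n q Dm : nat) (a : int) (alpha c : R) :
  (0 < q)%N -> coprimez a q%:Z -> `|alpha - a%:~R / q%:R| <= (q%:R ^+ 2)^-1 ->
  (forall m, (0 < m < n * n)%N -> (ndiv m <= Dm)%N) ->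
  normc (\sum_(i < n) expi (alpha * (i%:R + c) ^+ 3)) ^+ 4 <=
  10 * n%:R ^+ 3 + 48 * n%:R * (Dm%:R *
    ((12 * n%:R ^+ 2 / q%:R + 1) * (2 * n%:R + 4 * q%:R * harm R q))).
Proof.
move=> q0 cop app hD; apply: le_trans (weyl_cube _ _ _) _.
rewrite lerD2l ler_wpM2l ?mulr_ge0 //.
apply: le_trans (_ : Dm%:R * (\sum_(m < n * n) mm n%:R (alpha * (6 * m)%:R)) <= _).
  apply: le_trans (_ : \sum_(1 <= h < n) \sum_(1 <= k < n) mm n%:R (alpha * (6 * (h * k))%:R) <= _).
    apply: ler_sum => h _; apply: ler_sum => k _.
    by rewrite !natrM (_ : 6 * alpha * h%:R * k%:R = alpha * (6 * (h%:R * k%:R))) //; ring.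
  by apply: (@sum_prod_le n Dm (fun m => mm n%:R (alpha * (6 * m)%:R))) => // m; exact: mm_ge0.
rewrite ler_wpM2l //.
(* The factor 6 is absorbed by completing the multiples of 6 to all integers below 6 n^2: the
   approximation of [alpha] itself can be used, at the price of a constant. *)
apply: le_trans (_ : \sum_(m < 6 * (n * n)) mm n%:R (alpha * m%:R) <= _); last first.
  apply: le_trans (sum_mm_rat _ q0 (ler0n _ _) cop app) _.
  by rewrite !natrM (_ : 2 * (6 * (n%:R * n%:R)) = 12 * n%:R ^+ 2 :> R) //; ring.
elim: (n * n)%N => [|k IH]; first by rewrite !big_ord0.
rewrite big_ord_recr /= mulnS addnC.
rewrite big_split_ord /=; apply: lerD => //.
rewrite big_ord_recl /= addn0 lerDl.
by apply: sumr_ge0 => i _; exact: mm_ge0.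
Qed.

(** The root of order 2^k. All fractional exponents have dyadic denominators, so integer powers of
    such roots replace real powers and identities between them stay polynomial. *)
Definition rt (k : nat) (x : R) := iter k Num.sqrt x.

Lemma rt_ge0 k x : 0 <= x -> 0 <= rt k x.
Proof. by case: k => //= k _; rewrite sqrtr_ge0. Qed.

Lemma rt_exp k x : 0 <= x -> rt k x ^+ (2 ^ k) = x.
Proof.
elim: k x => [|k IH] x x0; first by rewrite expn0 expr1.
by rewrite expnS exprM /= sqr_sqrtr ?rt_ge0 // IH.
Qed.

Lemma rt_gt0 k x : 0 < x -> 0 < rt k x.
Proof. by move=> x0; elim: k => //= k IH; rewrite sqrtr_gt0. Qed.

Lemma rt_mono k x y : 0 <= x <= y -> rt k x <= rt k y.
Proof.
move=> /andP[x0 xy]; elim: k => //= k IH.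
by rewrite ler_sqrt // rt_ge0 // (le_trans x0).
Qed.

Lemma rt_ge1 k x : 1 <= x -> 1 <= rt k x.
Proof.
move=> x1; have e : rt k 1 = 1 by elim: k => //= k ->; rewrite sqrtr1.
by rewrite -{1}e; apply: rt_mono; rewrite ler01.
Qed.

Lemma rtM k x y : 0 <= x -> 0 <= y -> rt k (x * y) = rt k x * rt k y.
Proof. by move=> x0 y0; elim: k => //= k ->; rewrite sqrtrM // rt_ge0. Qed.

Lemma rtV k x : 0 <= x -> rt k x^-1 = (rt k x)^-1.
Proof. by move=> x0; elim: k => //= k ->; rewrite sqrtrV // rt_ge0. Qed.

Arguments rt : simpl never.
Local Notation fr := (rt 2).

Lemma fr4 x : 0 <= x -> fr x ^+ 4 = x.
Proof. exact: (@rt_exp 2). Qed.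

(** Discrete form of the primitive 4 x^(1/4) of x^(-3/4): with r, t the fourth roots, r^4 - t^4 is r
    - t times four terms, each at most r^3. *)
Lemma fr_telescope (x y : R) : 0 <= y -> y < x -> (fr x ^+ 3)^-1 <= 4 / (x - y) * (fr x - fr y).
Proof.
move=> y0 yx; have x0 : 0 < x by exact: le_lt_trans yx.
have r0 := rt_gt0 2 x0; have t0 := rt_ge0 2 y0.
have tr : fr y <= fr x by apply: rt_mono; rewrite y0 ltW.
have d0 : 0 < x - y by rewrite subr_gt0.
rewrite -[leLHS]mul1r ler_pdivrMr ?exprn_gt0 // mulrAC -mulrA mulrC.
rewrite mulrA ler_pdivlMr // mul1r -{1}(fr4 (ltW x0)) -{1}(fr4 y0).
move: r0 t0 tr; set r := fr x; set t := fr y => r0 t0 tr.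
have -> : r ^+ 4 - t ^+ 4 = (r - t) * (r ^+ 3 + r ^+ 2 * t + r * t ^+ 2 + t ^+ 3) by ring.
have -> : r ^+ 3 * (r - t) * 4 = (r - t) * (4 * r ^+ 3) by ring.
rewrite ler_wpM2l ?subr_ge0 //.
have h1 : r ^+ 2 * t <= r ^+ 2 * r by rewrite ler_wpM2l // sqr_ge0.
have h2 : r * t ^+ 2 <= r * r ^+ 2 by rewrite ler_wpM2l ?(ltW r0) // ler_sqr ?nnegrE ?(ltW r0).
have h3 : t ^+ 3 <= r ^+ 3 by rewrite lerXn2r ?nnegrE ?(ltW r0).
have e1 : r ^+ 2 * r = r ^+ 3 by ring.
have e2 : r * r ^+ 2 = r ^+ 3 by ring.
lra.
Qed.

(** Telescoping along the multiples of [m]: each weight is at most 4 / m times the increment of the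
    fourth root since the previous multiple. *)
Lemma sum_fr_multiples (n m : nat) : (0 < m)%N ->
  \sum_(1 <= h < n | (m %| h)%N) (fr h%:R ^+ 3)^-1 <= 4 * fr n%:R / m%:R.
Proof.
move=> m0; have mp : 0 < m%:R :> R by rewrite ltr0n.
have step k : \sum_(1 <= h < k.+1 | (m %| h)%N) (fr h%:R ^+ 3)^-1 <= 4 / m%:R * fr (k %/ m * m)%:R.
  elim: k => [|k IH].
    by rewrite big_geq // mulr_ge0 ?rt_ge0 // divr_ge0 // ltW.
  rewrite big_mkcond big_nat_recr //= -big_mkcond divnS //=.
  have [d|d] := boolP (m %| k.+1)%N; last by rewrite addr0 add0n.
  have e : ((k %/ m) * m + m = k.+1)%N.
    by rewrite -mulSnr -[RHS](divnK d) divnS // d.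
  rewrite add1n mulSnr e; apply: le_trans (lerD IH (lexx _)) _.
  have := @fr_telescope k.+1%:R (k %/ m * m)%:R (ler0n _ _).
  have -> : k.+1%:R - (k %/ m * m)%:R = m%:R :> R by rewrite -e natrD; ring.
  rewrite ltr_nat => /(_ ltac:(lia)); lra.
case: n => [|n]; first by rewrite big_geq // divr_ge0 ?mulr_ge0 ?rt_ge0.
apply: le_trans (step n) _; rewrite mulrAC ler_wpM2r ?invr_ge0 // ler_wpM2l //.
by apply: rt_mono; rewrite ler0n ler_nat ltnW // ltnS leq_divM.
Qed.

(** The gcd is at most the sum of all d dividing both [h] and [q]. Each d is compensated by the
    sparsity 1 / d of its multiples, and only the number of divisors remains. *)
Lemma sum_fr_gcd (n q : nat) : (0 < q)%N ->
  \sum_(1 <= h < n) (gcdn h q)%:R * (fr h%:R ^+ 3)^-1 <= 4 * fr n%:R * (ndiv q)%:R.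
Proof.
move=> q0.
apply: le_trans (_ : \sum_(1 <= h < n) \sum_(d <- divisors q) (d %| h)%N%:R * (d%:R * (fr h%:R ^+ 3)^-1) <= _).
  apply: ler_sum_nat => h /andP[h1 _].
  have gd : gcdn h q \in divisors q by rewrite -dvdn_divisors // dvdn_gcdr.
  rewrite (bigD1_seq _ gd (divisors_uniq _)) /= dvdn_gcdl mul1r lerDl.
  by apply: sumr_ge0 => d _; rewrite !mulr_ge0 // invr_ge0 exprn_ge0 // rt_ge0.
rewrite exchange_big /=.
apply: le_trans (_ : \sum_(d <- divisors q) 4 * fr n%:R <= _); last first.
  by rewrite big_const_seq count_predT iter_addr addr0 /ndiv mulr_natr.
rewrite big_seq [leRHS]big_seq; apply: ler_sum => d; rewrite -dvdn_divisors // => dq.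
have d0 : (0 < d)%N by exact: dvdn_gt0 dq.
have dp : 0 < d%:R :> R by rewrite ltr0n.
apply: le_trans (_ : d%:R * (4 * fr n%:R / d%:R) <= _); last first.
  by rewrite mulrC divfK // gt_eqF.
apply: le_trans (ler_wpM2l (ltW dp) (sum_fr_multiples n d0)).
rewrite mulr_sumr [leRHS]big_mkcond /=; apply: ler_sum => h _.
by case: (d %| h)%N; rewrite ?mul1r ?mul0r.
Qed.

End MinorMajor.
Arguments rt {R} k x : simpl never.

(** * Major arcs *)

Section Major.
Variable R : realType.
Local Notation normc := (@Normc.normc R).
Local Notation fr := (@rt R 2).

Lemma dvdn_mul_div_gcd (q m k : nat) : (0 < q)%N ->
  (q %| m * k)%N = (q %/ gcdn m q %| k)%N.
Proof.
move=> q0; have g0 : (0 < gcdn m q)%N by rewrite gcdn_gt0 q0 orbT.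
have -> : (q %| m * k)%N = (q %/ gcdn m q * gcdn m q %| m %/ gcdn m q * gcdn m q * k)%N.
  by rewrite (divnK (dvdn_gcdr m q)) (divnK (dvdn_gcdl m q)).
rewrite mulnAC dvdn_pmul2r //.
rewrite Gauss_dvdr // coprime_sym /coprime -(eqn_pmul2r g0) mul1n muln_gcdl.
by rewrite !divnK ?dvdn_gcdl ?dvdn_gcdr // eqxx.
Qed.

(** As u <= 1, (1 + B) u is at most 1 + B u, whose exponent is lowered from 1 to 3/4. This separates
    B from u, and the weaker exponent keeps the later sums over h and k, with u = h k / n^2, free of
    logarithms. *)
Lemma fr_interpolate (B u : R) : 0 <= B -> 0 < u <= 1 ->
  (1 + B * u)^-1 <= (fr (1 + B) ^+ 3)^-1 * (fr u ^+ 3)^-1.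
Proof.
move=> B0 /andP[u0 u1].
have p1 : 0 < 1 + B by lra.
have p2 : 1 <= 1 + B * u by nra.
rewrite -invfM -exprMn -rtM ?(ltW p1) ?(ltW u0) // lef_pV2 ?posrE; first last.
- by rewrite exprn_gt0 // rt_gt0 // mulr_gt0.
- by lra.
apply: le_trans (_ : fr (1 + B * u) ^+ 3 <= _).
  rewrite lerXn2r ?nnegrE ?rt_ge0 //; [nra|nra|].
  by apply: rt_mono; nra.
rewrite -[leRHS](fr4 (le_trans ler01 p2)) [leRHS]exprS ler_peMl ?rt_ge1 //.
by rewrite exprn_ge0 // rt_ge0 //; nra.
Qed.

(** For fixed h put q' = q / gcd(6 h, q). If q' does not divide k, the rational point keeps a
    distance D >= 1 / q' from the integers, and passing to 6 alpha h k costs at most 6 n^2 |alpha -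
    a / q| <= 1 / (2 q) <= D / 2; hence the factor 12. So the term is at most 2 / D <= 4 / (1 / q' +
    D), which is four times a peak of height q' instead of n. *)
Lemma sum_mm_far (n q h : nat) (a : int) (alpha : R) :
  (0 < q)%N -> (0 < h < n)%N -> coprimez a q%:Z ->
  12 * n%:R ^+ 2 * q%:R * `|alpha - a%:~R / q%:R| <= 1 ->
  \sum_(1 <= k < n | ~~ (q %| 6 * h * k)%N) mm n%:R (6 * alpha * h%:R * k%:R) <=
  4 * (2 * n%:R + q%:R) * (2 + 4 * harm R q).
Proof.
move=> q0 /andP[h0 hn] cop app; have qp : 0 < q%:R :> R by rewrite ltr0n.
pose g := gcdn (6 * h) q; pose q' := (q %/ g)%N; pose m := (6 * h %/ g)%N.
have g0 : (0 < g)%N by rewrite gcdn_gt0 q0 orbT.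
have qE : (q' * g = q)%N by rewrite divnK // dvdn_gcdr.
have mE : (m * g = 6 * h)%N by rewrite divnK // dvdn_gcdl.
have q'0 : (0 < q')%N by rewrite divn_gt0 // dvdn_leq // dvdn_gcdr.
have q'q : (q' <= q)%N by exact: leq_div.
have q'p : 0 < q'%:R :> R by rewrite ltr0n.
have gp : 0 < g%:R :> R by rewrite ltr0n.
have cop1 : coprime m q'.
  rewrite /coprime -(eqn_pmul2r g0) mul1n muln_gcdl mE qE.
  by rewrite -/g eqxx.
have cop' : coprimez (a * m%:Z) q'%:Z.
  rewrite coprimezMl; apply/andP; split; last by [].
  move: cop; rewrite /coprimez /gcdz !eqz_nat /=.
  rewrite -!/(coprime _ _); apply: coprime_dvdr; rewrite -qE; exact: dvdn_mulr.
have ratE : (a * m%:Z)%:~R / q'%:R = 6 * h%:R * (a%:~R / q%:R) :> R.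
  have h6 : 6 * h%:R = m%:R * g%:R :> R by rewrite -[RHS]natrM mE natrM.
  rewrite h6 -qE natrM intrM -pmulrn; field.
  by rewrite !gt_eqF.
apply: le_trans (_ : 4 * \sum_(k < n) mm q'%:R ((a * m%:Z)%:~R / q'%:R * k%:R) <= _); last first.
  have hh := @sum_mm_rat R ((a * m%:Z)%:~R / q'%:R) (a * m%:Z) q' n q'%:R q'0 (ler0n _ _) cop'.
  rewrite -mulrA ler_pM2l //; apply: le_trans (hh _) _; first by rewrite subrr normr0 invr_ge0 sqr_ge0.
  have -> : (2 * n%:R / q'%:R + 1) * (2 * q'%:R + 4 * q'%:R * harm R q') =
     (2 * n%:R + q'%:R) * (2 + 4 * harm R q').
    by field; rewrite gt_eqF.
  apply: ler_pM; rewrite ?addr_ge0 ?mulr_ge0 ?harm_ge0 //.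
    by rewrite lerD2l ler_nat.
  by rewrite lerD2l ler_pM2l // harm_mono.
rewrite -(big_mkord xpredT (fun k => mm q'%:R ((a * m%:Z)%:~R / q'%:R * k%:R))).
case: n hn app => // n hn app; rewrite [in leRHS]big_ltn // mulrDr.
rewrite -[leLHS]add0r; apply: lerD; first by rewrite mulr_ge0 // mm_ge0.
rewrite mulr_sumr big_mkcond /=; apply: ler_sum_nat => k /andP[k0 kn].
have m0 : 0 <= 4 * mm q'%:R ((a * m%:Z)%:~R / q'%:R * k%:R : R).
  by apply: mulr_ge0 => //; exact: mm_ge0.
case: ifP => // nd.
have d1 : q'%:R^-1 <= dZ ((a * m%:Z)%:~R / q'%:R * k%:R : R).
  apply: (@dZ_rat R (a * m%:Z) q' k%:Z) => //.
  rewrite Gauss_dvdzr; last by rewrite coprimez_sym.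
  by rewrite dvdzE /= -/g -dvdn_mul_div_gcd.
set D := dZ _ in d1 m0 *.
have iq : 0 < q'%:R^-1 :> R by rewrite invr_gt0.
have d2 : D / 2 <= dZ (6 * alpha * h%:R * k%:R).
  have := @dZ_triangle R ((a * m%:Z)%:~R / q'%:R * k%:R) (6 * alpha * h%:R * k%:R).
  rewrite -/D ratE.
  have -> : 6 * h%:R * (a%:~R / q%:R) * k%:R - 6 * alpha * h%:R * k%:R =
     - (6 * (h * k)%:R * (alpha - a%:~R / q%:R)) by rewrite natrM; ring.
  rewrite normrN !normrM [`|6|]ger0_norm // [`|(h * k)%:R|]ger0_norm //.
  set bt := `|_| in app *; have bt0 : 0 <= bt by exact: normr_ge0.
  have hk : (h * k)%:R <= n.+1%:R ^+ 2 :> R.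
    by rewrite -natrX ler_nat expnS expn1 leq_mul // ltnW.
  have e1 : 12 * n.+1%:R ^+ 2 * bt <= q%:R^-1 by rewrite -[leRHS]mul1r ler_pdivlMr //; nra.
  have e2 : q%:R^-1 <= q'%:R^-1 :> R by rewrite lef_pV2 ?posrE // ler_nat.
  have e3 : 6 * (h * k)%:R * bt <= 6 * n.+1%:R ^+ 2 * bt.
    by rewrite ler_wpM2r // ler_pM2l.
  lra.
apply: le_trans (mm_le_inv (ler0n _ _) (_ : 0 < D / 2 <= _)) _; first by rewrite d2 andbT; lra.
have Dp : 0 < D by exact: lt_le_trans d1.
have -> : 4 * mm q'%:R ((a * m%:Z)%:~R / q'%:R * k%:R : R) = 4 / (q'%:R^-1 + D).
  by rewrite /mm -/D; field; rewrite !gt_eqF // ?addr_gt0 // ?mulr_gt0.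
rewrite ler_pdivlMr; last lra.
rewrite invf_div mulrAC ler_pdivrMr //; lra.
Qed.

(** When q divides 6 h k, the point is an integer plus 6 h k (alpha - a / q), so its distance to the
    integers is known exactly. After [fr_interpolate], k runs over multiples of q / gcd(6 h, q) and
    h is summed by [sum_fr_gcd]. The constant is 96 = 4 * 6 * 4, the 6 from gcd(6 h, q) <= 6 gcd(h,
    q). *)
Lemma sum_mm_near (n q : nat) (a : int) (alpha : R) :
  (0 < q)%N -> coprimez a q%:Z ->
  12 * n%:R ^+ 2 * q%:R * `|alpha - a%:~R / q%:R| <= 1 ->
  \sum_(1 <= h < n) \sum_(1 <= k < n | (q %| 6 * h * k)%N) mm n%:R (6 * alpha * h%:R * k%:R) <=
  96 * n%:R ^+ 3 * (ndiv q)%:R / q%:R / fr (1 + n%:R ^+ 3 * `|alpha - a%:~R / q%:R|) ^+ 3.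
Proof.
move=> q0 cop app; have qp : 0 < q%:R :> R by rewrite ltr0n.
have [->|n0] := posnP n.
  by rewrite big_geq // expr0n /= !mulr0 !mul0r.
have np : 0 < n%:R :> R by rewrite ltr0n.
set bt := `|_| in app *; have bt0 : 0 <= bt by exact: normr_ge0.
pose B := n%:R ^+ 3 * bt; have B0 : 0 <= B by rewrite mulr_ge0 // exprn_ge0.
set E := fr (1 + n%:R ^+ 3 * bt) ^+ 3.
have E0 : 0 < E by rewrite exprn_gt0 // rt_gt0 // -/B; lra.
apply: le_trans (_ : \sum_(1 <= h < n) \sum_(1 <= k < n | (q %| 6 * h * k)%N)
    n%:R / E * fr n%:R ^+ 6 * ((fr h%:R ^+ 3)^-1 * (fr k%:R ^+ 3)^-1) <= _).
  apply: ler_sum_nat => h /andP[h0 hn]; rewrite big_nat_cond [leRHS]big_nat_cond.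
  apply: ler_sum => k /andP[/andP[k0 kn] dv].
  have hp : 0 < h%:R :> R by rewrite ltr0n.
  have kp : 0 < k%:R :> R by rewrite ltr0n.
  have hkn : h%:R * k%:R <= n%:R ^+ 2 :> R.
    by rewrite -natrM -natrX ler_nat expnS expn1 leq_mul // ltnW.
  have hkp : 0 < h%:R * k%:R :> R by rewrite mulr_gt0.
  have dE : dZ (6 * alpha * h%:R * k%:R) = 6 * (h%:R * k%:R) * bt.
    have [z zE] : exists z : int, 6 * (a%:~R / q%:R) * h%:R * k%:R = z%:~R :> R.
      exists (a * (6 * h * k %/ q)%N%:Z).
      rewrite intrM -pmulrn.
      have : (6 * h * k)%:R = (6 * h * k %/ q)%:R * q%:R :> R by rewrite -natrM divnK.
      rewrite !natrM => e6.
      have -> : 6 * (a%:~R / q%:R) * h%:R * k%:R = a%:~R / q%:R * (6 * h%:R * k%:R) :> R by ring.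
      by rewrite e6; field; rewrite gt_eqF.
    have -> : 6 * alpha * h%:R * k%:R = 6 * (h%:R * k%:R) * (alpha - a%:~R / q%:R) + z%:~R.
      by rewrite -zE; ring.
    have nE : `|6 * (h%:R * k%:R) * (alpha - a%:~R / q%:R)| = 6 * (h%:R * k%:R) * bt.
      by rewrite normrM ger0_norm // mulr_ge0 // ltW.
    rewrite dZDint dZ_small // nE.
    have q1 : 1 <= q%:R :> R by rewrite ler1n.
    apply: le_trans (_ : 6 * n%:R ^+ 2 * bt <= _).
      by rewrite ler_wpM2r // ler_pM2l.
    have : 12 * n%:R ^+ 2 * bt <= 12 * n%:R ^+ 2 * q%:R * bt.
      rewrite ler_wpM2r // ler_peMr // mulr_ge0 // sqr_ge0.
    lra.
  rewrite /mm dE.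
  pose u : R := h%:R * k%:R / n%:R ^+ 2.
  have n2 : 0 < n%:R ^+ 2 :> R by rewrite exprn_gt0.
  have u01 : 0 < u <= 1 by rewrite divr_gt0 //= ler_pdivrMr // mul1r.
  have e1 : B * u = n%:R * (h%:R * k%:R * bt) by rewrite /B /u; field; rewrite gt_eqF.
  have := fr_interpolate B0 u01; rewrite -/E.
  have -> : (fr u ^+ 3)^-1 = fr n%:R ^+ 6 * ((fr h%:R ^+ 3)^-1 * (fr k%:R ^+ 3)^-1).
    have -> : fr u = fr h%:R * fr k%:R / fr n%:R ^+ 2.
      rewrite /u rtM ?invr_ge0 ?(ltW hkp) ?(ltW n2) // rtM ?ler0n // rtV ?(ltW n2) //.
      by rewrite [in LHS]expr2 rtM ?ler0n // -expr2.
    by field; rewrite !gt_eqF ?rt_gt0.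
  move=> h1; rewrite -[n%:R / E * _ * _]mulrA -[n%:R / E * _]mulrA ler_pM2l //.
  apply: le_trans h1.
  rewrite lef_pV2 ?posrE; first last.
  - by rewrite ltr_pwDl // e1 !mulr_ge0 // ltW.
  - by rewrite ltr_pwDl // !mulr_ge0 // ltW.
  rewrite lerD2l e1 ler_pM2l // ler_wpM2r //; lra.
under eq_bigr => h _ do rewrite -mulr_sumr.
rewrite -mulr_sumr.
have inner : \sum_(1 <= h < n) \sum_(1 <= k < n | (q %| 6 * h * k)%N)
    ((fr h%:R ^+ 3)^-1 * (fr k%:R ^+ 3)^-1) <=
    96 * fr n%:R ^+ 2 * (ndiv q)%:R / q%:R.
  apply: le_trans (_ : \sum_(1 <= h < n) 24 * fr n%:R / q%:R *
      ((gcdn h q)%:R * (fr h%:R ^+ 3)^-1) <= _).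
    apply: ler_sum_nat => h /andP[h0 hn].
    have fh : 0 <= (fr h%:R ^+ 3)^-1 by rewrite invr_ge0 exprn_ge0 // rt_ge0.
    rewrite -mulr_sumr mulrC [leRHS]mulrA; apply: ler_wpM2r => //.
    pose g := gcdn (6 * h) q; have g0 : (0 < g)%N by rewrite gcdn_gt0 q0 orbT.
    have gq : (g %| q)%N by exact: dvdn_gcdr.
    have q'0 : (0 < q %/ g)%N by rewrite divn_gt0 // dvdn_leq.
    under eq_bigl => k do rewrite dvdn_mul_div_gcd //.
    apply: le_trans (sum_fr_multiples _ _ q'0) _.
    have -> : (q %/ g)%:R = q%:R / g%:R :> R.
      by rewrite -{2}(divnK gq) natrM mulfK // pnatr_eq0 -lt0n.
    have -> : 4 * fr n%:R / (q%:R / g%:R) = 4 * fr n%:R / q%:R * g%:R.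
      by field; rewrite !gt_eqF // ltr0n.
    have -> : 24 * fr n%:R / q%:R * (gcdn h q)%:R = 4 * fr n%:R / q%:R * (6 * (gcdn h q)%:R).
      by ring.
    rewrite ler_wpM2l ?divr_ge0 ?mulr_ge0 ?rt_ge0 //.
    rewrite -natrM ler_nat dvdn_leq // ?muln_gt0 ?gcdn_gt0 ?q0 ?orbT //.
    rewrite muln_gcdr dvdn_gcd dvdn_gcdl /=.
    by apply: dvdn_trans gq _; exact: dvdn_mull.
  rewrite -mulr_sumr; apply: le_trans (ler_wpM2l _ (sum_fr_gcd _ _ q0)) _.
    by rewrite divr_ge0 ?mulr_ge0 ?rt_ge0.
  rewrite le_eqVlt; apply/orP; left; apply/eqP; field; exact: lt0r_neq0.
apply: le_trans (ler_wpM2l _ inner) _.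
  by rewrite !mulr_ge0 ?exprn_ge0 ?rt_ge0 // invr_ge0 ltW.
rewrite le_eqVlt; apply/orP; left; apply/eqP.
have f8 : fr n%:R ^+ 6 * fr n%:R ^+ 2 = n%:R ^+ 2 :> R.
  by rewrite -exprD (exprM _ 4 2) fr4.
have n3 : n%:R ^+ 3 = n%:R * n%:R ^+ 2 :> R by rewrite [LHS]exprS.
rewrite n3 -f8.
field; rewrite !gt_eqF //.
Qed.

Lemma weyl_major (n q : nat) (a : int) (alpha c : R) :
  (0 < q)%N -> coprimez a q%:Z ->
  12 * n%:R ^+ 2 * q%:R * `|alpha - a%:~R / q%:R| <= 1 ->
  normc (\sum_(i < n) expi (alpha * (i%:R + c) ^+ 3)) ^+ 4 <=
  10 * n%:R ^+ 3 + 48 * n%:R * (n%:R * (4 * (2 * n%:R + q%:R) * (2 + 4 * harm R q))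
    + 96 * n%:R ^+ 3 * (ndiv q)%:R / q%:R / fr (1 + n%:R ^+ 3 * `|alpha - a%:~R / q%:R|) ^+ 3).
Proof.
move=> q0 cop app; apply: le_trans (weyl_cube _ _ _) _.
rewrite lerD2l ler_wpM2l ?mulr_ge0 //.
under eq_bigr => h _ do rewrite (bigID (fun k => (q %| 6 * h * k)%N)) /=.
rewrite big_split /= addrC; apply: lerD; last exact: sum_mm_near.
have C0 : 0 <= 4 * (2 * n%:R + q%:R) * (2 + 4 * harm R q).
  by rewrite mulr_ge0 // ?addr_ge0 ?mulr_ge0 ?addr_ge0 ?harm_ge0.
apply: le_trans (_ : \sum_(1 <= h < n) 4 * (2 * n%:R + q%:R) * (2 + 4 * harm R q) <= _).
  by apply: ler_sum_nat => h hn; apply: (sum_mm_far q0 hn cop app).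
rewrite sumr_const_nat -[leLHS]mulr_natl ler_wpM2r // ler_nat leq_subr //.
Qed.

End Major.

(** * Weyl bounds expressed in powers of [p] *)

Section Scales.
Variable R : realType.
Local Notation normc := (@Normc.normc R).
Local Notation fr := (@rt R 2).

Lemma ndiv_rt k : exists2 C : R, 1 <= C &
  forall q, (0 < q)%N -> (ndiv q)%:R <= C * rt k q%:R.
Proof.
have [c hc] := ndiv_le k; exists (c.+1%:R); first by rewrite ler1n.
move=> q q0; have e0 : (0 < 2 ^ k)%N by rewrite expn_gt0.
rewrite -(@ler_pXn2r _ (2 ^ k)) ?nnegrE ?mulr_ge0 ?rt_ge0 //.
rewrite exprMn rt_exp // -!natrX -natrM ler_nat; apply: leq_trans (hc q q0) _.
rewrite leq_mul2r; apply/orP; right; apply: leq_trans (leqnSn c) _.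
by rewrite -[leqLHS]expn1 leq_pexp2l.
Qed.

Lemma ndiv_scale k e : (e <= 2 ^ k)%N -> exists C : nat,
  forall p m, (0 < p)%N -> (0 < m < p ^ e)%N -> (ndiv m <= C * p)%N.
Proof.
move=> ek; have [c hc] := ndiv_le k; exists c.+1 => p m p0 /andP[m0 mp].
have e0 : (0 < 2 ^ k)%N by rewrite expn_gt0.
rewrite -(leq_exp2r _ _ e0) expnMn; apply: leq_trans (hc m m0) _.
apply: leq_mul; last by rewrite (leq_trans (ltnW mp)) // leq_pexp2l.
by apply: leq_trans (leqnSn c) _; rewrite -[leqLHS]expn1 leq_pexp2l.
Qed.

Lemma approx_div (q : nat) (a : int) (alpha Y : R) : (0 < q)%N ->
  `|q%:R * alpha - a%:~R| <= Y -> q%:R * `|alpha - a%:~R / q%:R| <= Y.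
Proof.
move=> q0; have qp : 0 < q%:R :> R by rewrite ltr0n.
rewrite -{2}(ger0_norm (ltW qp)) -normrM mulrBr (mulrC _ (a%:~R / _)) divfK //.
by rewrite gt_eqF.
Qed.

Lemma harm_scale e : exists2 C : R, 1 <= C & forall p n : nat,
  (0 < p)%N -> (n <= p ^ e)%N -> harm R n <= C * p%:R.
Proof. by exists e.+1%:R => [|p n p0 h]; [rewrite ler1n | exact: harm_le_pow]. Qed.

(** For length p^120 the ideal exponent is 360. The dominant term q [harm q] reaches p^244 instead
    of p^240, because q may be as large as p^243 and a logarithm is added; the divisor bound costs
    one more [p]. *)
Lemma minor_bound : exists2 C : R, 0 <= C & forall (p q : nat) (a : int) (alpha c : R),
  (0 < p)%N -> (p ^ 117 < q <= p ^ 243)%N -> coprimez a q%:Z ->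
  `|q%:R * alpha - a%:~R| <= (p ^ 243)%:R^-1 ->
  normc (\sum_(i < p ^ 120) expi (alpha * (i%:R + c) ^+ 3)) ^+ 4 <= C * p%:R ^+ 365.
Proof.
have [c1 hc1] := @ndiv_scale 8 240 isT.
have [c2 c21 hc2] := harm_scale 243.
exists (10 + 48 * c1%:R * (26 + 52 * c2)) => [|p q a alpha c p0 /andP[q1 q2] cop app].
  by rewrite addr_ge0 // !mulr_ge0 //; lra.
have q0 : (0 < q)%N by exact: leq_ltn_trans q1.
have qp : 0 < q%:R :> R by rewrite ltr0n.
set x : R := p%:R; have x1 : 1 <= x by rewrite ler1n.
have xn k : 0 <= x ^+ k by rewrite exprn_ge0 // (le_trans ler01).
have xm k l : (k <= l)%N -> x ^+ k <= x ^+ l by move=> kl; apply: ler_weXn2l.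
have qx1 : x ^+ 117 <= q%:R by rewrite -natrX ler_nat ltnW.
have qx2 : q%:R <= x ^+ 243 by rewrite -natrX ler_nat.
have app2 : `|alpha - a%:~R / q%:R| <= (q%:R ^+ 2)^-1.
  have := approx_div q0 app; rewrite natrX -/x => h.
  rewrite -[leRHS]mul1r ler_pdivlMr ?exprn_gt0 // expr2 mulrA mulrAC.
  apply: le_trans (_ : (x ^+ 243)^-1 * q%:R <= _).
    by rewrite ler_wpM2r // mulrC.
  by rewrite mulrC ler_pdivrMr ?mul1r // exprn_gt0 // (lt_le_trans ltr01).
have hd m : (0 < m < p ^ 120 * p ^ 120)%N -> (ndiv m <= c1 * p)%N.
  by rewrite -expnD; exact: hc1.
apply: le_trans (weyl_minor c q0 cop app2 hd) _.
have H : harm R q <= c2 * x by exact: hc2.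
have H0 := harm_ge0 R q.
rewrite natrX natrM -/x [in leRHS]mulrDl; apply: lerD.
  by rewrite -exprM ler_pM2l // xm.
have e1 : 12 * (x ^+ 120) ^+ 2 / q%:R <= 12 * x ^+ 123.
  rewrite ler_pdivrMr // -mulrA ler_pM2l // -exprM (_ : (120 * 2 = 123 + 117)%N) // exprD.
  by rewrite ler_wpM2l.
have e2 : (12 * (x ^+ 120) ^+ 2 / q%:R + 1) * (2 * x ^+ 120 + 4 * q%:R * harm R q) <= (26 + 52 * c2) * x ^+ 244.
  have -> : (12 * (x ^+ 120) ^+ 2 / q%:R + 1) * (2 * x ^+ 120 + 4 * q%:R * harm R q) =
    12 * (x ^+ 120) ^+ 2 / q%:R * (2 * x ^+ 120) + 48 * ((x ^+ 120) ^+ 2 * harm R q)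
    + (2 * x ^+ 120 + 4 * (q%:R * harm R q)).
    by field; rewrite gt_eqF.
  have f1 : 12 * (x ^+ 120) ^+ 2 / q%:R * (2 * x ^+ 120) <= 24 * x ^+ 244.
    apply: le_trans (ler_wpM2r _ e1) _; first by rewrite mulr_ge0.
    rewrite (_ : 12 * x ^+ 123 * (2 * x ^+ 120) = 24 * (x ^+ 123 * x ^+ 120)); last by ring.
    by rewrite -exprD ler_pM2l // xm.
  have f2 : (x ^+ 120) ^+ 2 * harm R q <= c2 * x ^+ 244.
    apply: le_trans (ler_wpM2l _ H) _; first by rewrite -exprM.
    by rewrite mulrCA -exprM -exprSr ler_wpM2l ?xm // (le_trans ler01).
  have f3 : q%:R * harm R q <= c2 * x ^+ 244.
    apply: le_trans (ler_pM _ _ qx2 H) _ => //.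
    by rewrite mulrCA -exprSr.
  have f4 : x ^+ 120 <= x ^+ 244 by exact: xm.
  rewrite mulrDl; lra.
have -> : 48 * c1%:R * (26 + 52 * c2) * x ^+ 365 =
    48 * x ^+ 120 * (c1%:R * x * ((26 + 52 * c2) * x ^+ 244)).
  have -> : x ^+ 365 = x ^+ 120 * x * x ^+ 244 by rewrite -exprSr -exprD.
  by ring.
have x0 : 0 <= x by exact: le_trans x1.
by apply: ler_wpM2l; [rewrite mulr_ge0 | apply: ler_wpM2l => //; rewrite mulr_ge0].
Qed.

(** The error terms of [weyl_major] are O(p^361). They are absorbed by the main term: with P =
    p^120, q (1 + P^3 |alpha - a / q|) <= 2 p^117, the second part because 360 - 243 = 117, so the
    main term is at least p^363 / 2. *)
Lemma major_long : exists2 C : R, 0 <= C & forall (p q : nat) (a : int) (alpha c : R),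
  (2 < p)%N -> (0 < q <= p ^ 117)%N -> coprimez a q%:Z ->
  `|q%:R * alpha - a%:~R| <= (p ^ 243)%:R^-1 ->
  normc (\sum_(i < p ^ 120) expi (alpha * (i%:R + c) ^+ 3)) ^+ 4 <=
  C * ((p ^ 120)%:R ^+ 4 * (rt 5 q%:R / q%:R)
     / fr (1 + (p ^ 120)%:R ^+ 3 * `|alpha - a%:~R / q%:R|) ^+ 3).
Proof.
have [c1 c11 hc1] := ndiv_rt 5.
have [c2 c21 hc2] := harm_scale 117.
pose C2 : R := 10 + 48 * 4 * 3 * (2 + 4 * c2).
exists (2 * C2 + 48 * 96 * c1) => [|p q a alpha c p3 /andP[q0 q1] cop app].
  by rewrite /C2; lra.
have qp : 0 < q%:R :> R by rewrite ltr0n.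
have p0 : (0 < p)%N by exact: leq_trans p3.
set x : R := p%:R; have x1 : 1 <= x by rewrite ler1n.
have x0 : 0 < x by exact: lt_le_trans x1.
have x3 : 3 <= x by rewrite /x (ler_nat _ 3).
have xn k : 0 < x ^+ k by rewrite exprn_gt0.
have xm k l : (k <= l)%N -> x ^+ k <= x ^+ l by move=> kl; apply: ler_weXn2l.
have qx : q%:R <= x ^+ 117 by rewrite -natrX ler_nat.
have bq : q%:R * `|alpha - a%:~R / q%:R| <= (x ^+ 243)^-1.
  by rewrite -natrX; exact: approx_div.
rewrite natrX -/x; set bt := `|_| in bq *; have bt0 : 0 <= bt by exact: normr_ge0.
have xinv k l : x ^+ k * (x ^+ (k + l))^-1 = (x ^+ l)^-1.
  by rewrite exprD; field; rewrite !gt_eqF.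
have small : 12 * (p ^ 120)%:R ^+ 2 * q%:R * bt <= 1.
  rewrite natrX -/x -mulrA -exprM; apply: le_trans (ler_wpM2l _ bq) _.
    by rewrite mulr_ge0 // ltW.
  rewrite -mulrA (xinv 240 3) ler_pdivrMr //; have := x3; nra.
have := weyl_major c q0 cop small; rewrite -/bt natrX -/x => main.
apply: le_trans main _.
have H : harm R q <= c2 * x by exact: hc2.
have H0 := harm_ge0 R q.
set E := fr _ ^+ 3.
have B0 : 0 <= (x ^+ 120) ^+ 3 * bt by rewrite mulr_ge0 // exprn_ge0 // ltW.
have F1 : 1 <= fr (1 + (x ^+ 120) ^+ 3 * bt) by apply: rt_ge1; lra.
have E1 : 1 <= E by rewrite exprn_ege1.
have E0 : 0 < E by exact: lt_le_trans E1.
have EB : E <= 1 + (x ^+ 120) ^+ 3 * bt.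
  rewrite -[leRHS]fr4; last by lra.
  by rewrite [leRHS]exprS ler_peMl // ltW.
have qE : q%:R * E <= 2 * x ^+ 117.
  apply: le_trans (ler_wpM2l (ltW qp) EB) _; rewrite mulrDr mulr1 mulrCA.
  have h : (x ^+ 120) ^+ 3 * (q%:R * bt) <= x ^+ 117.
    apply: le_trans (ler_wpM2l _ bq) _; first by rewrite exprn_ge0 // ltW.
    rewrite -exprM ler_pdivrMr // -exprD; exact: xm.
  lra.
have s1 : 1 <= rt 5 q%:R :> R by apply: rt_ge1; rewrite ler1n.
have err : 10 * (x ^+ 120) ^+ 3 + 48 * x ^+ 120 * (x ^+ 120 * (4 * (2 * x ^+ 120 + q%:R) * (2 + 4 * harm R q)))
   <= C2 * x ^+ 361.
  have g1 : 2 * x ^+ 120 + q%:R <= 3 * x ^+ 120.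
    have := xm 117 120 isT; lra.
  have g2 : 2 + 4 * harm R q <= (2 + 4 * c2) * x by nra.
  have g3 : (2 * x ^+ 120 + q%:R) * (2 + 4 * harm R q) <= (3 * x ^+ 120) * ((2 + 4 * c2) * x).
    apply: ler_pM => //; last by lra.
    by rewrite addr_ge0 // mulr_ge0 // ltW.
  have g4 : (x ^+ 120) ^+ 3 <= x ^+ 361 by rewrite -exprM; exact: xm.
  have -> : 48 * x ^+ 120 * (x ^+ 120 * (4 * (2 * x ^+ 120 + q%:R) * (2 + 4 * harm R q))) =
    48 * 4 * (x ^+ 120) ^+ 2 * ((2 * x ^+ 120 + q%:R) * (2 + 4 * harm R q)) by ring.
  have g5 : 48 * 4 * (x ^+ 120) ^+ 2 * ((2 * x ^+ 120 + q%:R) * (2 + 4 * harm R q)) <=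
     48 * 4 * (x ^+ 120) ^+ 2 * ((3 * x ^+ 120) * ((2 + 4 * c2) * x)).
    by apply: ler_wpM2l => //; rewrite mulr_ge0 // sqr_ge0.
  have g6 : 48 * 4 * (x ^+ 120) ^+ 2 * ((3 * x ^+ 120) * ((2 + 4 * c2) * x)) =
     48 * 4 * 3 * (2 + 4 * c2) * x ^+ 361.
    have -> : x ^+ 361 = (x ^+ 120) ^+ 3 * x by rewrite -exprM -exprSr.
    by ring.
  rewrite /C2 mulrDl; lra.
pose W := (x ^+ 120) ^+ 4 * (rt 5 q%:R / q%:R) / E.
have WE : W * (q%:R * E) = (x ^+ 120) ^+ 4 * rt 5 q%:R.
  by rewrite /W; move: (x ^+ 120) => X; field; rewrite !gt_eqF.
have W0 : 0 <= W.
  rewrite divr_ge0 ?(ltW E0) // mulr_ge0 //; first by rewrite exprn_ge0 // ltW.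
  by rewrite divr_ge0 ?(ltW qp) // (le_trans ler01).
have eW : x ^+ 361 <= 2 * W.
  rewrite -(ler_pM2r (xn 117)) -exprD.
  apply: le_trans (_ : (x ^+ 120) ^+ 4 * rt 5 q%:R <= _).
    rewrite -exprM; apply: le_trans (_ : x ^+ 480 * 1 <= _); first by rewrite mulr1 xm.
    by rewrite ler_pM2l.
  rewrite -WE (_ : 2 * W * x ^+ 117 = W * (2 * x ^+ 117)); last by ring.
  exact: ler_wpM2l.
have mainW : 48 * x ^+ 120 * (96 * (x ^+ 120) ^+ 3 * (ndiv q)%:R / q%:R / E) <= 48 * 96 * c1 * W.
  have -> : 48 * x ^+ 120 * (96 * (x ^+ 120) ^+ 3 * (ndiv q)%:R / q%:R / E) =
     48 * 96 * ((x ^+ 120) ^+ 4 / q%:R / E) * (ndiv q)%:R by ring.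
  have -> : 48 * 96 * c1 * W = 48 * 96 * ((x ^+ 120) ^+ 4 / q%:R / E) * (c1 * rt 5 q%:R).
    by rewrite /W; ring.
  apply: ler_wpM2l; last exact: hc1.
  by rewrite mulr_ge0 // divr_ge0 ?(ltW E0) // divr_ge0 ?(ltW qp) // exprn_ge0 // ltW.
rewrite [48 * _ * (_ + _)]mulrDr addrA [leRHS]mulrDl; apply: lerD => //.
apply: le_trans err _; rewrite -/W (mulrC 2) -mulrA; apply: ler_wpM2l => //.
by rewrite /C2; lra.
Qed.

(** The denominator may exceed the length p^80, and the error is as large as p^278 against p^320. So
    the fourth power is only asked to gain q^(1/4) <= p^30, and the decay away from a / q is
    dropped. *)
Lemma major_short : exists2 C : R, 0 <= C & forall (p q : nat) (a : int) (alpha c : R),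
  (2 < p)%N -> (0 < q <= p ^ 117)%N -> coprimez a q%:Z ->
  `|q%:R * alpha - a%:~R| <= (p ^ 243)%:R^-1 ->
  normc (\sum_(i < p ^ 80) expi (alpha * (i%:R + c) ^+ 3)) ^+ 4 <=
  C * ((p ^ 80)%:R ^+ 4 / rt 5 q%:R ^+ 8).
Proof.
have [c1 c11 hc1] := ndiv_rt 5.
have [c2 c21 hc2] := harm_scale 117.
pose C2 : R := 10 + 48 * 4 * 3 * (2 + 4 * c2).
exists (C2 + 48 * 96 * c1) => [|p q a alpha c p3 /andP[q0 q1] cop app].
  by rewrite /C2; lra.
have qp : 0 < q%:R :> R by rewrite ltr0n.
have p0 : (0 < p)%N by exact: leq_trans p3.
set x : R := p%:R; have x1 : 1 <= x by rewrite ler1n.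
have x0 : 0 < x by exact: lt_le_trans x1.
have x3 : 3 <= x by rewrite /x (ler_nat _ 3).
have xn k : 0 < x ^+ k by rewrite exprn_gt0.
have xm k l : (k <= l)%N -> x ^+ k <= x ^+ l by move=> kl; apply: ler_weXn2l.
have qx : q%:R <= x ^+ 117 by rewrite -natrX ler_nat.
have bq : q%:R * `|alpha - a%:~R / q%:R| <= (x ^+ 243)^-1.
  by rewrite -natrX; exact: approx_div.
set bt := `|_| in bq *; have bt0 : 0 <= bt by exact: normr_ge0.
have xinv k l : x ^+ k * (x ^+ (k + l))^-1 = (x ^+ l)^-1.
  by rewrite exprD; field; rewrite !gt_eqF.
have small : 12 * (p ^ 80)%:R ^+ 2 * q%:R * bt <= 1.
  rewrite natrX -/x -mulrA -exprM; apply: le_trans (ler_wpM2l _ bq) _.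
    by rewrite mulr_ge0 // ltW.
  rewrite -mulrA (xinv 160 83) ler_pdivrMr // mul1r; apply: le_trans (xm 3 83 isT).
  have := x3; nra.
have := weyl_major c q0 cop small; rewrite -/bt natrX -/x => main.
apply: le_trans main _.
have H : harm R q <= c2 * x by exact: hc2.
have H0 := harm_ge0 R q.
set E := fr _ ^+ 3.
have B0 : 0 <= (x ^+ 80) ^+ 3 * bt by rewrite mulr_ge0 // exprn_ge0 // ltW.
have E1 : 1 <= E by rewrite exprn_ege1 //; apply: rt_ge1; lra.
have E0 : 0 < E by exact: lt_le_trans E1.
set s := rt 5 q%:R; have s1 : 1 <= s by apply: rt_ge1; rewrite ler1n.
have s0 : 0 < s by exact: lt_le_trans s1.
have s32 : s ^+ 32 = q%:R by exact: (@rt_exp R 5).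
have s8 : s ^+ 8 <= x ^+ 30.
  rewrite -(@ler_pXn2r _ 4) ?nnegrE ?exprn_ge0 ?(ltW s0) ?(ltW x0) // -!exprM s32.
  exact: le_trans qx (xm _ _ _).
have err : 10 * (x ^+ 80) ^+ 3 + 48 * x ^+ 80 * (x ^+ 80 * (4 * (2 * x ^+ 80 + q%:R) * (2 + 4 * harm R q)))
   <= C2 * x ^+ 278.
  have g1 : 2 * x ^+ 80 + q%:R <= 3 * x ^+ 117.
    have := xm 80 117 isT; lra.
  have g2 : 2 + 4 * harm R q <= (2 + 4 * c2) * x by nra.
  have g3 : (2 * x ^+ 80 + q%:R) * (2 + 4 * harm R q) <= (3 * x ^+ 117) * ((2 + 4 * c2) * x).
    apply: ler_pM => //; last by lra.
    by rewrite addr_ge0 // mulr_ge0 // ltW.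
  have g4 : (x ^+ 80) ^+ 3 <= x ^+ 278 by rewrite -exprM; exact: xm.
  have -> : 48 * x ^+ 80 * (x ^+ 80 * (4 * (2 * x ^+ 80 + q%:R) * (2 + 4 * harm R q))) =
    48 * 4 * (x ^+ 80) ^+ 2 * ((2 * x ^+ 80 + q%:R) * (2 + 4 * harm R q)) by ring.
  have g5 : 48 * 4 * (x ^+ 80) ^+ 2 * ((2 * x ^+ 80 + q%:R) * (2 + 4 * harm R q)) <=
     48 * 4 * (x ^+ 80) ^+ 2 * ((3 * x ^+ 117) * ((2 + 4 * c2) * x)).
    by apply: ler_wpM2l => //; rewrite mulr_ge0 // sqr_ge0.
  have g6 : 48 * 4 * (x ^+ 80) ^+ 2 * ((3 * x ^+ 117) * ((2 + 4 * c2) * x)) =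
     48 * 4 * 3 * (2 + 4 * c2) * x ^+ 278.
    have -> : x ^+ 278 = (x ^+ 80) ^+ 2 * (x ^+ 117 * x) by rewrite -exprM -exprSr -exprD.
    by ring.
  rewrite /C2 mulrDl; lra.
rewrite [48 * _ * (_ + _)]mulrDr addrA [leRHS]mulrDl; apply: lerD.
  apply: le_trans err _; rewrite ler_wpM2l //; first by rewrite /C2; lra.
  rewrite ler_pdivlMr ?exprn_gt0 //; apply: le_trans (ler_wpM2l (ltW (xn _)) s8) _.
  by rewrite -exprD -exprM; exact: xm.
have -> : 48 * x ^+ 80 * (96 * (x ^+ 80) ^+ 3 * (ndiv q)%:R / q%:R / E) =
   48 * 96 * (x ^+ 80) ^+ 4 * ((ndiv q)%:R / q%:R / E) by ring.
have -> : 48 * 96 * c1 * ((x ^+ 80) ^+ 4 / s ^+ 8) = 48 * 96 * (x ^+ 80) ^+ 4 * (c1 / s ^+ 8).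
  by ring.
apply: ler_wpM2l; first by rewrite mulr_ge0 // exprn_ge0 // ltW.
apply: le_trans (_ : (ndiv q)%:R / q%:R <= _).
  by rewrite ler_pdivrMr // ler_peMr // divr_ge0 // ltW.
rewrite ler_pdivrMr // mulrAC ler_pdivlMr ?exprn_gt0 //.
apply: le_trans (_ : c1 * s * s ^+ 8 <= _).
  by rewrite ler_wpM2r ?exprn_ge0 ?(ltW s0) // hc1.
rewrite -mulrA -exprS ler_wpM2l ?(le_trans ler01) // -s32.
exact: ler_weXn2l.
Qed.

End Scales.

(** * The fixed arcs and the irrational shift *)

Section Irrational.
Variable R : realType.
Local Notation normc := (@Normc.normc R).

(** Irrationality with cleared denominators, a form stable under integer affine maps and directly
    opposed to the vanishing of [dZ (q%:R * t)]. *)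
Definition irr (t : R) := forall k a : int, k != 0 -> k%:~R * t <> a%:~R.

Lemma irrational_irr t : irrational t -> irr t.
Proof.
move=> it k a k0 e; apply: it; exists (a%:~R / k%:~R) => //.
have kR : k%:~R != 0 :> R by rewrite intr_eq0.
by rewrite fmorph_div /= !ratr_int -e mulrC mulKf.
Qed.

Lemma irr_affine t (m b : int) : m != 0 -> irr t -> irr (m%:~R * t + b%:~R).
Proof.
move=> m0 it k a k0 e; apply: (it (k * m) (a - k * b)); first by rewrite mulf_neq0.
by rewrite intrB !intrM -e; ring.
Qed.

Lemma irr_dZ_gt0 t : irr t -> forall q0 : nat, exists2 d : R, 0 < d &
  forall q : nat, (0 < q < q0)%N -> d <= dZ (q%:R * t).
Proof.
move=> it; elim=> [|q0 [d d0 IH]]; first by exists 1 => // q; rewrite ltn0 andbF.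
have [->|q00] := posnP q0; first by exists 1 => // q; lia.
have e0 : 0 < dZ (q0%:R * t).
  rewrite /dZ normr_gt0 subr_eq0; apply/eqP => e.
  by apply: (it q0%:Z _ _ e); rewrite -lt0n.
exists (Num.min d (dZ (q0%:R * t))) => [|q /andP[q1 q2]]; first by rewrite lt_min d0.
rewrite ge_min; move: q2; rewrite ltnS leq_eqVlt => /orP[/eqP ->|q2]; first by rewrite lexx orbT.
by rewrite IH ?q1.
Qed.

(** Denominators below [q0] keep [dZ (q%:R * t)] above some d > 0, so Dirichlet's theorem with 1 / Y
    < d must return a larger one. *)
Lemma irr_approx t : irr t -> forall q0 : nat, exists (q : nat) (a : int),
  [/\ (0 < q)%N, (q0 <= q)%N, coprimez a q%:Z & `|t - a%:~R / q%:R| <= (q%:R ^+ 2)^-1].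
Proof.
move=> it q0; have [d d0 hd] := irr_dZ_gt0 it q0.
pose Y := (Num.truncn d^-1).+1.
have Yp : 0 < Y%:R :> R by rewrite ltr0n.
have Yd : Y%:R^-1 < d.
  rewrite -[d]invrK ltf_pV2 ?posrE ?invr_gt0 //.
  have d1 : 0 <= d^-1 by rewrite invr_ge0 ltW.
  by have /andP[] := truncn_itv d1.
have [q [a [/andP[q1 qY] cop app]]] := dirichlet t (ltn0Sn _ : (0 < Y)%N).
have qp : 0 < q%:R :> R by rewrite ltr0n.
exists q, a; split => //.
  rewrite leqNgt; apply/negP => qq.
  have := hd q; rewrite q1 qq => /(_ isT) h.
  have := le_trans (dZ_le (q%:R * t) a) app; lra.
have := approx_div q1 app => h.
rewrite -[leRHS]mul1r ler_pdivlMr ?exprn_gt0 // expr2 mulrA mulrAC.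
apply: le_trans (_ : Y%:R^-1 * q%:R <= _); first by rewrite ler_wpM2r ?(ltW qp) // mulrC.
by rewrite mulrC ler_pdivrMr // mul1r ler_nat.
Qed.

(** Differencing once leaves [b] and [c] only in constant phases, whence the uniformity in both. The
    quadratic term from [sum_mm_rat] is 2 * 3 * 2 * 2 m^2 / q, so q must be at least 24 / eps^2. *)
Lemma quadratic_small g : irr g -> forall eps : R, 0 < eps -> exists2 C : R, 0 <= C &
  forall (m : nat) (b c : R),
    normc (\sum_(z < m) expi (g * z%:R ^+ 2 + b * z%:R + c)) <= eps * m%:R + C.
Proof.
move=> ig eps e0.
have i2 : irr (2 * g).
  by have := @irr_affine g 2 0 isT ig; rewrite addr0.
pose q0 := (Num.truncn (24 / eps ^+ 2)).+1.
have [q [a [q1 qq cop app]]] := irr_approx i2 q0.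
have qp : 0 < q%:R :> R by rewrite ltr0n.
have H0 := harm_ge0 R q; set H := harm R q in H0.
have e2 : 0 < eps ^+ 2 by rewrite exprn_gt0.
have qe : 24 / q%:R <= eps ^+ 2.
  rewrite ler_pdivrMr // mulrC -ler_pdivrMr //.
  have h0 : 0 <= 24 / eps ^+ 2 by rewrite divr_ge0 // ltW.
  have /andP[_ h1] := truncn_itv h0.
  by apply: le_trans (ltW h1) _; rewrite ler_nat.
pose C1 := 13 + 48 * H; pose C2 := 24 * q%:R * H.
have C10 : 0 <= C1 by rewrite /C1; lra.
have C20 : 0 <= C2 by rewrite /C2 !mulr_ge0 // ltW.
exists (C1 / eps + C2 + 1) => [|m b c].
  by rewrite !addr_ge0 // divr_ge0 // ltW.
set S := normc _; have S0 : 0 <= S by exact: normc_ge0.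
have m0 : 0 <= m%:R :> R by [].
have S2 : S ^+ 2 <= eps ^+ 2 * m%:R ^+ 2 + C1 * m%:R + C2.
  apply: le_trans (vdc m (fun z => g * z%:R ^+ 2 + b * z%:R + c)) _.
  apply: le_trans (_ : m%:R + 2 * (3 * \sum_(h < m) mm m%:R (2 * g * h%:R)) <= _).
    rewrite lerD2l ler_pM2l // mulr_sumr -(big_mkord xpredT (fun h => 3 * mm m%:R (2 * g * h%:R))).
    apply: le_trans (_ : \sum_(1 <= h < m) 3 * mm m%:R (2 * g * h%:R) <= _); last first.
      case: (m) => [|m']; first by rewrite !big_geq.
      by rewrite [leRHS]big_ltn // lerDr mulr_ge0 // mm_ge0.
    apply: ler_sum => h _.
    have e (i : nat) : g * (i + h)%:R ^+ 2 + b * (i + h)%:R + c - (g * i%:R ^+ 2 + b * i%:R + c) =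
       i%:R * (2 * g * h%:R) + (g * h%:R ^+ 2 + b * h%:R) by rewrite natrD; ring.
    under eq_bigr => i _ do rewrite e.
    apply: le_trans (normc_expi_geom _ _ _) _; rewrite ler_pM2l //.
    by apply: mm_mono; rewrite ler0n ler_nat leq_subr.
  have := @sum_mm_rat R (2 * g) a q m m%:R q1 m0 cop app; rewrite -/H => h.
  have -> : eps ^+ 2 * m%:R ^+ 2 + C1 * m%:R + C2 = (eps ^+ 2 - 24 / q%:R) * m%:R ^+ 2 + (m%:R + 2 * (3 * ((2 * m%:R / q%:R + 1) * (2 * m%:R + 4 * q%:R * H)))).
    by rewrite /C1 /C2; field; rewrite gt_eqF.
  have h2 : 0 <= (eps ^+ 2 - 24 / q%:R) * m%:R ^+ 2 by rewrite mulr_ge0 ?sqr_ge0 // subr_ge0.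
  lra.
set C := C1 / eps + C2 + 1.
have CE : C1 <= eps * C.
  have -> : eps * C = C1 + (eps * C2 + eps) by rewrite /C; field; rewrite gt_eqF.
  by rewrite lerDl addr_ge0 ?(ltW e0) // mulr_ge0 // ltW.
have CC : C2 <= C ^+ 2.
  have h1 : 0 <= C1 / eps by rewrite divr_ge0 // ltW.
  by rewrite /C; nra.
have C0 : 0 <= C by rewrite /C !addr_ge0 // divr_ge0 // ltW.
have X0 : 0 <= eps * m%:R + C by exact: (addr_ge0 (mulr_ge0 (ltW e0) m0) C0).
rewrite -(@ler_pXn2r _ 2) ?nnegrE //.
apply: le_trans S2 _.
have : C1 * m%:R <= eps * C * m%:R by rewrite ler_wpM2r.
have : 0 <= eps * C * m%:R by rewrite !mulr_ge0 // ltW.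
nra.
Qed.

Lemma sum_grid (V : nmodType) (f : nat -> V) (B q : nat) :
  \sum_(n < B * q) f n = \sum_(z < B) \sum_(r < q) f (z * q + r)%N.
Proof.
elim: B => [|B IH]; first by rewrite mul0n !big_ord0.
by rewrite mulSn addnC big_split_ord /= big_ord_recr /= IH.
Qed.

Lemma normc_sum_expi_le (n : nat) (f : nat -> R) : normc (\sum_(i < n) expi (f i)) <= n%:R.
Proof.
apply: le_trans (normc_sum _ _ _) _; under eq_bigr do rewrite normc_expi.
by rewrite sumr_const card_ord.
Qed.

(** Writing j = z q + r gives z^3 the integer coefficient a q^2, so it disappears modulo 1. What
    remains is quadratic in z with leading coefficient 3 a q (r + t), irrational because t is and a
    is not 0. *)
Lemma rational_cube_small t (a : int) (q : nat) : irr t -> a != 0 -> (0 < q)%N ->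
  forall eps : R, 0 < eps -> exists2 C : R, 0 <= C &
  forall m : nat, normc (\sum_(j < m) expi (a%:~R / q%:R * (j%:R + t) ^+ 3)) <= eps * m%:R + C.
Proof.
move=> it a0 q0 eps e0; have qp : 0 < q%:R :> R by rewrite ltr0n.
have hr (r : 'I_q) : exists C : R, 0 <= C /\ forall (m : nat) (b c : R),
   normc (\sum_(z < m) expi (3 * a%:~R * q%:R * (r%:R + t) * z%:R ^+ 2 + b * z%:R + c)) <= eps * m%:R + C.
  have ig : irr (3 * a%:~R * q%:R * (r%:R + t)).
    have := @irr_affine t (3 * a * q%:Z) (3 * a * q%:Z * r%:Z) _ it.
    rewrite !intrM -!pmulrn.
    have -> : 3 * a%:~R * q%:R * t + 3 * a%:~R * q%:R * r%:R = 3 * a%:~R * q%:R * (r%:R + t) :> R by ring.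
    by apply; rewrite !mulf_neq0 // -lt0n.
  by have [C C0 hC] := quadratic_small ig e0; exists C.
have [Cf hC] := fin_all_exists hr.
exists (\sum_(r < q) Cf r + q%:R) => [|m].
  by rewrite addr_ge0 // sumr_ge0 // => r _; case: (hC r).
have mE := divn_eq m q; pose B := (m %/ q)%N.
have -> : \sum_(j < m) expi (a%:~R / q%:R * (j%:R + t) ^+ 3) =
    \sum_(j < B * q) expi (a%:~R / q%:R * (j%:R + t) ^+ 3) +
    \sum_(j < m %% q) expi (a%:~R / q%:R * ((B * q + j)%:R + t) ^+ 3).
  rewrite -[in LHS](big_mkord xpredT (fun j => expi (a%:~R / q%:R * (j%:R + t) ^+ 3))).
  by rewrite {1}mE big_mkord big_split_ord.
apply: le_trans (le_normcD _ _) _.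
rewrite addrA; apply: lerD; last first.
  apply: le_trans (@normc_sum_expi_le _ (fun i => a%:~R / q%:R * ((B * q + i)%:R + t) ^+ 3)) _.
  by rewrite ler_nat ltnW // ltn_mod.
rewrite (@sum_grid _ (fun n => expi (a%:~R / q%:R * (n%:R + t) ^+ 3)) B q) exchange_big /=.
apply: le_trans (normc_sum _ _ _) _.
apply: le_trans (_ : \sum_(r < q) (eps * B%:R + Cf r) <= _); last first.
  rewrite big_split /= lerD2r sumr_const card_ord -[leLHS]mulr_natr -mulrA ler_wpM2l ?(ltW e0) //.
  by rewrite -natrM ler_nat leq_divM.
apply: ler_sum => r _; have [C0 h] := hC r.
apply: le_trans (h B (3 * a%:~R * (r%:R + t) ^+ 2) (a%:~R / q%:R * (r%:R + t) ^+ 3)).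
rewrite le_eqVlt; apply/orP; left; apply/eqP; congr (normc _); apply: eq_bigr => z _.
rewrite natrD natrM.
have -> : a%:~R / q%:R * (z%:R * q%:R + r%:R + t) ^+ 3 =
  (3 * a%:~R * q%:R * (r%:R + t) * z%:R ^+ 2 + 3 * a%:~R * (r%:R + t) ^+ 2 * z%:R
   + a%:~R / q%:R * (r%:R + t) ^+ 3) + (a * (q ^ 2 * z ^ 3)%N%:Z)%:~R :> R.
  by rewrite intrM -pmulrn natrM !natrX; field; rewrite gt_eqF.
by rewrite expiD expi_int mulr1.
Qed.

Lemma abel_bound (m : nat) (s w : nat -> R[i]) (M V : R) :
  (forall l, (l <= m)%N -> normc (\sum_(j < l) s j) <= M) ->
  (forall j, (j <= m)%N -> normc (w j) <= 1) ->
  (forall j, (j < m)%N -> normc (w j.+1 - w j) <= V) ->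
  normc (\sum_(j < m) s j * w j) <= M * (1 + m%:R * V).
Proof.
move=> hs hw hv.
have e l : \sum_(j < l) s j * w j = (\sum_(j < l) s j) * w l -
    \sum_(j < l) (\sum_(i < j.+1) s i) * (w j.+1 - w j).
  elim: l => [|l IH]; first by rewrite !big_ord0 mul0r subr0.
  rewrite big_ord_recr /= IH [X in _ = _ - X]big_ord_recr /= [\sum_(j < l.+1) s j]big_ord_recr /=.
  by ring.
have M0 : 0 <= M by apply: le_trans (hs 0%N isT); exact: normc_ge0.
rewrite e; apply: le_trans (le_normcD _ _) _; rewrite normcN mulrDr mulr1.
apply: lerD.
  rewrite Normc.normcM -[leRHS]mulr1; apply: ler_pM; rewrite ?normc_ge0 //; first exact: hs.
  exact: hw.
apply: le_trans (normc_sum _ _ _) _.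
apply: le_trans (_ : \sum_(j < m) M * V <= _).
  apply: ler_sum => j _; rewrite Normc.normcM; apply: ler_pM; rewrite ?normc_ge0 //.
    by apply: hs; exact: ltn_ord.
  exact: hv.
by rewrite sumr_const card_ord -[leLHS]mulr_natl mulrCA.
Qed.

(** Partial summation removes the phase of beta = alpha - a / q. Per step it varies by at most 8 *
    27 P^2 |beta| <= 216 B0 / P, over at most 2 P steps, so the loss is W = 1 + 432 B0. The sum
    starting at P is the difference of two initial sums. *)
Lemma cube_near_rational_small t (a : int) (q : nat) (B0 eps : R) :
  irr t -> 0 <= t <= 1 -> a != 0 -> (0 < q)%N -> 0 <= B0 -> 0 < eps ->
  exists n0 : nat, forall P : nat, (n0 <= P)%N -> forall alpha : R,
  P%:R ^+ 3 * `|alpha - a%:~R / q%:R| <= B0 ->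
  normc (\sum_(i < P) expi (alpha * (i%:R + (P%:R + t)) ^+ 3)) <= eps * P%:R.
Proof.
move=> it /andP[t0 t1] a0 q0 B00 e0.
pose W := 1 + 432 * B0; have W0 : 0 < W by rewrite /W; lra.
have e1 : 0 < eps / (8 * W) by rewrite divr_gt0 // mulr_gt0.
have [C C0 hC] := rational_cube_small it a0 q0 e1.
exists (Num.truncn (4 * C * W / eps)).+1 => P hP alpha app.
have P0 : (0 < P)%N by exact: leq_trans hP.
have Pp : 1 <= P%:R :> R by rewrite ler1n.
have CP : 4 * C * W <= eps * P%:R.
  rewrite [leRHS]mulrC -ler_pdivrMr //.
  have h0 : 0 <= 4 * C * W / eps by rewrite divr_ge0 ?mulr_ge0 // ltW.
  have /andP[_ h1] := truncn_itv h0.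
  by apply: le_trans (ltW h1) _; rewrite ler_nat.
pose f (j : nat) := expi (alpha * (j%:R + t) ^+ 3).
have U l : (l <= 2 * P)%N -> normc (\sum_(j < l) f j) <= (eps / (8 * W) * (2 * P%:R) + C) * W.
  move=> lP; set bt := alpha - a%:~R / q%:R in app *.
  have fE j : f j = expi (a%:~R / q%:R * (j%:R + t) ^+ 3) * expi (bt * (j%:R + t) ^+ 3).
    by rewrite -expiD /f; congr expi; rewrite /bt; ring.
  under eq_bigr => j _ do rewrite fE.
  have M0 : 0 <= eps / (8 * W) * (2 * P%:R) + C by rewrite addr_ge0 // mulr_ge0 // ltW // mulr_gt0; lra.
  apply: le_trans (@abel_bound l (fun j => expi (a%:~R / q%:R * (j%:R + t) ^+ 3))
     (fun j => expi (bt * (j%:R + t) ^+ 3)) (eps / (8 * W) * (2 * P%:R) + C) (216 * B0 / P%:R) _ _ _) _.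
  - move=> k kl; apply: le_trans (hC k) _; rewrite lerD2r ler_wpM2l ?(ltW e1) //.
    by rewrite -natrM ler_nat (leq_trans kl).
  - by move=> j _; rewrite normc_expi.
  - move=> j jl; apply: le_trans (normc_expiB_le _ _) _.
    rewrite -mulrBr normrM.
    have j0 : 0 <= j%:R :> R by [].
    have jP : j%:R + 1 <= 2 * P%:R :> R.
      by rewrite natr1 -natrM ler_nat (leq_trans jl).
    have -> : (j.+1%:R + t) ^+ 3 - (j%:R + t) ^+ 3 = 3 * (j%:R + t) ^+ 2 + 3 * (j%:R + t) + 1.
      by rewrite -[j.+1%:R]natr1; ring.
    have d0 : 0 <= 3 * (j%:R + t) ^+ 2 + 3 * (j%:R + t) + 1 by nra.
    rewrite (ger0_norm d0).
    have d1 : 3 * (j%:R + t) ^+ 2 + 3 * (j%:R + t) + 1 <= 27 * P%:R ^+ 2.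
      have : j%:R + t <= 2 * P%:R by lra.
      nra.
    rewrite ler_pdivlMr; last by lra.
    have b0 := normr_ge0 bt.
    have : `|bt| * (3 * (j%:R + t) ^+ 2 + 3 * (j%:R + t) + 1) <= `|bt| * (27 * P%:R ^+ 2) by rewrite ler_wpM2l.
    have : P%:R ^+ 3 * `|bt| = P%:R * (`|bt| * P%:R ^+ 2) by ring.
    set u := `|bt| * (_ + 1); set v := `|bt| * P%:R ^+ 2.
    have -> : `|bt| * (27 * P%:R ^+ 2) = 27 * v by rewrite /v; ring.
    move=> e3 h3; rewrite e3 in app.
    have : u * P%:R <= 27 * v * P%:R by rewrite ler_wpM2r //; lra.
    lra.
  rewrite ler_wpM2l // /W lerD2l.
  have -> : l%:R * (216 * B0 / P%:R) = 216 * B0 * (l%:R / P%:R) by ring.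
  have : l%:R / P%:R <= 2 :> R by rewrite ler_pdivrMr -?natrM ?ler_nat ?ltr0n //; lra.
  have : 0 <= B0 by []; nra.
have -> : \sum_(i < P) expi (alpha * (i%:R + (P%:R + t)) ^+ 3) =
   \sum_(j < 2 * P) f j - \sum_(j < P) f j.
  rewrite mul2n -addnn big_split_ord /= addrC addrK; apply: eq_bigr => i _.
  by rewrite /f natrD; congr (expi (_ * _ ^+ 3)); ring.
apply: le_trans (le_normcD _ _) _; rewrite normcN.
have h1 := U (2 * P)%N (leqnn _); have h2 := U P ltac:(lia).
have h3 : (eps / (8 * W) * (2 * P%:R) + C) * W = eps * P%:R / 4 + C * W.
  by field; rewrite gt_eqF.
lra.
Qed.

End Irrational.

(** * The diagonal mean value of two cubes *)

Section Diagonal.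
Variable R : realType.
Local Notation normc := (@Normc.normc R).

Lemma normc_sqr_expi_fin (X : finType) (f : X -> R) :
  normc (\sum_x expi (f x)) ^+ 2 = \sum_x \sum_y cos (2 * pi * (f y - f x)).
Proof.
rewrite normc_sqr Re_sum Im_sum !expr2 !big_distrlr /= -big_split /=.
apply: eq_bigr => x _; rewrite -big_split /=; apply: eq_bigr => y _.
by rewrite cos_bilinear /=; ring.
Qed.

(** Opening the square leaves geometric sums over k with ratio (v y - v x) / D. For fixed x these
    points are spaced modulo 1, since differences of v lie between 1 and D / 2; the off-diagonal
    pairs therefore add at most a logarithm. *)
Lemma diagonal_sum (X : finType) (v : X -> R) (D K : nat) : (0 < D)%N ->
  (forall x y, x != y -> 1 <= `|v x - v y|) ->
  (forall x y, `|v x - v y| <= D%:R / 2) ->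
  \sum_(k < K) normc (\sum_x expi (k%:R / D%:R * v x)) ^+ 2 <=
  #|X|%:R * (3 * (2 * K%:R + 4 * D%:R * harm R D)).
Proof.
move=> D0 sep diam; have Dp : 0 < D%:R :> R by rewrite ltr0n.
under eq_bigr => k _ do rewrite normc_sqr_expi_fin.
have -> : #|X|%:R * (3 * (2 * K%:R + 4 * D%:R * harm R D)) =
    \sum_(x : X) 3 * (2 * K%:R + 4 * D%:R * harm R D) by rewrite sumr_const mulr_natl.
rewrite exchange_big /=; apply: ler_sum => x _; rewrite exchange_big /=.
apply: le_trans (_ : \sum_y 3 * mm K%:R ((v y - v x) / D%:R) <= _).
  apply: ler_sum => y _.
  have e (k : nat) : cos (2 * pi * (k%:R / D%:R * v y - k%:R / D%:R * v x)) =
     complex.Re (expi (k%:R * ((v y - v x) / D%:R) + 0)).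
    by rewrite /= addr0; congr (cos (_ * _)); ring.
  under eq_bigr => k _ do rewrite e.
  rewrite -Re_sum; apply: le_trans (ler_norm _) _; apply: le_trans (Re_le_normc _) _.
  exact: normc_expi_geom.
rewrite -mulr_sumr ler_pM2l // (eq_bigl (mem [set: X])); last by move=> y /=; rewrite finset.in_setT.
apply: separation => // y z _ _ yz.
have -> : (v y - v x) / D%:R - (v z - v x) / D%:R = (v y - v z) / D%:R by ring.
have nE : `|(v y - v z) / D%:R| = `|v y - v z| / D%:R by rewrite normrM normfV (ger0_norm (ltW Dp)).
rewrite dZ_small nE; last by rewrite ler_pdivrMr //; have := diam y z; lra.
rewrite invfM; have := sep y z yz => h.
rewrite ler_wpM2r ?invr_ge0 ?(ltW Dp) //; lra.
Qed.

Lemma cube_gap (x y : R) : 0 <= y -> y + 1 <= x -> 3 * y ^+ 2 + 1 <= x ^+ 3 - y ^+ 3.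
Proof.
move=> y0 yx; have -> : x ^+ 3 - y ^+ 3 = (x - y) * (x ^+ 2 + x * y + y ^+ 2) by ring.
have h : 3 * y ^+ 2 + 1 <= x ^+ 2 + x * y + y ^+ 2 by nra.
apply: le_trans h _; rewrite ler_peMl //; last by lra.
by nra.
Qed.

Lemma natr_gap (i j : nat) (t : R) : (i < j)%N -> i%:R + t + 1 <= j%:R + t.
Proof. by move=> ij; rewrite addrAC natr1 lerD2r ler_nat. Qed.

(** If the first coordinates differ, their cubes differ by more than 3 P^2, while the second cubes
    compensate at most P^2 because Q^3 <= P^2. Otherwise the second cubes alone are separated. *)
Lemma two_cubes_separated (P Q : nat) (t1 t2 : R) :
  (0 < P)%N -> (Q ^ 3 <= P ^ 2)%N -> 0 <= t1 <= 1 -> 0 <= t2 <= 1 ->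
  forall x y : 'I_P * 'I_Q, x != y ->
  1 <= `|((x.1)%:R + (P%:R + t1)) ^+ 3 + ((x.2)%:R + t2) ^+ 3
       - (((y.1)%:R + (P%:R + t1)) ^+ 3 + ((y.2)%:R + t2) ^+ 3)|.
Proof.
move=> P0 PQ /andP[t10 t11] /andP[t20 t21].
have Pp : 1 <= P%:R :> R by rewrite ler1n.
have PQR : Q%:R ^+ 3 <= P%:R ^+ 2 :> R by rewrite -!natrX ler_nat.
have b (k : 'I_Q) : 0 <= (k%:R + t2) ^+ 3 <= P%:R ^+ 2.
  have k0 : 0 <= k%:R :> R by [].
  have kQ : k%:R + 1 <= Q%:R :> R by rewrite natr1 ler_nat.
  rewrite exprn_ge0 /=; last by lra.
  by apply: le_trans PQR; rewrite lerXn2r ?nnegrE //; lra.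
have main (i i' : 'I_P) (k k' : 'I_Q) : (i' < i)%N ->
  1 <= (i%:R + (P%:R + t1)) ^+ 3 + (k%:R + t2) ^+ 3
       - ((i'%:R + (P%:R + t1)) ^+ 3 + (k'%:R + t2) ^+ 3).
  move=> ii; have i0 : 0 <= i'%:R :> R by [].
  have := @cube_gap (i%:R + (P%:R + t1)) (i'%:R + (P%:R + t1)) _ (natr_gap _ ii).
  have -> : 0 <= i'%:R + (P%:R + t1) by lra.
  move=> /(_ isT) h.
  have : P%:R ^+ 2 <= (i'%:R + (P%:R + t1)) ^+ 2 by rewrite ler_sqr ?nnegrE; lra.
  have /andP[] := b k; have /andP[] := b k'; have := sqr_ge0 (P%:R : R).
  lra.
have main2 (i : 'I_P) (k k' : 'I_Q) : (k' < k)%N ->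
  1 <= (i%:R + (P%:R + t1)) ^+ 3 + (k%:R + t2) ^+ 3
       - ((i%:R + (P%:R + t1)) ^+ 3 + (k'%:R + t2) ^+ 3).
  move=> kk; have i0 : 0 <= k'%:R :> R by [].
  have := @cube_gap (k%:R + t2) (k'%:R + t2) _ (natr_gap _ kk).
  have -> : 0 <= k'%:R + t2 by lra.
  by move=> /(_ isT) h; have := sqr_ge0 (k'%:R + t2); lra.
move=> [i k] [i' k'] /= ne; case: (ltngtP i i') => ii.
- by rewrite distrC; apply: le_trans (ler_norm _); exact: main.
- by apply: le_trans (ler_norm _); exact: main.
- have ii' : i = i' by apply: val_inj.
  rewrite {}ii' in ne *; case: (ltngtP k k') => kk.
  + by rewrite distrC; apply: le_trans (ler_norm _); exact: main2.
  + by apply: le_trans (ler_norm _); exact: main2.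
  + by case/negP: ne; apply/eqP; congr (_, _); apply: val_inj.
Qed.

Lemma sum_expi_pair (X Y : finType) (f : X -> R) (g : Y -> R) :
  (\sum_x expi (f x)) * (\sum_y expi (g y)) = \sum_(z : X * Y) expi (f z.1 + g z.2).
Proof.
rewrite big_distrlr /= pair_big /=; apply: eq_bigr => z _; by rewrite expiD.
Qed.

End Diagonal.

(** * Detection by Fejer kernels on a grid *)

Section Detection.
Variable R : realType.
Local Notation normc := (@Normc.normc R).

Definition fejer (n : nat) (t : R) : R := normc (\sum_(i < n) expi (i%:R * t)) ^+ 2 / n%:R.

Lemma fejer_ge0 n t : 0 <= fejer n t.
Proof. by rewrite divr_ge0 // sqr_ge0. Qed.

Lemma fejer_le n t : (0 < n)%N -> 0 < dZ t -> fejer n t <= 9 / (n%:R * dZ t ^+ 2).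
Proof.
move=> n0 d0; have np : 0 < n%:R :> R by rewrite ltr0n.
have h : normc (\sum_(i < n) expi (i%:R * t)) <= 3 / dZ t.
  have := normc_expi_geom n t 0; under eq_bigr => i _ do rewrite addr0.
  move=> h; apply: le_trans h _; rewrite ler_pM2l //.
  by apply: mm_le_inv => //; rewrite d0 lexx.
rewrite /fejer ler_pdivrMr //.
have -> : 9 / (n%:R * dZ t ^+ 2) * n%:R = (3 / dZ t) ^+ 2 by field; rewrite !gt_eqF.
by rewrite ler_sqr ?nnegrE ?normc_ge0 // divr_ge0 // ltW.
Qed.

Lemma cos_ge (x : R) : 1 - x ^+ 2 / 2 <= cos x.
Proof.
have -> : cos x = 1 - 2 * sin (x / 2) ^+ 2.
  have {1}-> : x = (x / 2) *+ 2 by rewrite -mulr_natl; field.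
  by rewrite cos_mulr2n cos2sin2 -mulr_natl; ring.
have h := normr_sin_le (x / 2).
have : sin (x / 2) ^+ 2 <= (x / 2) ^+ 2.
  by rewrite -[leLHS]real_normK ?num_real // -[leRHS]real_normK ?num_real // ler_sqr ?nnegrE.
lra.
Qed.

(** All angles stay below 1/2 in absolute value, so the n terms add up without cancellation. *)
Lemma fejer_ge n t : (0 < n)%N -> `|t| * (16 * n%:R) <= 1 -> n%:R / 4 <= fejer n t.
Proof.
move=> n0 ht; have np : 0 < n%:R :> R by rewrite ltr0n.
have h (i : 'I_n) : 1 / 2 <= cos (2 * pi * (i%:R * t)).
  apply: le_trans (cos_ge _).
  have i0 : 0 <= i%:R :> R by [].
  have iN : i%:R <= n%:R :> R by rewrite ler_nat ltnW.
  have : `|2 * pi * (i%:R * t)| <= 1 / 2.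
    rewrite !normrM [`|2|]ger0_norm // [`|pi|]ger0_norm ?pi_ge0 // [`|i%:R|]ger0_norm //.
    have := @pihalf_lt2 R; have := @pi_ge0 R; have := normr_ge0 t => t0 p0 p4.
    apply: le_trans (_ : 2 * 4 * (n%:R * `|t|) <= _); last by lra.
    apply: ler_pM; rewrite ?mulr_ge0 //; first by lra.
    by rewrite ler_wpM2r.
  set y := 2 * pi * (i%:R * t); rewrite ler_norml => hy; nra.
have hs : n%:R / 2 <= normc (\sum_(i < n) expi (i%:R * t)).
  apply: le_trans (Re_le_normc _); apply: le_trans (ler_norm _).
  rewrite Re_sum; apply: le_trans (_ : \sum_(i < n) (1 / 2) <= _).
    by rewrite sumr_const card_ord -[_ *+ n]mulr_natl; lra.
  by apply: ler_sum => i _; exact: h.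
rewrite /fejer ler_pdivlMr //.
have -> : n%:R / 4 * n%:R = (n%:R / 2) ^+ 2 :> R by field.
by rewrite ler_sqr ?nnegrE ?normc_ge0 // divr_ge0 // ltW.
Qed.

Lemma expi_orthogonal (M : nat) (m : int) : (0 < M)%N ->
  \sum_(j < M) expi (j%:R * (m%:~R / M%:R)) = if (M%:Z %| m)%Z then (M%:R : R[i]) else 0.
Proof.
move=> M0; have Mp : 0 < M%:R :> R by rewrite ltr0n.
case: ifP => dv.
  have [k ->] := dvdzP dv.
  rewrite (eq_bigr (fun=> 1)); first by rewrite sumr_const card_ord.
  move=> j _; have -> : j%:R * ((k * M%:Z)%:~R / M%:R) = (j%:Z * k)%:~R :> R.
    by rewrite !intrM -!pmulrn; field; rewrite gt_eqF.
  exact: expi_int.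
have := expi_geom_mul M (m%:~R / M%:R) (0 : R).
under eq_bigr => i _ do rewrite addr0.
have -> : M%:R * (m%:~R / M%:R) + 0 = m%:~R :> R by field; rewrite gt_eqF.
rewrite expi_int expi0 subrr => /eqP; rewrite mulf_eq0 => /orP[/eqP //|/eqP e].
have := @dZ_le_normc_expi R (m%:~R / M%:R); rewrite e Normc.normc0 => d0.
have := @dZ_rat R m M 1 M0; rewrite mulr1 dv => /(_ isT); rewrite mulr1 => d1.
have M1 : 0 < M%:R^-1 :> R by rewrite invr_gt0.
by exfalso; lra.
Qed.

Lemma normc_sqr_conj (z : R[i]) : ((normc z ^+ 2)%:C = z * z^*)%C.
Proof.
rewrite normc_sqr; case: z => a b; apply/eqP; rewrite eq_complex /=.
by apply/andP; split; apply/eqP; ring.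
Qed.

Lemma conjc_expi t : ((expi t)^* = expi (- t) :> R[i])%C.
Proof. by rewrite /expi mulrN cosN sinN. Qed.

(** [K <= M] keeps distinct frequencies below [K] incongruent modulo [M], so orthogonality on the
    grid leaves only the diagonal. *)
Lemma parseval (M K : nat) (w : nat -> R[i]) : (0 < M)%N -> (K <= M)%N ->
  \sum_(j < M) normc (\sum_(h < K) w h * expi (- (h%:R * (j%:R / M%:R)))) ^+ 2 =
  M%:R * \sum_(h < K) normc (w h) ^+ 2.
Proof.
move=> M0 KM; apply: (@complexI R); rewrite !rmorph_sum rmorphM /= !rmorph_sum /= rmorph_nat.
under eq_bigr => j _ do rewrite normc_sqr_conj rmorph_sum /= big_distrlr /=.
rewrite exchange_big /= mulr_sumr; apply: eq_bigr => h _.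
rewrite exchange_big /= normc_sqr_conj.
have e (k : 'I_K) : \sum_(j < M) w h * expi (- (h%:R * (j%:R / M%:R))) *
    (w k * expi (- (k%:R * (j%:R / M%:R))))^*%C =
    w h * (w k)^*%C * (if (M%:Z %| k%:Z - h%:Z)%Z then M%:R else 0).
  rewrite -expi_orthogonal // mulr_sumr; apply: eq_bigr => j _.
  have -> : (w k * expi (- (k%:R * (j%:R / M%:R))))^*%C =
      (w k)^*%C * (expi (- (k%:R * (j%:R / M%:R))))^*%C by exact: rmorphM.
  rewrite conjc_expi mulrACA -expiD; congr (_ * expi _).
  by rewrite intrB -!pmulrn; ring.
under eq_bigr => k _ do rewrite e.
rewrite (bigD1 h) //= subrr dvdz0 big1 ?addr0; first by rewrite mulrC.
move=> k kh; rewrite (_ : (M%:Z %| k%:Z - h%:Z)%Z = false) ?mulr0 //.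
apply/negP; rewrite dvdzE /= => dv.
have hk : (0 < `|k%:Z - h%:Z|)%N.
  by rewrite absz_gt0 subr_eq0; apply: contra kh => /eqP [] e'; apply/eqP; apply: val_inj.
have := dvdn_leq hk dv; have := ltn_ord k; have := ltn_ord h; lia.
Qed.

(* [K] is the order of the narrow kernel, [k0] that of the wide one. *)
Definition fejer_diff (K k0 h : nat) : R :=
  (1 - h%:R / K%:R) - (if (h < k0)%N then 1 - h%:R / k0%:R else 0).

(** The bound h / k0 is the one that makes the frequencies next to 0 harmless once [k0] is large. *)
Lemma fejer_diff_bounds (K k0 h : nat) : (0 < k0 <= K)%N -> (h < K)%N ->
  0 <= fejer_diff K k0 h <= 1 /\ fejer_diff K k0 h <= h%:R / k0%:R.
Proof.
move=> /andP[k00 kK] hK; rewrite /fejer_diff.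
have kp : 0 < k0%:R :> R by rewrite ltr0n.
have Kp : 0 < K%:R :> R by rewrite ltr0n (leq_trans k00).
have h0 : 0 <= h%:R :> R by [].
have h1 : h%:R / K%:R <= 1 :> R by rewrite ler_pdivrMr // mul1r ler_nat ltnW.
have h2 : h%:R / K%:R <= h%:R / k0%:R :> R by rewrite ler_wpM2l // lef_pV2 ?posrE // ler_nat.
have h3 : 0 <= h%:R / K%:R :> R by rewrite divr_ge0 // ltW.
case: ifP => hk.
  have h4 : h%:R / k0%:R <= 1 :> R by rewrite ler_pdivrMr // mul1r ler_nat ltnW.
  by split; [apply/andP; split|]; lra.
have h4 : 1 <= h%:R / k0%:R :> R by rewrite ler_pdivlMr // mul1r ler_nat leqNgt hk.
by split; [apply/andP; split|]; lra.
Qed.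

Lemma fejerB (K k0 : nat) t : (0 < k0 <= K)%N ->
  fejer K t - fejer k0 t =
  2 * \sum_(1 <= h < K) fejer_diff K k0 h * cos (2 * pi * (h%:R * t)).
Proof.
move=> /andP[k00 kK]; have K0 := leq_trans k00 kK.
rewrite /fejer !fejer_expansion //.
have -> : \sum_(1 <= h < k0) (1 - h%:R / k0%:R) * cos (2 * pi * (h%:R * t)) =
  \sum_(1 <= h < K) (if (h < k0)%N then 1 - h%:R / k0%:R else 0) * cos (2 * pi * (h%:R * t)).
  have z : \sum_(k0 <= h < K) (if (h < k0)%N then 1 - h%:R / k0%:R else 0) * cos (2 * pi * (h%:R * t)) = 0.
    by rewrite big_nat big1 // => h /andP[h1 _]; rewrite ltnNge h1 mul0r.
  rewrite [RHS](@big_cat_nat _ _ _ k0) //= z addr0.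
  by apply: eq_big_nat => h /andP[_ ->].
have -> : \sum_(1 <= h < K) fejer_diff K k0 h * cos (2 * pi * (h%:R * t)) =
  \sum_(1 <= h < K) (1 - h%:R / K%:R) * cos (2 * pi * (h%:R * t)) -
  \sum_(1 <= h < K) (if (h < k0)%N then 1 - h%:R / k0%:R else 0) * cos (2 * pi * (h%:R * t)).
  by rewrite -sumrB; apply: eq_bigr => h _; rewrite /fejer_diff; ring.
by ring.
Qed.

(** The constant terms of the two kernels cancel, so at grid point j the difference is twice the
    real part of a trigonometric polynomial in j / M with frequencies from 1 to K - 1. Setting [w]
    to 0 at frequency 0 fits it to [parseval]. *)
Lemma sum_fejerB_sqr (X : finType) (F : X -> R) (D K k0 M : nat) :
  (0 < k0 <= K)%N -> (K <= M)%N -> (0 < D)%N ->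
  \sum_(j < M) (\sum_x fejer K ((F x - j%:R * (D%:R / M%:R)) / D%:R)
              - \sum_x fejer k0 ((F x - j%:R * (D%:R / M%:R)) / D%:R)) ^+ 2 <=
  4 * M%:R * \sum_(1 <= h < K) fejer_diff K k0 h ^+ 2 *
        normc (\sum_x expi (h%:R / D%:R * F x)) ^+ 2.
Proof.
move=> kK KM D0; have K0 : (0 < K)%N by case/andP: kK => h; exact: leq_trans.
have M0 : (0 < M)%N by exact: leq_trans KM.
have Dp : 0 < D%:R :> R by rewrite ltr0n.
have Mp : 0 < M%:R :> R by rewrite ltr0n.
pose w (h : nat) : R[i] := if h == 0%N then 0 else
  ((fejer_diff K k0 h)%:C)%C * \sum_x expi (h%:R / D%:R * F x).
have := parseval w M0 KM => pars.
have -> : \sum_(1 <= h < K) fejer_diff K k0 h ^+ 2 * normc (\sum_x expi (h%:R / D%:R * F x)) ^+ 2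
   = \sum_(h < K) normc (w h) ^+ 2.
  rewrite -(big_mkord xpredT (fun h => normc (w h) ^+ 2)) [RHS]big_ltn //.
  rewrite {1}/w eqxx Normc.normc0 expr0n add0r; apply: eq_big_nat => h /andP[h1 _].
  rewrite /w eqn0Ngt h1 /= Normc.normcM exprMn; congr (_ * _).
  by rewrite normc_sqr /= expr0n addr0.
rewrite -mulrA -pars mulr_sumr; apply: ler_sum => j _.
have -> : \sum_x fejer K ((F x - j%:R * (D%:R / M%:R)) / D%:R)
    - \sum_x fejer k0 ((F x - j%:R * (D%:R / M%:R)) / D%:R) =
  2 * complex.Re (\sum_(h < K) w h * expi (- (h%:R * (j%:R / M%:R)))).
  rewrite -sumrB.
  under eq_bigr => x _ do rewrite fejerB //.
  rewrite -mulr_sumr; congr (_ * _); rewrite exchange_big /= Re_sum.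
  rewrite -(big_mkord xpredT (fun h => complex.Re (w h * expi (- (h%:R * (j%:R / M%:R)))))).
  rewrite [RHS]big_ltn // {1}/w eqxx mul0r add0r; apply: eq_big_nat => h /andP[h1 _].
  rewrite /w eqn0Ngt h1 /= -mulrA mulr_suml.
  under [in RHS]eq_bigr => x _ do rewrite -expiD.
  set d := fejer_diff K k0 h.
  have -> : complex.Re (d%:C%C * \sum_x expi (h%:R / D%:R * F x + - (h%:R * (j%:R / M%:R)))) =
     d * complex.Re (\sum_x expi (h%:R / D%:R * F x + - (h%:R * (j%:R / M%:R)))).
    by case: (\sum_x _) => a b /=; ring.
  rewrite Re_sum mulr_sumr; apply: eq_bigr => x _ /=; congr (_ * cos (_ * _)).
  by field; rewrite !gt_eqF.
rewrite exprMn (_ : 2 ^+ 2 = 4) ?ler_pM2l //; last by ring.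
set z := \sum_(h < K) _.
rewrite -[leLHS]real_normK ?num_real // ler_sqr ?nnegrE ?normc_ge0 //.
exact: Re_le_normc.
Qed.

Lemma inv_sqr_tail (L N : nat) : (0 < L)%N ->
  \sum_(l < N | (L <= l)%N) (l%:R ^+ 2)^-1 <= 2 / L%:R :> R.
Proof.
move=> L0; have Lp : 0 < L%:R :> R by rewrite ltr0n.
suff h : forall n, \sum_(L <= l < n.+1) (l%:R ^+ 2)^-1 <= 2 / L%:R - (if (L <= n)%N then n%:R^-1 else 0) :> R.
  rewrite big_mkcond -(big_mkord xpredT (fun l => if (L <= l)%N then (l%:R ^+ 2)^-1 else 0)) /=.
  have [NL|LN] := leqP N L.
    rewrite big_nat big1 ?divr_ge0 ?(ltW Lp) // => l /andP[_ lN].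
    by rewrite leqNgt (leq_trans lN NL).
  rewrite (@big_cat_nat _ _ _ L) ?(ltnW LN) //= big_nat big1 ?add0r; last first.
    by move=> l /andP[_ lN]; rewrite leqNgt lN.
  rewrite (eq_big_nat _ _ (F2 := fun l => (l%:R ^+ 2)^-1)); last by move=> l /andP[->].
  case: N LN => // N LN; apply: le_trans (h N) _; rewrite lerBlDr lerDl.
  by case: ifP => // _; rewrite invr_ge0.
elim=> [|n IH].
  by rewrite big_geq // leqNgt L0 /= subr0 divr_ge0 // ltW.
have [Ln|Ln] := leqP L n.+1; last first.
  by rewrite big_geq // subr0 divr_ge0 // ltW.
rewrite big_nat_recr //=; move: IH.
have n1 : 0 < n.+1%:R :> R by rewrite ltr0n.
have [Ln'|Ln'] := leqP L n => IH.
  have n0 : 0 < n%:R :> R by rewrite ltr0n (leq_trans L0).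
  have h : (n.+1%:R ^+ 2)^-1 <= n%:R^-1 - n.+1%:R^-1 :> R.
    have -> : n%:R^-1 - n.+1%:R^-1 = (n%:R * n.+1%:R)^-1 :> R.
      by rewrite -[n.+1%:R]natr1 in n1 *; field; rewrite !gt_eqF.
    rewrite lef_pV2 ?posrE ?exprn_gt0 ?mulr_gt0 // expr2 ler_pM2r // ler_nat //.
  by apply: le_trans (lerD IH h) _; rewrite subrKA.
have e : L = n.+1 by apply/eqP; rewrite eqn_leq Ln.
rewrite big_geq ?e // add0r.
have -> : 2 / n.+1%:R - n.+1%:R^-1 = n.+1%:R^-1 :> R by ring.
by rewrite lef_pV2 ?posrE ?exprn_gt0 // expr2 ler_peMr ?(ltW n1) // ler1n.
Qed.

(** Seen from the single value f, the grid points of [J] are labelled by their side and by the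
    integer part of their distance in grid steps. Labels are distinct and at least L, since L steps
    fit in eta. The kernel is at most 9 D^2 / (K u^2) at distance u, so each side is a tail of
    inverse squares. *)
Lemma fejer_tail (f eta : R) (D K M : nat) (J : {set 'I_M}) :
  (0 < K)%N -> (0 < D)%N -> (0 < M)%N ->
  (forall j, j \in J -> eta <= `|f - j%:R * (D%:R / M%:R)| <= D%:R / 2) ->
  forall L : nat, (0 < L)%N -> L%:R * (D%:R / M%:R) <= eta ->
  \sum_(j in J) fejer K ((f - j%:R * (D%:R / M%:R)) / D%:R) <= 36 * M%:R ^+ 2 / (K%:R * L%:R).
Proof.
move=> K0 D0 M0 hJ L L0 hL.
have Dp : 0 < D%:R :> R by rewrite ltr0n.
have Mp : 0 < M%:R :> R by rewrite ltr0n.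
have Kp : 0 < K%:R :> R by rewrite ltr0n.
have Lp : 0 < L%:R :> R by rewrite ltr0n.
pose de : R := D%:R / M%:R; have de0 : 0 < de by rewrite divr_gt0.
pose u (j : 'I_M) := f - j%:R * de.
pose ell j := Num.truncn (`|u j| / de).
have ellb j : (ell j)%:R * de <= `|u j|.
  rewrite -ler_pdivlMr //; apply: (le_trans _ (lexx _)); rewrite truncn_le //.
  by rewrite divr_ge0 // ltW.
have ellM j : j \in J -> (ell j < M.+1)%N.
  move=> jJ; rewrite ltnS -(ler_nat R).
  have /andP[_ h] := hJ j jJ; rewrite -(ler_pM2r de0); apply: le_trans (ellb j) _.
  have -> : M%:R * de = D%:R by rewrite /de mulrC divfK // gt_eqF.
  by apply: le_trans h _; lra.
have ellL j : j \in J -> (L <= ell j)%N.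
  move=> jJ; rewrite truncn_ge_nat; last by rewrite divr_ge0 // ltW.
  by rewrite ler_pdivlMr //; have /andP[h _] := hJ j jJ; exact: le_trans h.
pose phi (j : 'I_M) : bool * 'I_M.+1 := (u j < 0, inord (ell j)).
have phi_inj : {in J &, injective phi}.
  move=> i j iJ jJ [] e1 e2'.
  have e2 : ell i = ell j.
    by have := congr1 val e2'; rewrite /= !inordK ?ellM.
  have := truncn_itv (divr_ge0 (normr_ge0 (u i)) (ltW de0)).
  have := truncn_itv (divr_ge0 (normr_ge0 (u j)) (ltW de0)).
  rewrite -/(ell i) -/(ell j) e2 -[(ell j).+1%:R]natr1; set r := (ell j)%:R.
  rewrite !ler_pdivlMr // !ltr_pdivrMr // => hj hi.
  have d1 : `|u i - u j| < de.
    have [ui|ui] := boolP (u i < 0); rewrite ?ui ?(negbTE ui) in e1; symmetry in e1.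
      move: hi hj; rewrite (ltr0_norm ui) (ltr0_norm e1) => hi hj.
      by have [w|w] := ler0P (u i - u j); lra.
    move/negbT: e1; move: ui; rewrite -!leNgt => ui uj.
    move: hi hj; rewrite (ger0_norm ui) (ger0_norm uj) => hi hj.
    by have [w|w] := ler0P (u i - u j); lra.
  apply: val_inj => /=; apply/eqP; apply/negPn/negP => ij.
  have uE : u i - u j = (j%:R - i%:R) * de by rewrite /u; ring.
  move: d1; rewrite uE normrM (ger0_norm (ltW de0)) -[X in _ < X]mul1r ltr_pM2r // ltNge.
  move/negP; apply; have -> : j%:R - i%:R = (j%:Z - i%:Z)%:~R :> R by rewrite intrB.
  rewrite -intr_norm (ler_int _ 1) -gtz0_ge1 normr_gt0 subr_eq0 eq_sym.
  by apply: contra ij => /eqP [->].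
pose g (y : bool * 'I_M.+1) : R := 9 * M%:R ^+ 2 / K%:R * (if (L <= y.2)%N then (y.2%:R ^+ 2)^-1 else 0).
have g0 y : 0 <= g y.
  rewrite /g mulr_ge0 ?divr_ge0 ?mulr_ge0 ?sqr_ge0 ?(ltW Kp) //.
  by case: ifP => // _; rewrite invr_ge0 sqr_ge0.
apply: le_trans (_ : \sum_(j in J) g (phi j) <= _).
  apply: ler_sum => j jJ; rewrite /g /= inordK ?ellM // ellL //.
  have /andP[h1 h2] := hJ j jJ.
  have l0 : 0 < (ell j)%:R :> R by rewrite ltr0n (leq_trans L0) // ellL.
  have uj0 : 0 < `|u j| by apply: lt_le_trans (ellb j); rewrite mulr_gt0.
  have nE : `|(f - j%:R * (D%:R / M%:R)) / D%:R| = `|u j| / D%:R by rewrite normrM normfV (ger0_norm (ltW Dp)).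
  have dE : dZ ((f - j%:R * (D%:R / M%:R)) / D%:R) = `|u j| / D%:R.
    by rewrite dZ_small nE // ler_pdivrMr //; rewrite /u /de; lra.
  apply: le_trans (fejer_le K0 _) _; first by rewrite dE divr_gt0.
  rewrite dE.
  have -> : 9 / (K%:R * (`|u j| / D%:R) ^+ 2) = 9 * D%:R ^+ 2 / K%:R * (`|u j| ^+ 2)^-1.
    by field; rewrite !gt_eqF.
  have -> : 9 * M%:R ^+ 2 / K%:R * ((ell j)%:R ^+ 2)^-1 =
     9 * D%:R ^+ 2 / K%:R * (((ell j)%:R * de) ^+ 2)^-1.
    by rewrite /de; field; rewrite !gt_eqF.
  rewrite ler_wpM2l ?divr_ge0 ?mulr_ge0 ?sqr_ge0 ?(ltW Kp) //.
  have p1 : 0 < (ell j)%:R * de by rewrite mulr_gt0.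
  rewrite lef_pV2 ?posrE ?(exprn_gt0 _ uj0) ?(exprn_gt0 _ p1) //.
  by rewrite ler_sqr ?nnegrE ?(ltW uj0) ?(ltW p1).
rewrite -(big_imset g phi_inj) /=.
apply: le_trans (_ : \sum_(y : bool * 'I_M.+1) g y <= _).
  by rewrite [leRHS](bigID (mem [set phi x | x in J])) /= lerDl sumr_ge0.
rewrite -(pair_big xpredT xpredT (fun b i => g (b, i))) /= big_bool /=.
have h : \sum_(i < M.+1) g (true, i) <= 9 * M%:R ^+ 2 / K%:R * (2 / L%:R).
  rewrite /g /= -mulr_sumr ler_wpM2l ?divr_ge0 ?mulr_ge0 ?sqr_ge0 ?(ltW Kp) //.
  by rewrite -big_mkcond /=; exact: inv_sqr_tail.
have -> : \sum_(i < M.+1) g (false, i) = \sum_(i < M.+1) g (true, i) by [].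
have -> : 36 * M%:R ^+ 2 / (K%:R * L%:R) = 2 * (9 * M%:R ^+ 2 / K%:R * (2 / L%:R)) :> R.
  by field; rewrite !gt_eqF.
lra.
Qed.

(** On [Z] each wide sum is at least c |X| and the narrow sums are tails by [fejer_tail].
    Cauchy-Schwarz bounds the total difference over [Z] by the mean square over the grid, that is by
    the energy, and this forces [Z] to be small. *)
Lemma detection (X : finType) (F : X -> R) (D K k0 M L : nat) (Z : {set 'I_M}) (c eta e : R) :
  (0 < k0 <= K)%N -> (K <= M)%N -> (0 < D)%N -> (0 < L)%N -> (0 < #|X|)%N -> 0 <= e ->
  L%:R * (D%:R / M%:R) <= eta ->
  (forall j x, j \in Z -> eta <= `|F x - j%:R * (D%:R / M%:R)| <= D%:R / 2) ->
  (forall j, j \in Z -> c * #|X|%:R <= \sum_x fejer k0 ((F x - j%:R * (D%:R / M%:R)) / D%:R)) ->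
  \sum_(1 <= h < K) fejer_diff K k0 h ^+ 2 *
        normc (\sum_x expi (h%:R / D%:R * F x)) ^+ 2 <= (e * #|X|%:R) ^+ 2 ->
  c * #|Z|%:R <= 36 * M%:R ^+ 2 / (K%:R * L%:R) + 2 * e * M%:R.
Proof.
move=> kK KM D0 L0 X0 e0 hL hZ hR hE.
have K0 : (0 < K)%N by case/andP: kK => h; exact: leq_trans.
have M0 : (0 < M)%N by exact: leq_trans KM.
have Xp : 0 < #|X|%:R :> R by rewrite ltr0n.
pose RK (j : 'I_M) := \sum_x fejer K ((F x - j%:R * (D%:R / M%:R)) / D%:R).
pose R0 (j : 'I_M) := \sum_x fejer k0 ((F x - j%:R * (D%:R / M%:R)) / D%:R).
have s1 : c * #|X|%:R * #|Z|%:R <= \sum_(j in Z) R0 j.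
  rewrite mulr_natr -sumr_const; apply: ler_sum => j jZ; exact: hR.
have s2 : \sum_(j in Z) RK j <= #|X|%:R * (36 * M%:R ^+ 2 / (K%:R * L%:R)).
  have -> : #|X|%:R * (36 * M%:R ^+ 2 / (K%:R * L%:R)) =
      \sum_(x : X) 36 * M%:R ^+ 2 / (K%:R * L%:R) :> R by rewrite sumr_const mulr_natl.
  rewrite /RK exchange_big /=; apply: ler_sum => x _.
  by apply: (@fejer_tail (F x) eta) => // j jZ; exact: hZ.
have s3 : (\sum_(j in Z) (RK j - R0 j)) ^+ 2 <= (2 * e * #|X|%:R * M%:R) ^+ 2.
  have := @CauchySchwarz_sum R _ (index_enum 'I_M) (mem Z) (fun j => RK j - R0 j) (fun=> 1).
  rewrite (eq_bigr (fun j => RK j - R0 j)) => [h|j _]; last by rewrite mulr1.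
  apply: le_trans h _.
  have h1 : \sum_(j in Z) (RK j - R0 j) ^+ 2 <= 4 * M%:R * (e * #|X|%:R) ^+ 2.
    apply: le_trans (_ : \sum_j (RK j - R0 j) ^+ 2 <= _).
      by rewrite [leRHS](bigID (mem Z)) /= lerDl sumr_ge0 // => j _; exact: sqr_ge0.
    apply: le_trans (sum_fejerB_sqr F kK KM D0) _.
    by rewrite ler_wpM2l // mulr_ge0.
  have h2 : \sum_(j in Z) 1 ^+ 2 <= M%:R :> R.
    rewrite expr1n sumr_const ler_nat; have := max_card (mem Z); by rewrite card_ord.
  apply: le_trans (ler_pM _ _ h1 h2) _.
  - by apply: sumr_ge0 => j _; exact: sqr_ge0.
  - by apply: sumr_ge0 => j _; exact: sqr_ge0.
  by rewrite le_eqVlt; apply/orP; left; apply/eqP; ring.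
have s4 : - (2 * e * #|X|%:R * M%:R) <= \sum_(j in Z) (RK j - R0 j).
  have b0 : 0 <= 2 * e * #|X|%:R * M%:R by rewrite !mulr_ge0.
  move: s3; rewrite -[leLHS]real_normK ?num_real // ler_sqr ?nnegrE // => h.
  by have /andP[] : - (2 * e * #|X|%:R * M%:R) <= \sum_(j in Z) (RK j - R0 j)
    <= 2 * e * #|X|%:R * M%:R by rewrite -ler_norml.
rewrite sumrB in s4.
rewrite -(ler_pM2l Xp).
have -> : #|X|%:R * (36 * M%:R ^+ 2 / (K%:R * L%:R) + 2 * e * M%:R) =
  #|X|%:R * (36 * M%:R ^+ 2 / (K%:R * L%:R)) + 2 * e * #|X|%:R * M%:R by ring.
have -> : #|X|%:R * (c * #|Z|%:R) = c * #|X|%:R * #|Z|%:R by ring.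
lra.
Qed.

End Detection.

(** * Convergent weights and regrouping of frequencies by arcs *)

Section Series.
Variable R : realType.

(* The exponents 1 + 1/2^k, small enough for the losses in Weyl's inequality
   and large enough for convergence. *)
Definition phi (k n : nat) : R := (n%:R * rt k n%:R)^-1.

Lemma phi_ge0 k n : 0 <= phi k n.
Proof. by rewrite invr_ge0 mulr_ge0 // rt_ge0. Qed.

Lemma exprB_le (r t : R) (m : nat) : 0 <= t <= r -> r ^+ m - t ^+ m <= (r - t) * (m%:R * r ^+ m.-1).
Proof.
move=> /andP[t0 tr]; have r0 := le_trans t0 tr.
rewrite subrXX ler_wpM2l ?subr_ge0 // mulr_natl.
have -> : r ^+ m.-1 *+ m = \sum_(i < m) r ^+ m.-1 by rewrite sumr_const card_ord.
apply: ler_sum => i _.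
have -> : r ^+ m.-1 = r ^+ (m.-1 - i) * r ^+ i.
  by rewrite -exprD subnK //; have := ltn_ord i; lia.
by rewrite ler_wpM2l ?exprn_ge0 // lerXn2r ?nnegrE.
Qed.

(** Discrete primitive of n^(-1 - 1/m) with m = 2^k: the unit gap n - (n - 1) is written as r^m -
    t^m with r, t the roots of order m and bounded by (r - t) m r^(m - 1). *)
Lemma phi_telescope k n : (1 < n)%N ->
  phi k n <= (2 ^ k)%:R * ((rt k n.-1%:R)^-1 - (rt k n%:R)^-1).
Proof.
case: n => [|[|n]] // _; rewrite succnK.
have n1 : 0 < n.+1%:R :> R by rewrite ltr0n.
have n2 : 0 < n.+2%:R :> R by rewrite ltr0n.
have r0 := rt_gt0 k n2; have t0 := rt_gt0 k n1.
have tr : rt k n.+1%:R <= rt k n.+2%:R :> R by apply: rt_mono; rewrite (ltW n1) ler_nat leqnSn.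
have cnd : 0 <= (rt k n.+1%:R : R) <= rt k n.+2%:R.
  by apply/andP; split; [exact: ltW | exact: tr].
have := exprB_le (2 ^ k) cnd.
rewrite !rt_exp ?(ltW n1) ?(ltW n2) //.
have -> : n.+2%:R - n.+1%:R = 1 :> R by rewrite -[n.+2%:R]natr1; ring.
have nE : rt k n.+2%:R ^+ (2 ^ k).-1 * rt k n.+2%:R = n.+2%:R :> R.
  by rewrite -exprSr prednK ?expn_gt0 // rt_exp // ltW.
rewrite /phi; move: r0 t0 tr nE; set r := rt k n.+2%:R; set t := rt k n.+1%:R.
set X := r ^+ _; set m := (2 ^ k)%:R => r0 t0 tr nE h.
have -> : r^-1 = t * (r * t)^-1 by field; rewrite !gt_eqF.
have -> : t^-1 = r * (r * t)^-1 by field; rewrite !gt_eqF.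
rewrite -mulrBl mulrA -[leLHS]mul1r.
rewrite ler_pdivrMr ?mulr_gt0 // mulrAC ler_pdivlMr ?mulr_gt0 // mul1r.
have h2 : r * t <= r * r by rewrite ler_pM2l.
apply: le_trans h2 _; rewrite -nE.
have -> : m * (r - t) * (X * r * r) = ((r - t) * (m * X)) * (r * r) by ring.
by rewrite ler_peMl // mulr_ge0 // ltW.
Qed.

Lemma phi_tail k L N : (0 < L)%N ->
  \sum_(L.+1 <= n < N) phi k n <= (2 ^ k)%:R / rt k L%:R.
Proof.
move=> L0; have Lp : 0 < L%:R :> R by rewrite ltr0n.
have r0 := rt_gt0 k Lp.
have [NL|LN] := leqP N L.+1.
  by rewrite big_geq // divr_ge0 // ltW.
apply: le_trans (_ : (2 ^ k)%:R * ((rt k L%:R)^-1 - (rt k N.-1%:R)^-1) <= _); last first.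
  by rewrite ler_wpM2l // gerBl invr_ge0 rt_ge0.
case: N LN => // N; rewrite succnK ltnS => LN.
elim: N LN => [|N IH]; first by [].
move=> LN; rewrite big_nat_recr //=.
have h := @phi_telescope k N.+1 ltac:(lia).
have h2 : \sum_(L.+1 <= n < N.+1) phi k n <= (2 ^ k)%:R * ((rt k L%:R)^-1 - (rt k N%:R)^-1).
  by have [e|e] := eqVneq L N; [rewrite e big_geq // subrr mulr0 | apply: IH; lia].
apply: le_trans (lerD h2 h) _; rewrite succnK.
by rewrite -mulrDr subrKA.
Qed.

Lemma phi_sum k N : \sum_(1 <= n < N) phi k n <= 1 + (2 ^ k)%:R.
Proof.
have [N1|N1] := leqP N 1; first by rewrite big_geq // addr_ge0.
have r1 : rt k 1 = 1 :> R by elim: k => // k IH; rewrite /rt iterS -/(rt k 1) IH sqrtr1.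
rewrite big_ltn // {1}/phi r1 mulr1 invr1 lerD2l.
by apply: le_trans (@phi_tail k 1 N isT) _; rewrite r1 divr1.
Qed.

Lemma phi_tail_small k (e : R) : 0 < e -> exists2 L : nat, (0 < L)%N &
  forall N, \sum_(L.+1 <= n < N) phi k n <= e.
Proof.
move=> e0; pose m := (Num.truncn ((2 ^ k)%:R / e)).+1.
exists (m ^ 2 ^ k)%N => [|N]; first by rewrite expn_gt0.
apply: le_trans (phi_tail _ _ _) _; first by rewrite expn_gt0.
have mp : 0 < m%:R :> R by rewrite ltr0n.
have -> : rt k (m ^ 2 ^ k)%:R = m%:R :> R.
  apply: (@pexpIrn _ (2 ^ k)); rewrite ?expn_gt0 ?nnegrE ?rt_ge0 //.
  by rewrite rt_exp // natrX.
rewrite ler_pdivrMr // mulrC -ler_pdivrMr //.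
have h0 : 0 <= (2 ^ k)%:R / e by rewrite divr_ge0 // ltW.
by have /andP[_ h1] := truncn_itv h0; exact: ltW.
Qed.

(** The labels are denominator, absolute numerator, sign of the offset and its integer part. For
    given q and l there are two signs and at most A q + 1 <= (A + 1) q numerators: hence the weight
    q in the hypothesis on g. *)
Lemma sum_injective_le (I : finType) (S : {set I}) (f : I -> nat * nat * bool * nat)
    (g : nat -> nat -> R) (A : nat) (C : R) :
  {in S &, injective f} ->
  (forall i, i \in S -> (0 < (f i).1.1.1)%N /\ ((f i).1.1.2 <= A * (f i).1.1.1)%N) ->
  (forall q l, 0 <= g q l) ->
  (forall N, \sum_(1 <= q < N) \sum_(l < N) q%:R * g q l <= C) ->
  \sum_(i in S) g (f i).1.1.1 (f i).2 <= 2 * (A.+1)%:R * C.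
Proof.
move=> finj fa g0 gC.
pose N := (\max_i maxn (maxn (f i).1.1.1 (f i).1.1.2) (f i).2).+1.
have bd i : [/\ ((f i).1.1.1 < N)%N, ((f i).1.1.2 < N)%N & ((f i).2 < N)%N].
  have := @leq_bigmax _ (fun i => maxn (maxn (f i).1.1.1 (f i).1.1.2) (f i).2) i.
  by rewrite !geq_max !ltnS => /andP[/andP[-> ->] ->].
pose fi i : 'I_N * 'I_N * bool * 'I_N :=
  (inord (f i).1.1.1, inord (f i).1.1.2, (f i).1.2, inord (f i).2).
have val_inord m : (m < N)%N -> val (inord m : 'I_N) = m by move=> h; rewrite /= inordK.
have fi_inj : {in S &, injective fi}.
  move=> i j iS jS; have [a1 a2 a3] := bd i; have [b1 b2 b3] := bd j.
  move=> [/(congr1 val) e1 /(congr1 val) e2 e3 /(congr1 val) e4]; apply: finj => //.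
  move: e1 e2 e3 e4; rewrite !val_inord //.
  by case: (f i) => [[[? ?] ?] ?]; case: (f j) => [[[? ?] ?] ?] /= -> -> -> ->.
pose G (y : 'I_N * 'I_N * bool * 'I_N) : R :=
  if (0 < y.1.1.1)%N && (y.1.1.2 <= A * y.1.1.1)%N then g y.1.1.1 y.2 else 0.
have G0 y : 0 <= G y by rewrite /G; case: ifP.
have -> : \sum_(i in S) g (f i).1.1.1 (f i).2 = \sum_(i in S) G (fi i).
  apply: eq_bigr => i iS; have [a1 a2 a3] := bd i; have [c1 c2] := fa i iS.
  by rewrite /G /fi /= !inordK // c1 c2.
rewrite -(big_imset G fi_inj) /=.
apply: le_trans (_ : \sum_y G y <= _).
  by rewrite [leRHS](bigID (mem [set fi x | x in S])) /= lerDl sumr_ge0.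
rewrite -(pair_big xpredT xpredT (fun z l => G (z, l))) /=.
rewrite -(pair_big xpredT xpredT (fun z b => \sum_l G (z, b, l))) /=.
rewrite -(pair_big xpredT xpredT (fun q a => \sum_b \sum_l G (q, a, b, l))) /=.
apply: le_trans (_ : \sum_(q < N) 2 * A.+1%:R * (\sum_(l < N) (if (0 < q)%N then q%:R * g q l else 0)) <= _); last first.
  rewrite -mulr_sumr ler_wpM2l ?mulr_ge0 //.
  apply: le_trans (gC N); rewrite -(big_mkord xpredT (fun q => \sum_(l < N) (if (0 < q)%N then q%:R * g q l else 0))).
  rewrite big_ltn // big1 // add0r; apply: ler_sum_nat => q /andP[q0 _].
  by apply: ler_sum => l _; rewrite q0.
apply: ler_sum => q _.
have [q0|q0] := posnP (q : nat).
  rewrite big1 ?mulr_ge0 //; last first.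
    by move=> a _; rewrite big1 // => b _; rewrite big1 // => l _; rewrite /G /= q0.
  by rewrite sumr_ge0 // => l _; rewrite q0.
pose s := \sum_(l < N) g q l; have s0 : 0 <= s by rewrite sumr_ge0.
apply: le_trans (_ : \sum_(a < N) (a < (A * q).+1)%N%:R * (2 * s) <= _).
  apply: ler_sum => a _; rewrite big_bool /= /G /= q0 /= ltnS.
  case: (a <= A * q)%N; last by rewrite !big1 // addr0 mul0r.
  by rewrite mul1r -/s; lra.
rewrite -mulr_suml.
have h : \sum_(a < N) (a < (A * q).+1)%N%:R <= (A * q).+1%:R :> R.
  rewrite -natr_sum ler_nat -(big_mkord xpredT (fun a => (a < (A * q).+1)%N : nat)).
  rewrite sum_bool_count -size_filter.
  apply: leq_trans (_ : size (iota 0 (A * q).+1) <= _)%N; last by rewrite size_iota.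
  apply: uniq_leq_size; first by rewrite filter_uniq // iota_uniq.
  by move=> x; rewrite mem_filter mem_iota add0n => /andP[].
apply: le_trans (ler_wpM2r _ h) _; first by rewrite mulr_ge0.
rewrite -mulr_sumr -/s (_ : 2 * A.+1%:R * (q%:R * s) = (A.+1 * q)%:R * (2 * s)); last by rewrite natrM; ring.
by rewrite ler_wpM2r ?mulr_ge0 // ler_nat mulSn; lia.
Qed.

End Series.

(** * The energy of the major and minor arcs *)

Section Energy.
Variable R : realType.
Local Notation normc := (@Normc.normc R).
Local Notation fr := (@rt R 2).
Variables t1 t2 t3 t4 t5 C0 : R.

Definition Tl (P : nat) (t alpha : R) : R[i] :=
  \sum_(i < P) expi (alpha * (i%:R + (P%:R + t)) ^+ 3).
Definition Ts (Q : nat) (t alpha : R) : R[i] :=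
  \sum_(i < Q) expi (alpha * (i%:R + t) ^+ 3).

Definition box (P Q : nat) : finType := (('I_P * 'I_Q) * ('I_P * 'I_P * 'I_P))%type.

(** The first pair holds the two variables of the diagonal mean value, the triple those estimated
    pointwise. [C0] is for the cubes of the variables beyond the fifth, which stay frozen and only
    rotate the exponential sum. *)
Definition cube5 (P Q : nat) (x : box P Q) : R :=
  ((x.1.1%:R + (P%:R + t1)) ^+ 3 + (x.1.2%:R + t2) ^+ 3)
  + ((x.2.1.1%:R + (P%:R + t3)) ^+ 3 + (x.2.1.2%:R + (P%:R + t4)) ^+ 3
     + (x.2.2%:R + (P%:R + t5)) ^+ 3) + C0.

Lemma card_boxR P Q : #|box P Q|%:R = P%:R * Q%:R * (P%:R * P%:R * P%:R) :> R.
Proof. by rewrite !card_prod !card_ord !natrM. Qed.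

Lemma rtS_sqr k (x : R) : 0 <= x -> rt k.+1 x ^+ 2 = rt k x.
Proof. by move=> x0; rewrite {1}/rt iterS sqr_sqrtr // -/(rt k x) rt_ge0. Qed.

Lemma normc_box_sum P Q alpha : normc (\sum_(x : box P Q) expi (alpha * cube5 x)) =
  normc (Tl P t1 alpha) * normc (Ts Q t2 alpha) *
  (normc (Tl P t3 alpha) * normc (Tl P t4 alpha) * normc (Tl P t5 alpha)).
Proof.
have -> : \sum_(x : box P Q) expi (alpha * cube5 x) =
  Tl P t1 alpha * Ts Q t2 alpha * (Tl P t3 alpha * Tl P t4 alpha * Tl P t5 alpha)
  * expi (alpha * C0).
  rewrite /Tl /Ts !sum_expi_pair mulr_suml; apply: eq_bigr => x _.
  by rewrite -expiD; congr expi; rewrite /cube5; ring.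
by rewrite !Normc.normcM normc_expi mulr1.
Qed.

Lemma sqr_prod_le (x y M : R) : 0 <= x -> 0 <= y -> x ^+ 4 <= M -> y ^+ 4 <= M ->
  x ^+ 2 * y ^+ 2 <= M.
Proof.
move=> x0 y0 xM yM; have M0 : 0 <= M by apply: le_trans xM; rewrite exprn_ge0.
rewrite -(@ler_pXn2r _ 2) ?nnegrE ?mulr_ge0 ?sqr_ge0 // exprMn -!exprM [leRHS]expr2.
by apply: ler_pM; rewrite ?exprn_ge0.
Qed.

(** With s = q^(1/32), the squares of the four long sums give (s / q)^2 and that of the short sum
    s^(-4): in all q^(-2) s^(-2), which is [phi 4 q] / q. As each q has about q numerators, the long
    sums alone would leave a divergent series; the small gain of the short sum makes it converge. *)
Lemma major_term : exists2 C : R, 0 <= C & forall (p P Q q : nat) (a : int) (alpha : R),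
  P = (p ^ 120)%N -> Q = (p ^ 80)%N -> (2 < p)%N -> (0 < q <= p ^ 117)%N -> coprimez a q%:Z ->
  `|q%:R * alpha - a%:~R| <= (p ^ 243)%:R^-1 ->
  normc (\sum_(x : box P Q) expi (alpha * cube5 x)) ^+ 2 <=
  #|box P Q|%:R ^+ 2 * (C / q%:R * phi R 4 q
     / fr (1 + P%:R ^+ 3 * `|alpha - a%:~R / q%:R|) ^+ 6).
Proof.
have [C1 C10 h1] := major_long R; have [C2 C20 h2] := major_short R.
exists (C1 ^+ 2 * (C2 + 1)) => [|p P Q q a alpha PE QE p2 qb cop app].
  by rewrite mulr_ge0 ?sqr_ge0 // addr_ge0.
have hl t := h1 p q a alpha (P%:R + t) p2 qb cop app.
have hs := h2 p q a alpha t2 p2 qb cop app.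
rewrite -{}PE in hl; rewrite -{}QE in hs.
have /andP[q0 _] := qb; have qp : 0 < q%:R :> R by rewrite ltr0n.
rewrite normc_box_sum !exprMn card_boxR.
rewrite -!/(Ts Q t2 alpha) in hs.
have P0 : 0 <= P%:R :> R by []. have Q0 : 0 <= Q%:R :> R by [].
move: hl hs.
set s : R := rt 5 q%:R; set E := fr _.
have s0 : 0 < s by rewrite rt_gt0.
have E0 : 0 < E.
  by rewrite rt_gt0 // ltr_pwDl // mulr_ge0 // exprn_ge0.
have s2 : s ^+ 2 = rt 4 q%:R by exact: rtS_sqr.
rewrite /phi -s2 => hl hs.
have a1 := sqr_prod_le (normc_ge0 _) (normc_ge0 _) (hl t1) (hl t3).
have a2 := sqr_prod_le (normc_ge0 _) (normc_ge0 _) (hl t4) (hl t5).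
rewrite -!/(Tl P _ alpha) in a1 a2.
have a3 : normc (Ts Q t2 alpha) ^+ 2 <= (C2 + 1) * (Q%:R ^+ 2 / s ^+ 4).
  rewrite -(@ler_pXn2r _ 2) ?nnegrE ?sqr_ge0 //; last first.
    by rewrite mulr_ge0 ?addr_ge0 // divr_ge0 ?exprn_ge0 // ltW.
  rewrite -exprM; apply: le_trans hs _.
  have -> : ((C2 + 1) * (Q%:R ^+ 2 / s ^+ 4)) ^+ 2 = (C2 + 1) ^+ 2 * (Q%:R ^+ 4 / s ^+ 8).
    by field; rewrite gt_eqF.
  by rewrite ler_wpM2r ?divr_ge0 ?exprn_ge0 ?(ltW s0) //; nra.
set W := C1 * _ in a1 a2.
have W0 : 0 <= W by apply: le_trans a1; rewrite mulr_ge0 ?sqr_ge0.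
have -> : normc (Tl P t1 alpha) ^+ 2 * normc (Ts Q t2 alpha) ^+ 2 *
   (normc (Tl P t3 alpha) ^+ 2 * normc (Tl P t4 alpha) ^+ 2 * normc (Tl P t5 alpha) ^+ 2) =
   (normc (Tl P t1 alpha) ^+ 2 * normc (Tl P t3 alpha) ^+ 2) *
   (normc (Tl P t4 alpha) ^+ 2 * normc (Tl P t5 alpha) ^+ 2) * normc (Ts Q t2 alpha) ^+ 2 by ring.
apply: le_trans (_ : W * W * ((C2 + 1) * (Q%:R ^+ 2 / s ^+ 4)) <= _).
  apply: ler_pM; rewrite ?mulr_ge0 ?normc_ge0 //.
  by apply: ler_pM; rewrite ?mulr_ge0 ?normc_ge0.
rewrite le_eqVlt; apply/orP; left; apply/eqP; rewrite /W.
by field; rewrite !gt_eqF.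
Qed.

(** The factor 81 = D / P^3 converts the distance to a / q into the offset of the frequency from the
    centre of its arc, and 9 is its square root. The exponent 6/4 makes the sum over offsets
    converge. *)
Lemma fr_decay : exists2 C : R, 0 <= C & forall (B : R) (l : nat), 0 <= B -> l%:R <= 81 * B ->
  (fr (1 + B) ^+ 6)^-1 <= C * phi R 1 l.+1.
Proof.
exists (81 * 9) => // B l B0 lB.
have l0 : 0 < l.+1%:R :> R by rewrite ltr0n.
have b1 : 0 < 1 + B by lra.
have h1 : l.+1%:R <= 81 * (1 + B) by rewrite -natr1; lra.
have -> : fr (1 + B) ^+ 6 = (1 + B) * rt 1 (1 + B).
  have e2 : fr (1 + B) ^+ 2 = rt 1 (1 + B) by apply: rtS_sqr; exact: ltW.
  by rewrite -e2 -{2}(fr4 (ltW b1)) -exprD.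
have h2 : rt 1 l.+1%:R <= 9 * rt 1 (1 + B).
  have -> : 9 = rt 1 81 :> R.
    rewrite /rt /= (_ : 81 = 9 ^+ 2) ?sqrtr_sqr ?ger0_norm //; by ring.
  by rewrite -rtM ?(ltW b1) //; apply: rt_mono; rewrite (ltW l0).
have r1 : 0 < rt 1 (1 + B) by rewrite rt_gt0.
have r2 : 0 < rt 1 l.+1%:R :> R by rewrite rt_gt0.
rewrite /phi -[leLHS]mul1r ler_pdivrMr ?mulr_gt0 //.
rewrite mulrAC ler_pdivlMr ?mulr_gt0 // mul1r.
have -> : 81 * 9 * ((1 + B) * rt 1 (1 + B)) = (81 * (1 + B)) * (9 * rt 1 (1 + B)) by ring.
by apply: ler_pM; rewrite ?(ltW l0) ?(ltW r2).
Qed.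

End Energy.

Section EnergyBound.
Variable R : realType.

(** Outside a finite box of pairs (q, l) the convergent weights have a small tail; inside the box a
    constant weight [e3] may be chosen after its size is known. *)
Lemma weight_sum (C3 del : R) : 0 <= C3 -> 0 < del ->
  exists q0 l0 : nat, exists2 e3 : R, 0 < e3 <= 1 & forall N : nat,
  \sum_(1 <= q < N) \sum_(l < N) q%:R *
    (if (q <= q0)%N && (l <= l0)%N then e3 else C3 / q%:R * phi R 4 q * phi R 1 l.+1) <= del.
Proof.
move=> C30 d0; have C1 : 0 < C3 + 1 by lra.
(* 17 and 3 bound the sums of [phi 4] and [phi 1]; the box, the large q and the large l each receive
   at most a third of [del]. *)
pose tau := del / (3 * 17 * (C3 + 1)).
have tau0 : 0 < tau by rewrite divr_gt0 // !mulr_gt0.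
have [q0 q00 hq] := phi_tail_small 4 tau0; have [l0 l00 hl] := phi_tail_small 1 tau0.
pose M : R := q0%:R * (q0%:R * l0.+1%:R).
have q0p : 0 < q0%:R :> R by rewrite ltr0n.
have l0p : 0 < l0.+1%:R :> R by rewrite ltr0n.
have M0 : 0 < M by rewrite !mulr_gt0.
exists q0, l0, (Num.min 1 (del / (3 * M))) => [|N].
  by rewrite ge_min lexx lt_min ltr01 /= divr_gt0 // mulr_gt0.
set e3 := Num.min _ _.
have e30 : 0 <= e3 by rewrite /e3 le_min ler01 /= divr_ge0 ?mulr_ge0 ?(ltW d0) ?(ltW M0).
have e3M : e3 * M <= del / 3.
  apply: le_trans (_ : del / (3 * M) * M <= _); first by rewrite ler_wpM2r ?(ltW M0) // /e3 ge_min lexx orbT.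
  by rewrite le_eqVlt; apply/orP; left; apply/eqP; field; rewrite gt_eqF.
pose I1 (q : nat) : R := (q <= q0)%N%:R; pose J1 (l : nat) : R := (l <= l0)%N%:R.
pose f4 := phi R 4; pose f1 (l : nat) := phi R 1 l.+1.
have f40 q : 0 <= f4 q by exact: phi_ge0.
have f10 l : 0 <= f1 l by exact: phi_ge0.
apply: le_trans (_ : \sum_(1 <= q < N) \sum_(l < N) (q0%:R * e3 * (I1 q * J1 l)
    + C3 * (((1 - I1 q) * f4 q) * f1 l) + C3 * (f4 q * ((1 - J1 l) * f1 l))) <= _).
  apply: ler_sum_nat => q /andP[q1 _]; apply: ler_sum => l _.
  have qp : 0 < q%:R :> R by rewrite ltr0n.
  have g0 : 0 <= C3 * (f4 q * f1 l) by rewrite !mulr_ge0.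
  rewrite /I1 /J1 -/(f1 l) -/(f4 q).
  have e : q%:R * (C3 / q%:R * f4 q * f1 l) = C3 * (f4 q * f1 l) by field; rewrite gt_eqF.
  have [qq|qq] := leqP q q0; have [ll|ll] := leqP l l0 => /=; rewrite ?e; try lra.
  have : q%:R * e3 <= q0%:R * e3 by rewrite ler_wpM2r // ler_nat.
  lra.
under eq_bigr => q _ do rewrite !big_split /= -!mulr_sumr.
rewrite !big_split /= -!mulr_sumr.
have s1 : \sum_(1 <= q < N) I1 q <= q0%:R.
  rewrite -natr_sum ler_nat sum_bool_count -size_filter.
  apply: leq_trans (_ : size (iota 1 q0) <= _)%N; last by rewrite size_iota.
  apply: uniq_leq_size; first by rewrite filter_uniq // iota_uniq.
  by move=> x; rewrite mem_filter mem_index_iota mem_iota => /andP[h1 /andP[h2 _]]; lia.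
have s2 : \sum_(l < N) J1 l <= l0.+1%:R.
  rewrite -natr_sum ler_nat -(big_mkord xpredT (fun l => (l <= l0)%N : nat)).
  rewrite sum_bool_count -size_filter.
  apply: leq_trans (_ : size (iota 0 l0.+1) <= _)%N; last by rewrite size_iota.
  apply: uniq_leq_size; first by rewrite filter_uniq // iota_uniq.
  by move=> x; rewrite mem_filter mem_iota add0n ltnS => /andP[].
have s3 : \sum_(1 <= q < N) (1 - I1 q) * f4 q <= tau.
  have [Nq|Nq] := leqP N q0.+1.
    rewrite big_nat big1 ?(ltW tau0) // => q /andP[_ qN].
    by rewrite /I1 -ltnS (leq_trans qN Nq) subrr mul0r.
  rewrite (@big_cat_nat _ _ _ q0.+1) ?(ltnW Nq) //= [X in X + _]big_nat big1 ?add0r; last first.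
    by move=> q /andP[_ qN]; rewrite /I1 -ltnS qN subrr mul0r.
  apply: le_trans (hq N); apply: ler_sum_nat => q /andP[h1 _].
  by rewrite /I1 leqNgt h1 subr0 mul1r.
have s4 : \sum_(l < N) f1 l <= 3.
  rewrite -(big_mkord xpredT f1) -(big_add1 _ _ 0 N.+1 xpredT (phi R 1)).
  by apply: le_trans (phi_sum _ _ _) _; rewrite expn1; lra.
have s5 : \sum_(l < N) (1 - J1 l) * f1 l <= tau.
  rewrite -(big_mkord xpredT (fun l => (1 - J1 l) * f1 l)).
  have [Nl|Nl] := leqP N l0.+1.
    rewrite big_nat big1 ?(ltW tau0) // => l /andP[_ lN].
    by rewrite /J1 -ltnS (leq_trans lN Nl) subrr mul0r.
  rewrite (@big_cat_nat _ _ _ l0.+1) ?(ltnW Nl) //= [X in X + _]big_nat big1 ?add0r; last first.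
    by move=> l /andP[_ lN]; rewrite /J1 -ltnS lN subrr mul0r.
  apply: le_trans (hl N.+1).
  rewrite [leRHS](@big_cat_nat _ _ _ l0.+2) ?leqnSn ?(leqW Nl) //= -[leLHS]add0r; apply: lerD.
    by apply: sumr_ge0 => i _; exact: phi_ge0.
  rewrite [leRHS]big_add1 /=; apply: ler_sum_nat => l /andP[h1 _].
  by rewrite /J1 leqNgt h1 subr0 mul1r.
have s6 : \sum_(1 <= q < N) f4 q <= 17.
  by apply: le_trans (phi_sum _ _ _) _; rewrite (_ : (2 ^ 4 = 16)%N) //; lra.
have i0 : 0 <= \sum_(1 <= q < N) I1 q by apply: sumr_ge0.
have j0 : 0 <= \sum_(l < N) J1 l by apply: sumr_ge0.
have I01 q : 0 <= 1 - I1 q by rewrite subr_ge0 /I1; case: (q <= q0)%N.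
have J01 l : 0 <= 1 - J1 l by rewrite subr_ge0 /J1; case: (l <= l0)%N.
have b0 : 0 <= \sum_(1 <= q < N) (1 - I1 q) * f4 q by apply: sumr_ge0 => q _; rewrite mulr_ge0.
have c0 : 0 <= \sum_(l < N) f1 l by apply: sumr_ge0.
have d1 : 0 <= \sum_(l < N) (1 - J1 l) * f1 l by apply: sumr_ge0 => l _; rewrite mulr_ge0.
have g0 : 0 <= \sum_(1 <= q < N) f4 q by apply: sumr_ge0.
have m1 := ler_pM i0 j0 s1 s2; have m2 := ler_pM b0 c0 s3 s4; have m3 := ler_pM g0 d1 s6 s5.
rewrite -!mulr_suml.
have tC : tau * (C3 + 1) = del / (3 * 17) by rewrite /tau; field; rewrite gt_eqF.
have n1 : q0%:R * e3 * ((\sum_(1 <= q < N) I1 q) * (\sum_(l < N) J1 l)) <= e3 * M.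
  have -> : e3 * M = q0%:R * e3 * (q0%:R * l0.+1%:R) by rewrite /M; ring.
  by rewrite ler_wpM2l // mulr_ge0.
have n2 := ler_wpM2l C30 m2; have n3 := ler_wpM2l C30 m3.
lra.
Qed.

End EnergyBound.

(** * The minor arcs *)

Section EnergyMain.
Variable R : realType.
Local Notation normc := (@Normc.normc R).
Variables t1 t2 t3 t4 t5 C0 : R.
Hypotheses (it1 : irr t1) (t1b : 0 <= t1 <= 1) (t2b : 0 <= t2 <= 1).

Local Notation T P Q alpha :=
  (\sum_(x : box P Q) expi (alpha * @cube5 R t1 t2 t3 t4 t5 C0 P Q x)).

Lemma Tl_le P t (alpha : R) : normc (Tl P t alpha) <= P%:R.
Proof. exact: (@normc_sum_expi_le R _ (fun i => alpha * (i%:R + (P%:R + t)) ^+ 3)). Qed.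

Lemma Ts_le Q t (alpha : R) : normc (Ts Q t alpha) <= Q%:R.
Proof. exact: (@normc_sum_expi_le R _ (fun i => alpha * (i%:R + t) ^+ 3)). Qed.

Lemma box_sum_le P Q (alpha c : R) : 0 <= c -> normc (Tl P t1 alpha) <= c * P%:R ->
  normc (T P Q alpha) <= c * #|box P Q|%:R.
Proof.
move=> c0 h; rewrite normc_box_sum card_boxR.
have := Ts_le Q t2 alpha; have := Tl_le P t3 alpha.
have := Tl_le P t4 alpha; have := Tl_le P t5 alpha.
move: h (normc_ge0 (Tl P t1 alpha)) (normc_ge0 (Ts Q t2 alpha)) (normc_ge0 (Tl P t3 alpha))
  (normc_ge0 (Tl P t4 alpha)) (normc_ge0 (Tl P t5 alpha)).
move: (normc (Tl P t1 alpha)) (normc (Ts Q t2 alpha)) (normc (Tl P t3 alpha))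
  (normc (Tl P t4 alpha)) (normc (Tl P t5 alpha)) => a b d e f ha a0 b0 d0 e0 f0 hf he hd hb.
rewrite (_ : c * _ = c * P%:R * Q%:R * (P%:R * P%:R * P%:R)); last by ring.
by apply: ler_pM; [exact: mulr_ge0 | do 2 apply: mulr_ge0 => // | exact: ler_pM
  | apply: ler_pM => //; [exact: mulr_ge0 | exact: ler_pM]].
Qed.

(** Three long sums are bounded pointwise by Weyl's inequality, and the square of the remaining long
    sum times the short one is summed over all frequencies by the diagonal estimate. The factor p^10
    on the left is the saving. *)
Lemma minor_sum (A : nat) : exists2 C : R, 0 <= C & forall (p P Q D K : nat),
  P = (p ^ 120)%N -> Q = (p ^ 80)%N -> D = (81 * P ^ 3)%N -> K = (A * D)%N -> (80 < p)%N ->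
  forall S : {set 'I_K},
  (forall h, h \in S -> exists (q : nat) (a : int), [/\ (p ^ 117 < q <= p ^ 243)%N, coprimez a q%:Z &
     `|q%:R * (h%:R / D%:R) - a%:~R| <= (p ^ 243)%:R^-1 :> R]) ->
  (\sum_(h in S) normc (T P Q (h%:R / D%:R)) ^+ 2) * p%:R ^+ 10 <=
  C * #|box P Q|%:R ^+ 2.
Proof.
have [C1 C10 hC1] := minor_bound R.
have [c2 c21 hc2] := harm_scale R 361.
exists ((C1 + 1) ^+ 3 * (3 * 81 * (2 * A%:R + 4 * c2))) => [|p P Q D K PE QE DE KE p80 S hS].
  by rewrite !mulr_ge0 ?exprn_ge0 ?addr_ge0 ?mulr_ge0 //; lra.
have p0 : (0 < p)%N by exact: leq_trans p80.
set x : R := p%:R; have x1 : 1 <= x by rewrite ler1n.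
have x0 : 0 < x by exact: lt_le_trans x1.
have PR : P%:R = x ^+ 120 by rewrite PE natrX.
have QR : Q%:R = x ^+ 80 by rewrite QE natrX.
have P0 : (0 < P)%N by rewrite PE expn_gt0 p0.
have P1 : 1 <= P%:R :> R by rewrite ler1n.
have DR : D%:R = 81 * P%:R ^+ 3 :> R by rewrite DE natrM natrX.
have D0 : (0 < D)%N by rewrite DE muln_gt0 expn_gt0 P0.
have Dp : 0 < D%:R :> R by rewrite ltr0n.
pose v (z : 'I_P * 'I_Q) : R := (z.1%:R + (P%:R + t1)) ^+ 3 + (z.2%:R + t2) ^+ 3.
have PQ : (Q ^ 3 <= P ^ 2)%N by rewrite PE QE -!expnM.
have DH : (D <= p ^ 361)%N.
  by rewrite DE PE -expnM [in leqRHS]expnS leq_mul2r; apply/orP; right.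
have vb z : 0 <= v z <= 9 * P%:R ^+ 3.
  case: z => i k; rewrite /v /=; have /andP[a1 a2] := t1b; have /andP[b1 b2] := t2b.
  have i1 : i%:R + 1 <= P%:R :> R by rewrite natr1 ler_nat.
  have k1 : k%:R + 1 <= Q%:R :> R by rewrite natr1 ler_nat.
  have i0 : 0 <= i%:R :> R by []. have k0 : 0 <= k%:R :> R by [].
  have c1 : (i%:R + (P%:R + t1)) ^+ 3 <= (2 * P%:R) ^+ 3 by rewrite lerXn2r ?nnegrE //; lra.
  have c2' : (k%:R + t2) ^+ 3 <= Q%:R ^+ 3 by rewrite lerXn2r ?nnegrE //; lra.
  have c3 : Q%:R ^+ 3 <= P%:R ^+ 2 :> R by rewrite -!natrX ler_nat.
  have c4 : P%:R ^+ 2 <= P%:R ^+ 3 :> R by rewrite ler_weXn2l.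
  have c5 : 0 <= (i%:R + (P%:R + t1)) ^+ 3 by rewrite exprn_ge0 //; lra.
  have c6 : 0 <= (k%:R + t2) ^+ 3 by rewrite exprn_ge0 //; lra.
  have c7 : (2 * P%:R) ^+ 3 = 8 * P%:R ^+ 3 :> R by ring.
  by apply/andP; split; lra.
have diam z w : `|v z - v w| <= D%:R / 2.
  have /andP[z1 z2] := vb z; have /andP[w1 w2] := vb w.
  have : 0 <= P%:R ^+ 3 :> R by rewrite exprn_ge0.
  by rewrite ler_norml DR => h; apply/andP; split; lra.
have diag := @diagonal_sum R _ v D K D0 (two_cubes_separated P0 PQ t1b t2b) diam.
(* 183 is 365 / 2 rounded up. *)
have sup t (h : 'I_K) : h \in S -> normc (Tl P t (h%:R / D%:R)) ^+ 2 <= (C1 + 1) * x ^+ 183.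
  move=> hin; have [q [a [qb cop app]]] := hS h hin.
  have := hC1 p q a (h%:R / D%:R) (P%:R + t) p0 qb cop app; rewrite -PE -/(Tl P t _) -/x => h4.
  have x183 : 0 <= x ^+ 183 by rewrite exprn_ge0 // ltW.
  rewrite -(@ler_pXn2r _ 2) ?nnegrE ?sqr_ge0 //; last by apply: mulr_ge0 => //; lra.
  rewrite -exprM exprMn -exprM; apply: le_trans h4 _.
  apply: ler_pM => //; first by rewrite exprn_ge0 // ltW.
    by nra.
  exact: ler_weXn2l.
have H : harm R D <= c2 * x by exact: hc2.
have H0 := harm_ge0 R D.
have [Y YE] : exists Y : R, Y = (C1 + 1) * x ^+ 183 by eexists.
rewrite -YE in sup; have Y0 : 0 <= Y.
  by rewrite YE mulr_ge0 ?exprn_ge0 ?(ltW x0) //; lra.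
have step : \sum_(h in S) normc (T P Q (h%:R / D%:R)) ^+ 2 <=
   Y ^+ 3 * \sum_(k < K) normc (\sum_z expi (k%:R / D%:R * v z)) ^+ 2.
  rewrite mulr_sumr [leRHS](bigID (mem S)) /= -[leLHS]addr0; apply: lerD; last first.
    by apply: sumr_ge0 => k _; rewrite mulr_ge0 ?exprn_ge0 ?normc_ge0.
  apply: ler_sum => h hin; rewrite normc_box_sum !exprMn.
  have -> : \sum_z expi (h%:R / D%:R * v z) = Tl P t1 (h%:R / D%:R) * Ts Q t2 (h%:R / D%:R).
    by rewrite /Tl /Ts sum_expi_pair; apply: eq_bigr => z _; congr expi; rewrite /v; ring.
  rewrite Normc.normcM exprMn [leRHS]mulrC.
  move: (sup t3 h hin) (sup t4 h hin) (sup t5 h hin).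
  move: (sqr_ge0 (normc (Tl P t3 (h%:R / D%:R)))) (sqr_ge0 (normc (Tl P t4 (h%:R / D%:R))))
    (sqr_ge0 (normc (Tl P t5 (h%:R / D%:R)))) (sqr_ge0 (normc (Tl P t1 (h%:R / D%:R))))
    (sqr_ge0 (normc (Ts Q t2 (h%:R / D%:R)))).
  move: (normc (Tl P t3 (h%:R / D%:R)) ^+ 2) (normc (Tl P t4 (h%:R / D%:R)) ^+ 2)
    (normc (Tl P t5 (h%:R / D%:R)) ^+ 2) (normc (Tl P t1 (h%:R / D%:R)) ^+ 2)
    (normc (Ts Q t2 (h%:R / D%:R)) ^+ 2) => a b d e f a0 b0 d0 e0 f0 ha hb hd.
  apply: ler_wpM2l; first exact: mulr_ge0.
  have -> : Y ^+ 3 = Y * Y * Y by ring.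
  by apply: ler_pM => //; [exact: mulr_ge0 | exact: ler_pM].
have Y3 : 0 <= Y ^+ 3 by rewrite exprn_ge0.
have x10 : 0 <= x ^+ 10 by rewrite exprn_ge0 // ltW.
apply: le_trans (ler_wpM2r x10 step) _.
apply: le_trans (ler_wpM2r x10 (ler_wpM2l Y3 diag)) _.
have b1 : 3 * (2 * K%:R + 4 * D%:R * harm R D) <= 3 * (D%:R * (2 * A%:R + 4 * c2) * x).
  have KR : K%:R = A%:R * D%:R :> R by rewrite KE natrM.
  have A0 : 0 <= A%:R :> R by [].
  have m1 : D%:R * harm R D <= D%:R * (c2 * x) by rewrite ler_wpM2l // ltW.
  have m2 : A%:R * D%:R <= A%:R * D%:R * x by rewrite ler_peMr // mulr_ge0 // ltW.
  rewrite KR; lra.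
have cE : #|{: 'I_P * 'I_Q}|%:R = P%:R * Q%:R :> R by rewrite card_prod !card_ord natrM.
have PQ0 : 0 <= P%:R * Q%:R :> R by rewrite mulr_ge0.
rewrite cE.
apply: le_trans (ler_wpM2r x10 (ler_wpM2l Y3 (ler_wpM2l PQ0 b1))) _.
rewrite card_boxR DR le_eqVlt; apply/orP; left; apply/eqP.
(* Three pointwise bounds use 549, the logarithm 1 and the saving 10: together 560 = 4 * 120 + 80,
   the exponent of P^4 Q. *)
have key : x ^+ 183 ^+ 3 * x * x ^+ 10 = P%:R ^+ 4 * Q%:R.
  by rewrite PR QR -!exprM -exprSr -!exprD.
rewrite YE exprMn.
rewrite (_ : _ * x ^+ 10 = (C1 + 1) ^+ 3 * (3 * 81 * (2 * A%:R + 4 * c2)) * (P%:R ^+ 4 * Q%:R)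
  * (x ^+ 183 ^+ 3 * x * x ^+ 10)); last by move: (x ^+ 183) (x ^+ 10) => u w; ring.
by rewrite key; ring.
Qed.

End EnergyMain.

(** * The total energy over all frequencies *)

Section EnergyTotal.
Variable R : realType.
Local Notation normc := (@Normc.normc R).
Variables t1 t2 t3 t4 t5 C0 : R.
Hypotheses (it1 : irr t1) (t1b : 0 <= t1 <= 1) (t2b : 0 <= t2 <= 1).

Local Notation T P Q alpha :=
  (\sum_(x : box P Q) expi (alpha * @cube5 R t1 t2 t3 t4 t5 C0 P Q x)).

Lemma truncn_lt (x : R) : 0 <= x -> x < (Num.truncn x).+1%:R.
Proof. by move=> x0; have /andP[] := truncn_itv x0. Qed.

(** Only finitely many pairs (q, a) occur, so a maximum of thresholds is uniform. *)
Lemma fixed_arcs (A q0 l0 : nat) (e3 : R) : 0 < e3 -> exists n1 : nat,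
  forall (P q : nat) (a : int) (alpha : R), (n1 <= P)%N -> (0 < q <= q0)%N ->
  a != 0 -> 0 <= a -> (`|a| <= A * q)%N -> P%:R ^+ 3 * `|alpha - a%:~R / q%:R| <= l0.+1%:R ->
  normc (Tl P t1 alpha) <= e3 * P%:R.
Proof.
move=> e30.
have hn (z : 'I_q0.+1 * 'I_(A * q0).+1) : exists n0 : nat, (0 < z.1)%N -> (0 < z.2)%N ->
   forall P : nat, (n0 <= P)%N -> forall alpha : R,
   P%:R ^+ 3 * `|alpha - (z.2%:Z)%:~R / z.1%:R| <= l0.+1%:R ->
   normc (Tl P t1 alpha) <= e3 * P%:R.
  case: z => q a /=; have [q1|q1] := posnP (q : nat); first by exists 0%N.
  have [a1|a1] := posnP (a : nat); first by exists 0%N.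
  have aN : a%:Z != 0 by rewrite -lt0n.
  have [n0 h] := cube_near_rational_small it1 t1b aN q1 (ler0n R l0.+1) e30.
  by exists n0 => _ _ P hP alpha; exact: h.
have [nf hnf] := fin_all_exists hn.
exists (\max_z nf z) => P q a alpha hP /andP[q1 q2] a0 age aA app.
have aE : a = `|a|%N%:Z by rewrite gez0_abs.
have a1 : (`|a| < (A * q0).+1)%N by rewrite ltnS (leq_trans aA) // leq_mul2l q2 orbT.
have q3 : (q < q0.+1)%N by rewrite ltnS.
apply: (hnf (Ordinal q3, Ordinal a1)) => //=; first by rewrite absz_gt0.
  by apply: leq_trans hP; exact: (@leq_bigmax _ nf (Ordinal q3, Ordinal a1)).
by rewrite -aE.
Qed.

(** Major frequencies with large q or large offset fall under [major_term] and the convergent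
    weights. Of the others, those with a = 0 are killed by the coefficient bound h / k0, those with
    a nonzero by the irrationality of t1. So [k0] is fixed after [q0], [l0], [e3] and before [p]. *)
Lemma energy (A k1 : nat) (e : R) : 0 < e ->
  exists k0 : nat, (0 < k0)%N /\ (k1 <= k0)%N /\ exists p0 : nat,
  forall p P Q D K : nat, (p0 <= p)%N ->
  P = (p ^ 120)%N -> Q = (p ^ 80)%N -> D = (81 * P ^ 3)%N -> K = (A.+1 * D)%N ->
  (k0 <= K)%N /\
  \sum_(1 <= h < K) fejer_diff R K k0 h ^+ 2 * normc (T P Q (h%:R / D%:R)) ^+ 2
    <= (e * #|box P Q|%:R) ^+ 2.
Proof.
move=> e0; have e2 : 0 < e ^+ 2 by rewrite exprn_gt0.
have [C1 C10 hC1] := major_term t1 t2 t3 t4 t5 C0.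
have [C2 C20 hC2] := fr_decay R.
pose C3 := C1 * C2; have C30 : 0 <= C3 by rewrite mulr_ge0.
(* Numerators go up to (A + 2) q, since h / D is at most A + 1 and the error is below 1. Then
   [sum_injective_le] costs 2 (A + 3), and 2 (A + 3) del = e^2 / 2. *)
pose del := e ^+ 2 / (4 * A.+3%:R).
have A3 : 0 < A.+3%:R :> R by rewrite ltr0n.
have del0 : 0 < del by rewrite divr_gt0 // mulr_gt0.
have [q0 [l0 [e3 /andP[e30 e31] hw]]] := weight_sum C30 del0.
have [k0 [k0p kk lk]] : exists k0 : nat, [/\ (0 < k0)%N, (k1 <= k0)%N & l0%:R / k0%:R <= e3].
  exists (maxn k1 (Num.truncn (l0%:R / e3)).+1); rewrite leq_maxl leq_max orbT; split => //.
  rewrite ler_pdivrMr ?ltr0n ?leq_max ?orbT // mulrC -ler_pdivrMr //.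
  have h0 : 0 <= l0%:R / e3 by rewrite divr_ge0 // ltW.
  apply: le_trans (ltW (truncn_lt h0)) _; rewrite ler_nat; exact: leq_maxr.
have k0R : 0 < k0%:R :> R by rewrite ltr0n.
exists k0; split => //; split => //.
have [n1 hn1] := fixed_arcs A.+2 q0 l0 e30.
have [C4 C40 hC4] := minor_sum t3 t4 t5 C0 t1b t2b A.+1.
pose n2 := (Num.truncn (2 * C4 / e ^+ 2)).+1.
exists (maxn 81 (maxn n1 (maxn n2 k0))) => p P Q D K.
rewrite !geq_max => /andP[p81 /andP[pn1 /andP[pn2 pk0]]] PE QE DE KE.
have p0 : (0 < p)%N by exact: leq_trans p81.
have pP : (p <= P)%N by rewrite PE -{1}[p]expn1 leq_pexp2l.
have P0 : (0 < P)%N by exact: leq_trans pP.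
have PD : (P <= D)%N by rewrite DE; apply: leq_trans (leq_pmull _ _) => //; rewrite -{1}[P]expn1 leq_pexp2l.
have D0 : (0 < D)%N by exact: leq_trans PD.
have DK : (D <= K)%N by rewrite KE leq_pmull.
have kK : (k0 <= K)%N by rewrite (leq_trans pk0) // (leq_trans pP) // (leq_trans PD).
split => //.
have kK' : (0 < k0 <= K)%N by rewrite k0p.
have Dp : 0 < D%:R :> R by rewrite ltr0n.
have Pp : 0 < P%:R :> R by rewrite ltr0n.
have DR : D%:R = 81 * P%:R ^+ 3 :> R by rewrite DE natrM natrX.
pose X2 : R := #|box P Q|%:R ^+ 2; have X20 : 0 <= X2 by rewrite sqr_ge0.
pose G (h : nat) := fejer_diff R K k0 h ^+ 2 * normc (T P Q (h%:R / D%:R)) ^+ 2.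
have G0 h : 0 <= G h by rewrite mulr_ge0 ?sqr_ge0.
have K0 : (0 < K)%N by exact: leq_trans DK.
apply: le_trans (_ : \sum_(h < K) G h <= _).
  by rewrite -(big_mkord xpredT G) [leRHS]big_ltn // lerDr.
have Y0 : (0 < p ^ 243)%N by rewrite expn_gt0 p0.
have dir (h : 'I_K) : exists z : nat * int, [/\ (0 < z.1 <= p ^ 243)%N, coprimez z.2 z.1%:Z &
    `|z.1%:R * (h%:R / D%:R) - z.2%:~R| <= (p ^ 243)%:R^-1 :> R].
  by have [q [a h1]] := @dirichlet R (h%:R / D%:R) _ Y0; exists (q, a).
have [z hz] := fin_all_exists dir.
pose S : {set 'I_K} := [set h | ((z h).1 <= p ^ 117)%N].
have gam (h : 'I_K) : fejer_diff R K k0 h ^+ 2 <= 1.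
  have [/andP[g0 g1] _] := @fejer_diff_bounds R K k0 h kK' (ltn_ord h).
  by rewrite expr_le1.
have Gle (h : 'I_K) : G h <= normc (T P Q (h%:R / D%:R)) ^+ 2.
  by rewrite /G ler_piMl ?sqr_ge0.
have minor : \sum_(h in ~: S) G h <= e ^+ 2 / 2 * X2.
  have hS' (h : 'I_K) : h \in ~: S -> exists (q : nat) (a : int), [/\ (p ^ 117 < q <= p ^ 243)%N, coprimez a q%:Z &
     `|q%:R * (h%:R / D%:R) - a%:~R| <= (p ^ 243)%:R^-1 :> R].
    rewrite !inE -ltnNge => hS; have [/andP[_ b1] b2 b3] := hz h.
    by exists (z h).1, (z h).2; rewrite hS b1.
  have := hC4 p P Q D K PE QE DE KE p81 (~: S) hS'.
  set M := \sum_(h in ~: S) _; rewrite -/X2 => hM.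
  apply: le_trans (_ : M <= _); first by apply: ler_sum => h _.
  have x1 : 1 <= p%:R :> R by rewrite ler1n.
  have M0 : 0 <= M by apply: sumr_ge0 => h _; rewrite sqr_ge0.
  have h1 : M * p%:R <= C4 * X2.
    apply: le_trans hM; rewrite ler_wpM2l // -{1}[p%:R]expr1; exact: ler_weXn2l.
  have h2 : 2 * C4 <= e ^+ 2 * p%:R.
    rewrite [leRHS]mulrC -ler_pdivrMr //.
    have h0 : 0 <= 2 * C4 / e ^+ 2 by rewrite divr_ge0 ?mulr_ge0 // ltW.
    by apply: le_trans (ltW (truncn_lt h0)) _; rewrite ler_nat.
  rewrite -(@ler_pM2r _ p%:R); last by lra.
  apply: le_trans h1 _.
  have -> : e ^+ 2 / 2 * X2 * p%:R = (e ^+ 2 * p%:R / 2) * X2 by ring.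
  by apply: ler_wpM2r => //; lra.
have major : \sum_(h in S) G h <= e ^+ 2 / 2 * X2.
  pose g (q l : nat) : R := if (q <= q0)%N && (l <= l0)%N then e3 else C3 / q%:R * phi R 4 q * phi R 1 l.+1.
  (* The centre a D / q of the arc need not be an integer, so the offset is real; with q and a, its
     sign and integer part still determine h. *)
  pose u (h : 'I_K) : R := h%:R - (z h).2%:~R * D%:R / (z h).1%:R.
  pose f (h : 'I_K) : nat * nat * bool * nat :=
    ((z h).1, `|(z h).2|%N, u h < 0, Num.truncn `|u h|).
  have zq (h : 'I_K) : 0 < (z h).1%:R :> R by have [/andP[b1 _] _ _] := hz h; rewrite ltr0n.
  have ub (h : 'I_K) : `|h%:R / D%:R - (z h).2%:~R / (z h).1%:R| = `|u h| / D%:R.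
    have -> : h%:R / D%:R - (z h).2%:~R / (z h).1%:R = u h / D%:R :> R.
      by rewrite /u; field; rewrite (gt_eqF (zq h)) (gt_eqF Dp).
    by rewrite normrM normfV (ger0_norm (ltW Dp)).
  have za (h : 'I_K) : 0 <= (z h).2 /\ (`|(z h).2| <= A.+2 * (z h).1)%N.
    have [/andP[b1 _] _ b3] := hz h.
    have b4 : (p ^ 243)%:R^-1 < 1 :> R.
      rewrite invf_lt1 ?ltr0n // ltr1n -[1%N](exp1n 243) ltn_exp2r //; exact: leq_trans p81.
    have hK : h%:R / D%:R <= A.+1%:R :> R.
      by rewrite ler_pdivrMr // -natrM ler_nat -KE ltnW.
    have h0 : 0 <= h%:R / D%:R :> R by rewrite divr_ge0 // ltW.
    move: b3; rewrite ler_norml => /andP[c1 c2].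
    have m1 : 0 <= (z h).1%:R * (h%:R / D%:R) :> R by rewrite mulr_ge0 // ltW.
    have m2 : (z h).1%:R * (h%:R / D%:R) <= (z h).1%:R * A.+1%:R :> R by rewrite ler_wpM2l // ltW.
    have q1 : 1 <= (z h).1%:R :> R by rewrite ler1n.
    have d1 : -1 < (z h).2.
      by rewrite -(ltr_int R) mulrN1z; lra.
    have d2 : 0 <= (z h).2 by move: d1; rewrite -lezD1 addNr.
    split => //.
    have : `|(z h).2|%N%:R < (A.+2 * (z h).1)%N.+1%:R :> R; last by rewrite ltr_nat ltnS.
    have -> : `|(z h).2|%N%:R = (z h).2%:~R :> R by rewrite -{2}(gez0_abs d2) pmulrn.
    by rewrite -natr1 natrM -[A.+2%:R]natr1; lra.
  have f_inj : {in S &, injective f}.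
    move=> h h' _ _ [] e1 e2' e3' e4.
    have az : (z h).2 = (z h').2.
      have [d _] := za h; have [d' _] := za h'.
      by rewrite -(gez0_abs d) -(gez0_abs d') e2'.
    have uu : u h - u h' = h%:R - h'%:R by rewrite /u e1 az; ring.
    have := truncn_itv (normr_ge0 (u h)); have := truncn_itv (normr_ge0 (u h')).
    rewrite e4 -[(Num.truncn _).+1%:R]natr1; set r := (Num.truncn _)%:R => k2 k1'.
    have d1 : `|u h - u h'| < 1.
      have [ui|ui] := boolP (u h < 0); rewrite ?ui ?(negbTE ui) in e3'; symmetry in e3'.
        move: k1' k2; rewrite (ltr0_norm ui) (ltr0_norm e3') => k1' k2.
        by have [w|w] := ler0P (u h - u h'); lra.
      move/negbT: e3'; move: ui; rewrite -!leNgt => ui uj.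
      move: k1' k2; rewrite (ger0_norm ui) (ger0_norm uj) => k1' k2.
      by have [w|w] := ler0P (u h - u h'); lra.
    apply: val_inj => /=; apply/eqP; apply/negPn/negP => ij.
    move: d1; rewrite uu ltNge => /negP; apply.
    have -> : h%:R - h'%:R = (h%:Z - h'%:Z)%:~R :> R by rewrite intrB.
    rewrite -intr_norm (ler_int _ 1) -gtz0_ge1 normr_gt0 subr_eq0.
    by apply: contra ij => /eqP [->].
  have g0 q l : 0 <= g q l.
    by rewrite /g; case: ifP => _; rewrite ?(ltW e30) // !mulr_ge0 ?phi_ge0 // invr_ge0.
  have main (h : 'I_K) : h \in S -> G h <= X2 * g (f h).1.1.1 (f h).2.
    rewrite inE => hS; have [/andP[b1 b2] cop app] := hz h; have [a0 aA] := za h.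
    rewrite /f /= /g; case: ifP => [/andP[qq ll]|_].
      (* For a = 0 coprimality forces q = 1, so the offset is h itself and h <= l0. *)
      have [az|az] := eqVneq (z h).2 0.
        have z1 : (z h).1 = 1%N.
          by move: cop; rewrite az /coprimez gcd0z => /eqP [].
        have uh : u h = h%:R by rewrite /u az mul0r mul0r subr0.
        have hl0 : (h <= l0)%N by move: ll; rewrite uh ger0_norm // natrK.
        have [/andP[ga0 ga1] ga2] := @fejer_diff_bounds R K k0 h kK' (ltn_ord h).
        have ge : fejer_diff R K k0 h <= e3.
          apply: le_trans ga2 _; apply: le_trans lk.
          by apply: ler_wpM2r; [rewrite invr_ge0 ltW | rewrite ler_nat].
        have gg : fejer_diff R K k0 h ^+ 2 <= e3.
          by rewrite expr2; apply: le_trans (ler_pM ga0 ga0 ge ga1) _; rewrite mulr1.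
        rewrite /G [leRHS]mulrC; apply: ler_pM; rewrite ?sqr_ge0 //.
        rewrite /X2 ler_sqr ?nnegrE ?normc_ge0 //.
        have := @box_sum_le R t1 t2 t3 t4 t5 C0 P Q (h%:R / D%:R) 1 ler01.
        by rewrite !mul1r; apply; exact: Tl_le.
      have near : P%:R ^+ 3 * `|h%:R / D%:R - (z h).2%:~R / (z h).1%:R| <= l0.+1%:R :> R.
        rewrite ub DR.
        have -> : P%:R ^+ 3 * (`|u h| / (81 * P%:R ^+ 3)) = `|u h| / 81 by field; rewrite gt_eqF.
        have := truncn_lt (normr_ge0 (u h)).
        have : (Num.truncn `|u h|).+1%:R <= l0.+1%:R :> R by rewrite ler_nat ltnS.
        have := normr_ge0 (u h); lra.
      have qb : (0 < (z h).1 <= q0)%N by rewrite b1 qq.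
      have s1 := hn1 P _ _ _ (leq_trans pn1 pP) qb az a0 aA near.
      have s2 := @box_sum_le R t1 t2 t3 t4 t5 C0 P Q _ _ (ltW e30) s1.
      apply: le_trans (Gle h) _.
      apply: le_trans (_ : (e3 * #|box P Q|%:R) ^+ 2 <= _).
        by rewrite ler_sqr ?nnegrE ?normc_ge0 // mulr_ge0 // ltW.
      rewrite exprMn mulrC /X2 ler_wpM2l ?sqr_ge0 // expr2 ler_piMl // ltW //.
    have qb : (0 < (z h).1 <= p ^ 117)%N by rewrite b1 hS.
    have p2 : (2 < p)%N by exact: leq_trans p81.
    apply: le_trans (Gle h) _.
    apply: le_trans (hC1 p P Q _ _ _ PE QE p2 qb cop app) _.
    rewrite -/X2; apply: ler_wpM2l => //.
    have -> : C3 / (z h).1%:R * phi R 4 (z h).1 * phi R 1 (Num.truncn `|u h|).+1 =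
      C1 / (z h).1%:R * phi R 4 (z h).1 * (C2 * phi R 1 (Num.truncn `|u h|).+1).
      by rewrite /C3; ring.
    apply: ler_wpM2l; first by rewrite !mulr_ge0 ?phi_ge0 // invr_ge0.
    apply: hC2; first by rewrite mulr_ge0 // exprn_ge0.
    rewrite ub DR.
    have -> : 81 * (P%:R ^+ 3 * (`|u h| / (81 * P%:R ^+ 3))) = `|u h| by field; rewrite gt_eqF.
    by rewrite truncn_le.
  apply: le_trans (ler_sum _ main) _; rewrite -mulr_sumr mulrC; apply: ler_wpM2r => //.
  have fa (h : 'I_K) : h \in S -> (0 < (f h).1.1.1)%N /\ ((f h).1.1.2 <= A.+2 * (f h).1.1.1)%N.
    move=> _; have [/andP[b1 _] _ _] := hz h; have [_ aA] := za h; by [].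
  apply: le_trans (sum_injective_le f_inj fa g0 hw) _.
  by rewrite /del le_eqVlt; apply/orP; left; apply/eqP; field; rewrite gt_eqF.
rewrite (bigID (mem S)) /= exprMn -/X2.
have -> : \sum_(i < K | i \notin S) G i = \sum_(h in ~: S) G h.
  by apply: eq_bigl => h; rewrite finset.in_setC.
have -> : e ^+ 2 * X2 = e ^+ 2 / 2 * X2 + e ^+ 2 / 2 * X2 by field.
exact: lerD.
Qed.

End EnergyTotal.

(** * Counting bad grid points *)

Section Wide.
Variable R : realType.

(** Take the last index whose cube is at most y and go back L steps; up to 2 P the derivative of the
    cube is at most 12 P^2. *)
Lemma cube_run (P L : nat) (t y w : R) : (40 <= P)%N -> 0 <= t <= 1 ->
  3 / 2 * P%:R ^+ 3 <= y <= 7 * P%:R ^+ 3 -> (20 * L <= P)%N -> 12 * L%:R * P%:R ^+ 2 <= w ->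
  exists2 s : nat, (s + L <= P)%N & forall j : nat, (s <= j < s + L)%N ->
    `|(j%:R + (P%:R + t)) ^+ 3 - y| <= w.
Proof.
move=> P40 /andP[t0 t1] /andP[y1 y2] LP wL.
have Pr : 40 <= P%:R :> R by rewrite (ler_nat _ 40).
have LR : 20 * L%:R <= P%:R :> R by rewrite -natrM ler_nat.
have L0 : 0 <= L%:R :> R by [].
pose X (i : nat) : R := i%:R + (P%:R + t).
pose ok (i : nat) := (i < P)%N && (X i ^+ 3 <= y).
have ok0 : exists i, ok i.
  exists 0%N; rewrite /ok (leq_trans _ P40) //= /X add0r; apply: le_trans y1.
  apply: le_trans (_ : (41 / 40 * P%:R) ^+ 3 <= _); first by rewrite lerXn2r ?nnegrE //; lra.
  rewrite exprMn ler_wpM2r ?exprn_ge0 //; lra.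
have okP i : ok i -> (i <= P)%N by move=> /andP[/ltnW].
case: (ex_maxnP ok0 okP) => m /andP[mP Xm] mmax.
have Xp i : 0 <= X i by rewrite /X; have : 0 <= i%:R :> R by []; lra.
have Xhi : y < X m.+1 ^+ 3.
  have [mP1|mP1] := ltnP m.+1 P.
    rewrite ltNge; apply/negP => h; have := mmax m.+1; rewrite /ok mP1 h => /(_ isT).
    by rewrite ltnn.
  have mE : m.+1%:R = P%:R :> R by congr (_%:R); apply/eqP; rewrite eqn_leq mP.
  have P30 : 0 < P%:R ^+ 3 :> R by rewrite exprn_gt0 //; lra.
  apply: lt_le_trans (_ : (2 * P%:R) ^+ 3 <= _).
    by apply: le_lt_trans y2 _; rewrite exprMn; lra.
  by rewrite lerXn2r ?nnegrE ?Xp //; rewrite ?mulr_ge0 // /X mE; lra.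
have mL : (L <= m)%N.
  rewrite leqNgt; apply/negP => mL.
  have mR : m.+1%:R <= L%:R :> R by rewrite ler_nat.
  have : X m.+1 ^+ 3 <= (11 / 10 * P%:R) ^+ 3.
    by rewrite lerXn2r ?nnegrE ?Xp //; rewrite ?mulr_ge0 ?divr_ge0 // /X; lra.
  rewrite exprMn; have : 0 < P%:R ^+ 3 :> R by rewrite exprn_gt0 //; lra.
  lra.
have step (a b : R) : 0 <= a <= b -> b <= 2 * P%:R -> b ^+ 3 - a ^+ 3 <= (b - a) * (12 * P%:R ^+ 2).
  move=> /andP[a0 ab] bP; have := @exprB_le R b a 3; rewrite a0 ab => /(_ isT) h.
  apply: le_trans h _; rewrite ler_wpM2l ?subr_ge0 //=.
  have : b ^+ 2 <= (2 * P%:R) ^+ 2 by rewrite lerXn2r ?nnegrE //; lra.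
  rewrite exprMn; lra.
exists (m - L).+1 => [|j /andP[j1 j2]]; first by lia.
have jm : (j <= m)%N by lia.
have jL : (m.+1 <= j + L)%N by lia.
have jR : j%:R <= m%:R :> R by rewrite ler_nat.
have jLR : m%:R + 1 <= j%:R + L%:R :> R by rewrite natr1 -natrD ler_nat.
have mPR : m%:R + 1 <= P%:R :> R by rewrite natr1 ler_nat.
have m1 : X m.+1 = m%:R + 1 + (P%:R + t) by rewrite /X natr1.
have P2 : 0 <= P%:R ^+ 2 :> R by rewrite sqr_ge0.
have P3 : P%:R ^+ 3 = P%:R * P%:R ^+ 2 :> R by rewrite [LHS]exprS.
rewrite -/(X j).
have jmX : X j ^+ 3 <= X m ^+ 3 by rewrite lerXn2r ?nnegrE ?Xp // /X; lra.
have up : X j ^+ 3 <= y by exact: le_trans Xm.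
(* If the last index is P - 1, the next point may exceed 2 P, where the slope bound fails; since y
   <= 7 P^3 < 8 P^3, the point 2 P replaces it. *)
have [Xb|Xb] := leP (X m.+1) (2 * P%:R).
  have := step (X j) (X m.+1); rewrite Xp /= => h.
  have {h} := h ltac:(by rewrite /X -natr1; lra) Xb.
  have : (X m.+1 - X j) * (12 * P%:R ^+ 2) <= L%:R * (12 * P%:R ^+ 2).
    by rewrite ler_wpM2r ?mulr_ge0 // m1 /X; lra.
  rewrite ler_norml; lra.
have yb : y <= (2 * P%:R) ^+ 3.
  apply: le_trans y2 _; rewrite exprMn; have : 0 <= P%:R ^+ 3 :> R by rewrite exprn_ge0.
  lra.
have := step (X j) (2 * P%:R); rewrite Xp /= lexx => h.
have {h} := h ltac:(by rewrite /X; lra) isT.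
have : (2 * P%:R - X j) * (12 * P%:R ^+ 2) <= L%:R * (12 * P%:R ^+ 2).
  by rewrite ler_wpM2r ?mulr_ge0 // /X; move: Xb; rewrite m1; lra.
rewrite ler_norml; lra.
Qed.

Variables t1 t2 t3 t4 t5 C0 : R.
Hypotheses (t1b : 0 <= t1 <= 1) (t2b : 0 <= t2 <= 1) (t3b : 0 <= t3 <= 1).
Hypotheses (t4b : 0 <= t4 <= 1) (t5b : 0 <= t5 <= 1) (C00 : 0 <= C0).
Local Notation F5 := (@cube5 R t1 t2 t3 t4 t5 C0 _ _).

Lemma sum_box_lower (P Q m : nat) (g : box P Q -> R) (B : R) : (m <= P)%N -> 0 <= B ->
  (forall x, 0 <= g x) ->
  (forall (a b c : 'I_P) (k : 'I_Q), (a < m)%N -> (b < m)%N -> (c < m)%N ->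
     B <= \sum_(i < P) g ((a, k), (b, c, i))) ->
  m%:R ^+ 3 * Q%:R * B <= \sum_x g x.
Proof.
move=> mP B0 g0 hB.
have cnt (V : R) : \sum_(a < P | (a < m)%N) V = m%:R * V.
  by rewrite -(big_ord_widen _ (fun=> V) mP) sumr_const card_ord mulr_natl.
have -> : \sum_x g x = \sum_(a < P) \sum_(k < Q) \sum_(v : 'I_P * 'I_P * 'I_P) g ((a, k), v).
  by rewrite pair_big /= pair_big /=; apply: eq_bigr => -[[a k] v].
have s0 (a : 'I_P) : 0 <= \sum_k \sum_v g ((a, k), v).
  by apply: sumr_ge0 => k _; apply: sumr_ge0.
rewrite [leRHS](bigID (fun a : 'I_P => (a < m)%N)) /= -[leLHS]addr0.
apply: lerD; last by apply: sumr_ge0 => a _; exact: s0.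
have -> : m%:R ^+ 3 * Q%:R * B = m%:R * (Q%:R * (m%:R * (m%:R * B))) by ring.
rewrite -cnt; apply: ler_sum => a am.
have -> : Q%:R * (m%:R * (m%:R * B)) = \sum_(k < Q) m%:R * (m%:R * B).
  by rewrite sumr_const card_ord mulr_natl.
apply: ler_sum => k _.
have -> : \sum_(v : 'I_P * 'I_P * 'I_P) g ((a, k), v) =
    \sum_(b < P) \sum_(c < P) \sum_(i < P) g ((a, k), (b, c, i)).
  by rewrite pair_big /= pair_big /=; apply: eq_bigr => -[[b c] i].
rewrite [leRHS](bigID (fun b : 'I_P => (b < m)%N)) /= -[leLHS]addr0.
apply: lerD; last by apply: sumr_ge0 => b _; apply: sumr_ge0 => c _; apply: sumr_ge0.
rewrite -cnt; apply: ler_sum => b bm.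
rewrite [leRHS](bigID (fun c : 'I_P => (c < m)%N)) /= -[leLHS]addr0.
apply: lerD; last by apply: sumr_ge0 => c _; apply: sumr_ge0.
rewrite -cnt; apply: ler_sum => c cm.
exact: hB.
Qed.

Lemma divn_lower (P n : nat) : (0 < n <= P)%N -> P%:R / (2 * n%:R) <= (P %/ n)%:R :> R.
Proof.
move=> /andP[n0 nP]; have np : 0 < n%:R :> R by rewrite ltr0n.
rewrite ler_pdivrMr ?mulr_gt0 // -natrM -natrM ler_nat.
have d1 : (0 < P %/ n)%N by rewrite divn_gt0.
rewrite mulnCA mul2n -addnn {1}(divn_eq P n) leq_add2l.
by apply: leq_trans (ltnW (ltn_pmod P n0)) _; exact: leq_pmull.
Qed.

Lemma mul20_le (L k P : nat) : (7 <= k)%N -> (L * (3 * k) <= P)%N -> (20 * L <= P)%N.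
Proof.
move=> k7; apply: leq_trans; rewrite mulnC leq_mul2l; apply/orP; right.
by apply: (@leq_trans (3 * 7)); rewrite // leq_mul2l k7.
Qed.

(** As (11/10)^3 <= 4/3, the three cubes total between 3 p3 and 4 p3, and the remaining terms at
    most p3 / 50. From [6 p3, 10 p3] this leaves the range required by [cube_run]. *)
Lemma window_bounds (p2 p3 tau A B C K : R) : 0 <= p3 -> 100 * p2 <= p3 -> 100 * C0 <= p3 ->
  6 * p3 <= tau -> tau <= 10 * p3 ->
  p3 <= A -> A <= (11 / 10) ^+ 3 * p3 -> p3 <= B -> B <= (11 / 10) ^+ 3 * p3 ->
  p3 <= C -> C <= (11 / 10) ^+ 3 * p3 -> 0 <= K -> K <= p2 ->
  3 / 2 * p3 <= tau - (A + K + (B + C) + C0) <= 7 * p3.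
Proof.
have h : (11 / 10) ^+ 3 <= 4 / 3 :> R by lra.
move=> p30 h2 hC t6 t10 A1 A2 B1 B2 D1 D2 K1 K2; have h3 := ler_wpM2r p30 h.
have A3 := le_trans A2 h3; have B3 := le_trans B2 h3; have D3 := le_trans D2 h3.
clear A2 B2 D2 h3 h; have c0 := C00.
by apply/andP; split; lra.
Qed.

(** The constant must be independent of [k0], which is chosen later in terms of it. The run of the
    fifth variable has length about P / (3 k0), each kernel value on it is at least k0 / 4, and [k0]
    cancels. *)
Lemma wide_lower : exists2 c : R, 0 < c & forall k0 : nat, (7 <= k0)%N ->
  exists p0 : nat, forall P Q D : nat, (p0 <= P)%N -> (Q ^ 3 <= P ^ 2)%N -> D = (81 * P ^ 3)%N ->
  forall tau : R, 6 * P%:R ^+ 3 <= tau <= 10 * P%:R ^+ 3 ->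
  c * #|box P Q|%:R <= \sum_(x : box P Q) fejer k0 ((F5 x - tau) / D%:R).
Proof.
(* Three long variables keep at least P / 20 values each, the short one all of its Q values, and the
   fifth contributes P / 24. *)
exists ((20 * 20 * 20 * 24)^-1); first by rewrite invr_gt0 !mulr_gt0.
move=> k0 k7; have k00 : (0 < k0)%N by exact: leq_trans k7.
have kp : 7 <= k0%:R :> R by rewrite (ler_nat _ 7).
exists (maxn 100 (maxn (3 * k0) (Num.truncn (100 * C0)).+1)) => P Q D.
rewrite !geq_max => /andP[P100 /andP[Pk PC]] PQ DE tau /andP[tau1 tau2].
have Pr : 100 <= P%:R :> R by rewrite (ler_nat _ 100).
have P0 : (0 < P)%N by exact: leq_trans P100.
have Pp : 0 < P%:R :> R by rewrite ltr0n.
pose m := (P %/ 10)%N; pose L := (P %/ (3 * k0))%N.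
have mP : (m <= P)%N by exact: leq_div.
have mR : P%:R / 20 <= m%:R :> R.
  have := @divn_lower P 10; rewrite (leq_trans _ P100) // => /(_ isT).
  by rewrite (_ : 2 * 10 = 20 :> R) //; ring.
have m10 : 10 * m%:R <= P%:R :> R by rewrite -natrM ler_nat mulnC leq_divM.
have LR : P%:R / (6 * k0%:R) <= L%:R :> R.
  have := @divn_lower P (3 * k0); rewrite Pk andbT muln_gt0 k00 => /(_ isT).
  by rewrite natrM (_ : 2 * (3 * k0%:R) = 6 * k0%:R :> R) //; ring.
have L3 : 3 * k0%:R * L%:R <= P%:R :> R by rewrite -!natrM ler_nat mulnC leq_divM.
have L20 : (20 * L <= P)%N.
  by apply: (mul20_le k7); exact: leq_divM.
have DR : D%:R = 81 * P%:R ^+ 3 :> R by rewrite DE natrM natrX.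
have P3 : 0 < P%:R ^+ 3 :> R by rewrite exprn_gt0.
have Dp : 0 < D%:R :> R by rewrite DR mulr_gt0.
have C0P : 100 * C0 <= P%:R ^+ 3.
  apply: le_trans (_ : P%:R <= _); last by rewrite -{1}[P%:R]expr1 ler_weXn2l //; lra.
  have h0 : 0 <= 100 * C0 by rewrite mulr_ge0.
  by apply: le_trans (ltW (truncn_lt h0)) _; rewrite ler_nat.
have P23 : 100 * P%:R ^+ 2 <= P%:R ^+ 3 :> R.
  by rewrite [leRHS]exprS ler_wpM2r // sqr_ge0.
have inner (a b c : 'I_P) (k : 'I_Q) : (a < m)%N -> (b < m)%N -> (c < m)%N ->
   L%:R * (k0%:R / 4) <= \sum_(i < P) fejer k0 ((@cube5 R t1 t2 t3 t4 t5 C0 P Q ((a, k), (b, c, i)) - tau) / D%:R).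
  move=> am bm cm.
  have cb (n : 'I_P) (t : R) : (n < m)%N -> 0 <= t <= 1 ->
      P%:R ^+ 3 <= (n%:R + (P%:R + t)) ^+ 3 <= (11 / 10) ^+ 3 * P%:R ^+ 3.
    move=> nm /andP[u0 u1]; have n0 : 0 <= n%:R :> R by [].
    have n1 : n%:R + 1 <= m%:R :> R by rewrite natr1 ler_nat.
    by rewrite -exprMn; apply/andP; split; rewrite lerXn2r ?nnegrE //; lra.
  have kb : 0 <= (k%:R + t2) ^+ 3 <= P%:R ^+ 2.
    have /andP[u0 u1] := t2b; have k0' : 0 <= k%:R :> R by [].
    have kQ : k%:R + 1 <= Q%:R :> R by rewrite natr1 ler_nat.
    rewrite exprn_ge0 /=; last by lra.
    apply: le_trans (_ : Q%:R ^+ 3 <= _); first by rewrite lerXn2r ?nnegrE //; lra.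
    by rewrite -!natrX ler_nat.
  have /andP[a1 a2] := cb a t1 am t1b; have /andP[b1 b2] := cb b t3 bm t3b.
  have /andP[c1 c2] := cb c t4 cm t4b; have /andP[d1 d2] := kb.
  pose r := (a%:R + (P%:R + t1)) ^+ 3 + (k%:R + t2) ^+ 3
    + ((b%:R + (P%:R + t3)) ^+ 3 + (c%:R + (P%:R + t4)) ^+ 3) + C0.
  have yb : 3 / 2 * P%:R ^+ 3 <= tau - r <= 7 * P%:R ^+ 3.
    exact: (window_bounds (ltW P3) P23 C0P).
  have [s sL hs] := cube_run (leq_trans (isT : (40 <= 100)%N) P100) t5b yb L20 (lexx _).
  pose G (n : nat) := fejer k0 ((r + (n%:R + (P%:R + t5)) ^+ 3 - tau) / D%:R).
  have -> : \sum_(i < P) fejer k0 ((@cube5 R t1 t2 t3 t4 t5 C0 P Q ((a, k), (b, c, i)) - tau) / D%:R)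
     = \sum_(0 <= n < P) G n.
    rewrite big_mkord; apply: eq_bigr => i _; rewrite /G /r /cube5 /=; congr (fejer _ (_ / _)); ring.
  rewrite (@big_cat_nat _ _ _ s) //=; last by apply: leq_trans sL; exact: leq_addr.
  rewrite [X in _ + X](@big_cat_nat _ _ _ (s + L)) ?leq_addr //=.
  have G0 n : 0 <= G n by exact: fejer_ge0.
  have n1 : 0 <= \sum_(0 <= n < s) G n by apply: sumr_ge0.
  have n2 : 0 <= \sum_(s + L <= n < P) G n by apply: sumr_ge0.
  suff : L%:R * (k0%:R / 4) <= \sum_(s <= n < s + L) G n by lra.
  apply: le_trans (_ : \sum_(s <= n < s + L) (k0%:R / 4) <= _).
    by rewrite sumr_const_nat addnC addnK mulr_natl.
  apply: ler_sum_nat => n hn; apply: fejer_ge => //.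
  have e1 : r + (n%:R + (P%:R + t5)) ^+ 3 - tau = (n%:R + (P%:R + t5)) ^+ 3 - (tau - r) by ring.
  rewrite e1 normrM normfV (ger0_norm (ltW Dp)) mulrAC ler_pdivrMr // mul1r DR.
  apply: le_trans (ler_wpM2r _ (hs n hn)) _; first by rewrite mulr_ge0.
  (* 16 * 12 = 64 * 3 and 3 k0 L <= P, so the condition of [fejer_ge] reduces to 64 < 81. *)
  have e2 : 12 * L%:R * P%:R ^+ 2 * (16 * k0%:R) = 64 * (3 * k0%:R * L%:R) * P%:R ^+ 2 :> R by ring.
  have : 3 * k0%:R * L%:R * P%:R ^+ 2 <= P%:R * P%:R ^+ 2 :> R by rewrite ler_wpM2r // sqr_ge0.
  by rewrite -exprS e2; lra.
have k04 : 0 <= L%:R * (k0%:R / 4) :> R by rewrite mulr_ge0 // divr_ge0.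
apply: le_trans (sum_box_lower mP k04 _ inner); last by move=> x; exact: fejer_ge0.
rewrite card_boxR.
have l1 : P%:R / 24 <= L%:R * (k0%:R / 4) :> R.
  have : P%:R / (6 * k0%:R) * (k0%:R / 4) <= L%:R * (k0%:R / 4) :> R.
    by rewrite ler_wpM2r // divr_ge0.
  by rewrite (_ : P%:R / (6 * k0%:R) * (k0%:R / 4) = P%:R / 24 :> R) //; field; lra.
have l2 : (P%:R / 20) ^+ 3 <= m%:R ^+ 3 :> R by rewrite lerXn2r ?nnegrE // divr_ge0.
have -> : (20 * 20 * 20 * 24)^-1 * (P%:R * Q%:R * (P%:R * P%:R * P%:R)) =
   (P%:R / 20) ^+ 3 * Q%:R * (P%:R / 24) :> R by field.
apply: ler_pM; rewrite ?mulr_ge0 ?exprn_ge0 ?divr_ge0 //.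
by rewrite ler_wpM2r.
Qed.

End Wide.

(** * Bad grid points in one window *)

Section Window.
Variable R : realType.
Variables t1 t2 t3 t4 t5 C0 : R.
Hypotheses (it1 : irr t1) (t1b : 0 <= t1 <= 1) (t2b : 0 <= t2 <= 1) (t3b : 0 <= t3 <= 1).
Hypotheses (t4b : 0 <= t4 <= 1) (t5b : 0 <= t5 <= 1) (C00 : 0 <= C0).
Local Notation F5 := (@cube5 R t1 t2 t3 t4 t5 C0 _ _).

(** Four long cubes of at most 8 P^3 and a short one make 33 P^3. Once C0 <= P^3, differences with
    points up to 10 P^3 stay below D / 2 = 81 P^3 / 2, so the kernels of period D see no
    wrap-around. *)
Lemma cube5_bounds (P Q : nat) (x : box P Q) : (0 < P)%N -> (Q ^ 3 <= P ^ 2)%N ->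
  0 <= F5 x <= 33 * P%:R ^+ 3 + C0.
Proof.
move=> P0 PQ; case: x => [[a k] [[b c] d]]; rewrite /cube5 /=.
have P1 : 1 <= P%:R :> R by rewrite ler1n.
have cb (n : 'I_P) (t : R) : 0 <= t <= 1 -> 0 <= (n%:R + (P%:R + t)) ^+ 3 <= 8 * P%:R ^+ 3.
  move=> /andP[u0 u1]; have n0 : 0 <= n%:R :> R by [].
  have n1 : n%:R + 1 <= P%:R :> R by rewrite natr1 ler_nat.
  have -> : 8 * P%:R ^+ 3 = (2 * P%:R) ^+ 3 :> R by rewrite exprMn; congr (_ * _); ring.
  by rewrite exprn_ge0 /=; [rewrite lerXn2r ?nnegrE //; lra | lra].
have kb : 0 <= (k%:R + t2) ^+ 3 <= P%:R ^+ 3.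
  have /andP[u0 u1] := t2b; have k0' : 0 <= k%:R :> R by [].
  have kQ : k%:R + 1 <= Q%:R :> R by rewrite natr1 ler_nat.
  rewrite exprn_ge0 /=; last by lra.
  apply: le_trans (_ : Q%:R ^+ 3 <= _); first by rewrite lerXn2r ?nnegrE //; lra.
  by rewrite -!natrX ler_nat (leq_trans PQ) // leq_pexp2l.
move: (cb a t1 t1b) (cb b t3 t3b) (cb c t4 t4b) (cb d t5 t5b) kb.
move: ((a%:R + (P%:R + t1)) ^+ 3) ((b%:R + (P%:R + t3)) ^+ 3) ((c%:R + (P%:R + t4)) ^+ 3)
  ((d%:R + (P%:R + t5)) ^+ 3) ((k%:R + t2) ^+ 3) (P%:R ^+ 3) => u v w y z p3.
move=> /andP[u1 u2] /andP[v1 v2] /andP[w1 w2] /andP[y1 y2] /andP[z1 z2].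
have c0 := C00; by apply/andP; split; lra.
Qed.

(** Parameters are fixed in the order c, L, A, k0, p. L >= 144 / (c eps) keeps the tail 72 M / L
    below c eps M / 2; A makes L grid steps, of length 1 / (2 (A + 1)) whatever [p] is, fit in
    [eta]; the energy with c eps / 4 accounts for the other half. *)
Lemma count_bad (eta eps : R) : 0 < eta -> 0 < eps ->
  exists A p0 : nat, ((2 * A.+1%:R)^-1 : R) <= eta /\
  forall p P Q D K M : nat, (p0 <= p)%N ->
  P = (p ^ 120)%N -> Q = (p ^ 80)%N -> D = (81 * P ^ 3)%N -> K = (A.+1 * D)%N -> M = (2 * K)%N ->
  forall Z : {set 'I_M},
  (forall j : 'I_M, j \in Z ->
     ((6 * P%:R ^+ 3 : R) <= (j%:R : R) * (D%:R / M%:R) <= (10 * P%:R ^+ 3 : R)) /\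
     (forall x : box P Q, eta <= `|F5 x - (j%:R : R) * (D%:R / M%:R)|)) ->
  (#|Z|%:R : R) <= eps * M%:R.
Proof.
move=> eta0 eps0; have [c c0 hc] := wide_lower t1b t2b t3b t4b t5b C00.
have ce : 0 < c * eps by rewrite mulr_gt0.
have h0 : 0 <= 144 / (c * eps) by rewrite divr_ge0 // ltW.
have [L [L0 hL]] : exists L : nat, (0 < L)%N /\ 144 / (c * eps) <= L%:R.
  by exists (Num.truncn (144 / (c * eps))).+1; split => //; exact: ltW (truncn_lt h0).
have Lp : 0 < L%:R :> R by rewrite ltr0n.
have h1 : 0 <= L%:R / (2 * eta) by rewrite divr_ge0 ?mulr_ge0 // ltW.
have [A hA] : exists A : nat, L%:R / (2 * eta) <= A.+1%:R.
  by exists (Num.truncn (L%:R / (2 * eta))); exact: ltW (truncn_lt h1).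
have Ap : 0 < A.+1%:R :> R by rewrite ltr0n.
have LA : L%:R <= eta * (2 * A.+1%:R).
  by move: hA; rewrite ler_pdivrMr ?mulr_gt0 // => h; apply: le_trans h _; rewrite (_ : _ * (2 * eta) = eta * (2 * A.+1%:R)) //; ring.
have e0 : 0 < c * eps / 4 by rewrite divr_gt0.
have [k0 [k00 [k7 [p1 hE]]]] := energy t3 t4 t5 C0 it1 t1b t2b A 7 e0.
have [p2 hW] := hc k0 k7.
have C1 : 0 <= C0 by [].
exists A, (maxn 1 (maxn p1 (maxn p2 (Num.truncn C0).+1))); split.
  rewrite -[leLHS]mul1r ler_pdivrMr ?mulr_gt0 //; apply: le_trans LA; by rewrite ler1n.
move=> p P Q D K M; rewrite !geq_max => /andP[p0 /andP[pp1 /andP[pp2 pC]]] PE QE DE KE ME Z hZ.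
have pP : (p <= P)%N by rewrite PE -{1}[p]expn1 leq_pexp2l.
have P0 : (0 < P)%N by exact: leq_trans pP.
have Q0 : (0 < Q)%N by rewrite QE expn_gt0 p0.
have Pp : 1 <= P%:R :> R by rewrite ler1n.
have PQ : (Q ^ 3 <= P ^ 2)%N by rewrite PE QE -!expnM.
have D0 : (0 < D)%N by rewrite DE muln_gt0 expn_gt0 P0.
have K0 : (0 < K)%N by rewrite KE muln_gt0 D0.
have Dp : 0 < D%:R :> R by rewrite ltr0n.
have Kp : 0 < K%:R :> R by rewrite ltr0n.
have DR : D%:R = 81 * P%:R ^+ 3 :> R by rewrite DE natrM natrX.
have KR : K%:R = A.+1%:R * D%:R :> R by rewrite KE natrM.
have MR : M%:R = 2 * K%:R :> R by rewrite ME natrM.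
have P3 : P%:R <= P%:R ^+ 3 :> R by rewrite -{1}[P%:R]expr1 ler_weXn2l.
have CP : C0 <= P%:R ^+ 3.
  apply: le_trans P3; apply: le_trans (ltW (truncn_lt C1)) _.
  by rewrite ler_nat (leq_trans pC).
have [kK eB] := hE p P Q D K pp1 PE QE DE KE.
have kK' : (0 < k0 <= K)%N by rewrite k00.
have KM : (K <= M)%N by rewrite ME leq_pmull.
have X0 : (0 < #|box P Q|)%N by rewrite !card_prod !card_ord !muln_gt0 P0 Q0.
have dE : D%:R / M%:R = (2 * A.+1%:R)^-1 :> R.
  by rewrite MR KR; field; rewrite !gt_eqF.
have LD : L%:R * (D%:R / M%:R) <= eta by rewrite dE ler_pdivrMr ?mulr_gt0.
have hZ1 (j : 'I_M) (x : box P Q) : j \in Z ->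
    eta <= `|F5 x - j%:R * (D%:R / M%:R)| <= D%:R / 2.
  move=> jZ; have [/andP[a1 a2] hx] := hZ j jZ; rewrite hx /=.
  have /andP[b1 b2] := cube5_bounds x P0 PQ.
  move: b1 b2 a1 a2; move: (F5 x) (j%:R * _) => F y b1 b2 a1 a2.
  move: CP P3 Pp b1 b2 a1 a2; rewrite DR; move: (P%:R ^+ 3) => p3 CP P3 Pp b1 b2 a1 a2.
  by rewrite ler_norml; apply/andP; split; lra.
have hZ2 (j : 'I_M) : j \in Z ->
    c * #|box P Q|%:R <= \sum_(x : box P Q) fejer k0 ((F5 x - j%:R * (D%:R / M%:R)) / D%:R).
  move=> jZ; have [hj _] := hZ j jZ.
  by apply: hW => //; exact: leq_trans pP.
have := @detection R _ (fun x => F5 x) D K k0 M L Z c eta _ kK' KM D0 L0 X0 (ltW e0) LD hZ1 hZ2 eB.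
have -> : 36 * M%:R ^+ 2 / (K%:R * L%:R) + 2 * (c * eps / 4) * M%:R =
   (72 / L%:R + c * eps / 2) * M%:R :> R by rewrite MR; field; rewrite !gt_eqF.
have t1' : 72 / L%:R <= c * eps / 2.
  rewrite ler_pdivrMr //; move: hL; rewrite ler_pdivrMr // => hL; lra.
move=> h; rewrite -(ler_pM2l c0); apply: le_trans h _; rewrite mulrA.
by apply: ler_wpM2r => //; lra.
Qed.

End Window.

(** * From the grid to Lebesgue measure *)

Local Open Scope classical_set_scope.

Section Measure.
Variable R : realType.

Definition far (V : set R) (eta : R) : set R := [set tau | forall v, V v -> eta <= `|v - tau|].

(** The complement is a union of open balls, hence open whatever [V] is. *)
Lemma measurable_far (V : set R) (eta : R) : measurable (far V eta).
Proof.
have -> : far V eta = ~` (\bigcup_(v in V) ball v eta).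
  apply/seteqP; split => [tau h [v Vv]|tau h v Vv]; rewrite -?ball_normE /=.
    by apply/negP; rewrite -leNgt; exact: h.
  by rewrite leNgt; apply/negP => hv; apply: h; exists v => //; rewrite -ball_normE.
by apply: measurableC; apply: measurable_realfun.open_measurable; apply: bigcup_open => v _; exact: ball_open.
Qed.

Lemma measure_grid_cover (E : set R) (s : seq nat) (d : R) : measurable E -> 0 <= d ->
  (forall tau, E tau -> exists2 j, j \in s & j%:R * d <= tau <= j%:R * d + d) ->
  (lebesgue_measure E <= ((size s)%:R * d)%:E)%E.
Proof.
move=> mE d0 hE.
pose F (k : nat) : set R := `[(nth 0%N s k)%:R * d, (nth 0%N s k)%:R * d + d].
have mF k : `I_(size s) k -> measurable (F k) by move=> _; exact: measurable_itv.
have EF : E `<=` \big[setU/set0]_(k < size s) F k.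
  move=> tau /hE[j js jt]; rewrite -bigcup_mkord; exists (index j s) => /=.
    by rewrite index_mem.
  by rewrite /F nth_index //= in_itv.
apply: le_trans (content_subadditive (@lebesgue_measure R) mF mE EF) _.
have -> : ((size s)%:R * d)%:E = (\sum_(k < size s) d%:E)%E.
  by rewrite sumEFin sumr_const card_ord mulr_natl.
have hF k : (lebesgue_measure (F k) <= d%:E)%E.
  rewrite /F lebesgue_measure_itv /= lte_fin.
  by case: ifP => _; rewrite -?EFinD lee_fin // addrAC subrr add0r.
by apply: lee_sum => k _; exact: hF.
Qed.

Lemma bernoulli_le (k : nat) (x : R) : 0 <= x <= 1 -> 1 - k%:R * x <= (1 - x) ^+ k.
Proof.
move=> /andP[x0 x1]; elim: k => [|k IH]; first by rewrite expr0 mul0r subr0.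
rewrite exprS -natr1; have h : (1 - x) ^+ k <= 1 by rewrite exprn_ile1 //; lra.
have := ler_wpM2l x0 h; move: ((1 - x) ^+ k) (k%:R * x) IH (mulrDl k%:R 1 x) => u w IH -> {h} h; lra.
Qed.

Lemma exists_power_window (k p0 : nat) : (0 < k)%N ->
  exists Y : R, forall y : R, Y <= y ->
  exists2 p : nat, (p0 <= p)%N & y <= 10 * (p ^ k)%:R /\ 7 * (p ^ k)%:R <= 4 / 5 * y.
Proof.
move=> k0; pose m := maxn p0 (maxn 2 (8 * k)).
exists (10 * (m ^ k)%:R + 1) => y hy.
have mk0 : 0 <= (m ^ k)%:R :> R by [].
have y0 : 0 <= y by lra.
have ex : exists p : nat, y <= 10 * (p ^ k)%:R.
  exists (Num.truncn y).+1; apply: le_trans (ltW (truncn_lt y0)) _.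
  apply: le_trans (_ : (((Num.truncn y).+1 ^ k)%:R : R) <= _).
    by rewrite ler_nat -{1}[_.+1]expn1 leq_pexp2l.
  have : 0 <= (((Num.truncn y).+1 ^ k)%:R : R) by [].
  lra.
case: (ex_minnP ex) => p py pmin.
have mp : (m < p)%N.
  rewrite ltnNge; apply/negP => pm.
  have : ((p ^ k)%:R : R) <= (m ^ k)%:R by rewrite ler_nat leq_exp2r.
  lra.
have p0' : (p0 <= p)%N by apply: leq_trans (ltnW mp); exact: leq_maxl.
have p8 : (8 * k <= p)%N.
  by apply: leq_trans (ltnW mp); rewrite /m !leq_max leqnn !orbT.
have p2 : (1 < p)%N by apply: leq_trans (ltnW mp); rewrite /m !leq_max orbT.
exists p => //; split => //.
have hp : 10 * (p.-1 ^ k)%:R < y.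
  rewrite ltNge; apply/negP => h; have := pmin _ h.
  by rewrite leqNgt ltn_predL (ltnW p2).
have pp : 0 < p%:R :> R by rewrite ltr0n ltnW.
have x01 : 0 <= (p%:R : R)^-1 <= 1.
  by rewrite invr_ge0 ltW //= invf_le1 // ler1n ltnW.
have b := bernoulli_le k x01.
have e : 1 - (p%:R : R)^-1 = p.-1%:R / p%:R.
  by rewrite -{2}(ltn_predK p2) in pp *; rewrite -[in RHS](ltn_predK p2) /= -natr1; field; rewrite natr1 pnatr_eq0.
have kp : k%:R * (p%:R : R)^-1 <= 1 / 8.
  rewrite ler_pdivrMr //; have : (8 * k%:R : R) <= p%:R by rewrite -natrM ler_nat.
  lra.
have q : 7 / 8 <= (p.-1%:R / p%:R : R) ^+ k by rewrite -e; apply: le_trans b; lra.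
have pk : 0 < (p%:R : R) ^+ k by rewrite exprn_gt0.
move: q; rewrite expr_div_n ler_pdivlMr // -!natrX => q; lra.
Qed.

Lemma measure_itv0 (E : set R) (y : R) : measurable E -> 0 <= y ->
  (lebesgue_measure (E `&` `[0%R, y]) <= y%:E)%E.
Proof.
move=> mE y0; apply: le_trans (_ : lebesgue_measure (`[0%R, y] : set R) <= _)%E.
  by apply: le_measure; rewrite ?inE //; apply: measurableI => //; exact: measurable_itv.
by rewrite lebesgue_measure_itv /= lte_fin; case: ifP => _; rewrite -?EFinB lee_fin ?subr0.
Qed.

(** Induction down from y to 4 y / 5: the share e / 2 is reproduced because (4/5)(1/2) + 1/10 =
    1/2. *)
Lemma density_zero_of_windows (E : set R) : measurable E ->
  (forall e : R, 0 < e -> exists Y : R, forall y : R, Y <= y ->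
     (lebesgue_measure (E `&` `[(4 / 5 * y)%R, y]) <= (e * y)%:E)%E) ->
  forall e : R, 0 < e -> exists Y : R, forall y : R, Y <= y ->
     (lebesgue_measure (E `&` `[0%R, y]) <= (e * y)%:E)%E.
Proof.
move=> mE hE e e0; have [Y0 hY] := hE (e / 10) ltac:(lra).
(* From 5 on, passing to 4 y / 5 lowers y by at least 1, so induction on an integer above y
   suffices. *)
pose Y := Num.max 5 Y0.
have Y5 : 5 <= Y by rewrite le_max lexx.
have YY : Y0 <= Y by rewrite le_max lexx orbT.
have mI a b : measurable (E `&` `[a, b]) by apply: measurableI => //; exact: measurable_itv.
have claim n y : 0 <= y -> y <= n%:R ->
    (lebesgue_measure (E `&` `[0%R, y]) <= (Y + e / 2 * y)%:E)%E.
  elim: n y => [|n IH] y y0 yn.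
    by apply: le_trans (measure_itv0 mE y0) _; rewrite lee_fin; nra.
  have [yY|yY] := leP y Y.
    by apply: le_trans (measure_itv0 mE y0) _; rewrite lee_fin; nra.
  have y45 : 4 / 5 * y <= n%:R by move: yn; rewrite -natr1; lra.
  have h1 := IH (4 / 5 * y) ltac:(lra) y45.
  have h2 := hY y ltac:(lra).
  have -> : (Y + e / 2 * y)%:E = ((Y + e / 2 * (4 / 5 * y))%:E + (e / 10 * y)%:E)%E.
    by rewrite -EFinD; congr (_%:E); field.
  apply: le_trans (leeD h1 h2).
  pose F (k : nat) : set R := if k == 0%N then E `&` `[0, 4 / 5 * y] else E `&` `[4 / 5 * y, y].
  have mF k : `I_2 k -> measurable (F k) by rewrite /F; case: ifP => _ _; exact: mI.
  have -> : (lebesgue_measure (E `&` `[0%R, (4 / 5 * y)%R]) +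
      lebesgue_measure (E `&` `[(4 / 5 * y)%R, y]) =
      \sum_(k < 2) lebesgue_measure (F k))%E by rewrite !big_ord_recl big_ord0 adde0.
  apply: (content_subadditive (@lebesgue_measure R) mF (mI _ _)).
  rewrite !big_ord_recl big_ord0 setU0 /F /= => t [Et]; rewrite /= !in_itv /= => /andP[t0 ty].
  by have [h|h] := leP t (4 / 5 * y); [left; rewrite t0 | right; rewrite ty (ltW h)].
exists (2 * Y / e) => y hy.
have y0 : 0 <= y by apply: le_trans hy; rewrite divr_ge0 //; lra.
apply: le_trans (claim _ y y0 (ltW (truncn_lt y0))) _.
by rewrite lee_fin; move: hy; rewrite ler_pdivrMr //; lra.
Qed.

(** Rounding tau down to the grid moves it by at most d <= eta / 2, so it lands on a grid point bad
    for eta / 2. The window lies in [7 P^3, 10 P^3], and P^3 >= 1 >= d leaves room for the rounding.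
    The measure is at most (e / 10) 81 P^3 <= e y. *)
Lemma far_window (t1 t2 t3 t4 t5 C0 : R) (V : set R) (eta : R) :
  irr t1 -> 0 <= t1 <= 1 -> 0 <= t2 <= 1 -> 0 <= t3 <= 1 -> 0 <= t4 <= 1 -> 0 <= t5 <= 1 ->
  0 <= C0 -> 0 < eta -> (forall P Q (x : box P Q), V (cube5 t1 t2 t3 t4 t5 C0 x)) ->
  forall e : R, 0 < e -> exists Y : R, forall y : R, Y <= y ->
    (lebesgue_measure (far V eta `&` `[(4 / 5 * y)%R, y]) <= (e * y)%:E)%E.
Proof.
move=> it1 t1b t2b t3b t4b t5b C00 eta0 hV e e0.
have [A [p0 [hA hb]]] :=
  count_bad it1 t1b t2b t3b t4b t5b C00 (eta := eta / 2) (eps := e / 10) ltac:(lra) ltac:(lra).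
have [Y hY] := @exists_power_window (120 * 3) (maxn 1 p0) isT.
exists Y => y /hY[p]; rewrite geq_max => /andP[p1 pp].
rewrite expnM => -[y10 y7].
have [P PE] : exists P, P = (p ^ 120)%N by eexists.
have [Q QE] : exists Q, Q = (p ^ 80)%N by eexists.
rewrite -PE natrX in y10 y7.
have P0 : (0 < P)%N by rewrite PE expn_gt0 p1.
have [D DE] : exists D, D = (81 * P ^ 3)%N by eexists.
have [K KE] : exists K, K = (A.+1 * D)%N by eexists.
have [M ME] : exists M, M = (2 * K)%N by eexists.
have D0 : (0 < D)%N by rewrite DE muln_gt0 expn_gt0 P0.
have M0 : (0 < M)%N by rewrite ME KE !muln_gt0 D0.
have Mp : 0 < M%:R :> R by rewrite ltr0n.
have Dp : 0 < D%:R :> R by rewrite ltr0n.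
have DR : D%:R = 81 * P%:R ^+ 3 :> R by rewrite DE natrM natrX.
have Ap : 0 < A.+1%:R :> R by rewrite ltr0n.
have [d dE] : exists d : R, d = D%:R / M%:R by eexists.
have dA : d = (2 * A.+1%:R)^-1.
  by rewrite dE ME KE !natrM; field; rewrite !gt_eqF.
have d0 : 0 < d by rewrite dE divr_gt0.
have deta : d <= eta / 2 by rewrite dA.
have d1 : d <= 1.
  by rewrite dA invf_le1 ?mulr_gt0 //; have : 1 <= A.+1%:R :> R by [rewrite ler1n]; lra.
have P3 : 1 <= P%:R ^+ 3 :> R by rewrite exprn_ege1 // ler1n.
have Md : M%:R * d = 81 * P%:R ^+ 3 by rewrite dE -DR mulrC divfK // gt_eqF.
pose ok (j : 'I_M) := ((6 * P%:R ^+ 3 : R) <= j%:R * d <= 10 * P%:R ^+ 3) &&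
  `[< forall x : box P Q, eta / 2 <= `|cube5 t1 t2 t3 t4 t5 C0 x - j%:R * d| >].
pose Z : {set 'I_M} := [set j | ok j]%SET.
have cZ : #|Z|%:R <= e / 10 * M%:R.
  apply: (hb p P Q D K M pp PE QE DE KE ME Z) => j.
  by rewrite inE /ok dE => /andP[h1 /asboolP h2].
apply: le_trans (measure_grid_cover (s := [seq val j | j <- enum Z]) (d := d) _ (ltW d0) _) _.
- by apply: measurableI; [exact: measurable_far | exact: measurable_itv].
- move=> tau [ft]; rewrite /= in_itv /= => /andP[tau1 tau2].
  have tau0 : 0 <= tau by lra.
  have q0 : 0 <= tau / d by rewrite divr_ge0 // ltW.
  have [j jE] : exists j, j = Num.truncn (tau / d) by eexists.
  have j1 : j%:R * d <= tau.
    by rewrite -ler_pdivlMr // jE truncn_le.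
  have j2 : tau < j%:R * d + d.
    have := truncn_lt q0; rewrite -jE ltr_pdivrMr // -natr1 mulrDl mul1r; exact.
  have jM : (j < M)%N.
    rewrite -(ltr_nat R) -(ltr_pM2r d0) Md; lra.
  exists j; last by rewrite j1 ltW.
  have -> : j = val (Ordinal jM) by [].
  apply: map_f; rewrite mem_enum inE /ok /=; apply/andP; split.
    by apply/andP; split; lra.
  apply/asboolP => x; have := ft _ (hV P Q x).
  move: (cube5 _ _ _ _ _ _ _) => F; rewrite !ler_normr => /orP[h|h]; apply/orP; [left|right]; lra.
rewrite size_map -cardE lee_fin.
apply: le_trans (_ : e / 10 * M%:R * d <= _); first by rewrite ler_wpM2r // ltW.
rewrite -mulrA Md; have : e * (7 * P%:R ^+ 3) <= e * (4 / 5 * y) by rewrite ler_wpM2l // ltW.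
have : 0 <= e * y by rewrite mulr_ge0 //; lra.
move: (P%:R ^+ 3) => u; rewrite !(mulrA e) !(mulrC e) -!mulrA !(mulrCA _ e); lra.
Qed.

End Measure.

(** * From general integer points to the box of five variables *)

Local Open Scope ring_scope.

(** Writing each variable as the floor of mu i, plus 1, plus an offset puts the new shifts in (0, 1]
    and makes positivity automatic for offsets >= 0. *)
Lemma cube5_shifted_cubes (R : realType) (n : nat) (mu : 'I_n.+4.+1 -> R)
    (t := fun i => (Num.floor (mu i) + 1)%:~R - mu i)
    (P Q : nat) (x : box P Q) :
  exists2 z : 'I_n.+4.+1 -> int, (forall i, mu i < (z i)%:~R) &
  shifted_cubes mu z = cube5 (t (inord 0)) (t (inord 1)) (t (inord 2)) (t (inord 3)) (t (inord 4))
    (\sum_(i < n) t (rshift 5 i) ^+ 3) x.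
Proof.
case: x => [[a k] [[b c] d]].
(* The default 0 of [nth] freezes every variable beyond the fifth at its least admissible value. *)
pose o := [:: (a + P)%N; nat_of_ord k; (b + P)%N; (c + P)%N; (d + P)%N].
exists (fun i => Num.floor (mu i) + 1 + (nth 0%N o i)%:Z) => [i|].
  by apply: lt_le_trans (floorD1_gt _) _; rewrite ler_int lerDl.
have e i : (Num.floor (mu i) + 1 + (nth 0%N o i)%:Z)%:~R - mu i = (nth 0%N o i)%:R + t i.
  by rewrite /t intrD -pmulrn addrAC addrC.
rewrite /shifted_cubes (eq_bigr _ (fun i _ => congr1 (fun u => u ^+ 3) (e i))).
rewrite (@big_split_ord _ _ _ 5 n) /= /cube5 /=; congr (_ + _); last first.
  by apply: eq_bigr => i _; rewrite nth_nil add0r.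
have i5 (i : 'I_5) : t (lshift n i) = t (inord i).
  congr t; apply: val_inj; rewrite /= inordK // (leq_trans (ltn_ord i)) //; exact: leq_addr.
rewrite (eq_bigr (fun i : 'I_5 => ((nth 0%N o i)%:R + t (inord i)) ^+ 3)) => [|i _]; last by rewrite i5.
rewrite !big_ord_recl big_ord0 /= !natrD; ring.
Qed.

Theorem theorem1p3 (R : realType) (s : nat) (hs : (5 <= s)%N) (eta : R)
    (heta : 0 < eta) (mu : 'I_s -> R)
    (hmu : irrational (mu (Ordinal (leq_trans (ltn0Sn 4) hs)))) :
  (fun N : R => fine (lebesgue_measure (exceptional_set eta mu N)))
    =o_ (FilterType (pinfty_nbhs R) _) (fun N : R => N).
Proof.
case: s hs mu hmu => [|[|[|[|[|n]]]]] // hs mu hmu.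
pose t i := (Num.floor (mu i) + 1)%:~R - mu i.
have tb i : 0 <= t i <= 1.
  have /andP[f1 f2] := floor_itv (mu i).
  by rewrite /t subr_ge0 (ltW f2) /= lerBlDl intrD lerD2r.
have C00 : 0 <= \sum_(i < n) t (rshift 5 i) ^+ 3.
  by apply: sumr_ge0 => i _; rewrite exprn_ge0 //; case/andP: (tb (rshift 5 i)).
have it : irr (t (inord 0)).
  have -> : t (inord 0) = (-1)%:~R * mu (inord 0) + (Num.floor (mu (inord 0)) + 1)%:~R.
    by rewrite /t mulN1r addrC.
  apply: irr_affine => //; apply: irrational_irr.
  by rewrite (_ : inord 0 = Ordinal (leq_trans (ltn0Sn 4) hs)) //; apply: val_inj; rewrite /= inordK.
pose V : set R := [set v | exists2 z : 'I_n.+4.+1 -> int, forall i, mu i < (z i)%:~R & shifted_cubes mu z = v].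
have hV P Q (x : box P Q) : V (cube5 (t (inord 0)) (t (inord 1)) (t (inord 2)) (t (inord 3))
    (t (inord 4)) (\sum_(i < n) t (rshift 5 i) ^+ 3) x).
  by have [z z1 z2] := cube5_shifted_cubes mu x; exists z.
have EE N : exceptional_set eta mu N = far V eta `&` `[0, N].
  apply/seteqP; split => [tau [h1 h2]|tau [h1 h2]]; split => //=.
  - move=> v [z z1 <-]; rewrite leNgt; apply/negP => h; apply: h2; exists z; split=> //.
  - move=> [z [z1 z2]]; have := h1 _ (ex_intro2 _ _ z z1 erefl).
    by rewrite leNgt z2.
have mE := measurable_far V eta.
apply/eqoP => e e0.
have [Y hY] := density_zero_of_windows mE
  (far_window it (tb _) (tb _) (tb _) (tb _) (tb _) C00 heta hV) e0.
exists (Num.max 0 Y); split; first exact: num_real.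
move=> N; rewrite gt_max => /andP[N0 YN].
rewrite EE (ger0_norm (ltW N0)) ger0_norm; last by rewrite fine_ge0.
have h := hY N (ltW YN).
rewrite -lee_fin fineK // ge0_fin_numE //; exact: le_lt_trans h (ltry _).
Qed.
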